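(* Let $d\ge1$ and $0<\beta\le\alpha<\frac12$, and let $(-\Delta)^{s}$ denote the operator on $\mathbb R^d$ with Fourier multiplier $|\xi|^{2s}$. Then there exists a constant $C>0$ (depending only on $d,\alpha,\beta$) such that for all $g,h\in C_0^\infty(\mathbb R^d)$, $$ \big\|(-\Delta)^{\alpha}(gh)-g\,(-\Delta)^{\alpha}h-h\,(-\Delta)^{\alpha}g\big\|_{L^2(\mathbb R^d)} \le C\,\big\|(-\Delta)^{\frac{\beta}{2}}h\big\|_{L^2(\mathbb R^d)}\,\|g\|_{L^\infty(\mathbb R^d)}^{\frac{\beta}{2\alpha}}\,\big\|(-\Delta)^{\alpha}g\big\|_{L^\infty(\mathbb R^d)}^{\frac{2\alpha-\beta}{2\alpha}} . $$
   Context: $C_0^\infty(\mathbb R^d)$ is the space of smooth compactly supported functions on $\mathbb R^d$. For $0<s<1$, $(-\Delta)^s$ is the standard fractional Laplacian on $\mathbb R^d$, i.e. $\widehat{(-\Delta)^s u}(\xi)=|\xi|^{2s}\widehat u(\xi)$, with the Fourier transform normalized so that $-\Delta$ has symbol $|\xi|^2$. *)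

(* Defs.v *)
From HB Require Import structures.
From mathcomp Require Import all_boot all_order all_algebra.
From mathcomp Require Import complex.
From mathcomp Require Import all_classical all_reals all_analysis.

Set Implicit Arguments.
Unset Strict Implicit.
Unset Printing Implicit Defensive.

Import Order.TTheory GRing.Theory Num.Theory.
Import numFieldNormedType.Exports.

Local Open Scope classical_set_scope.
Local Open Scope ring_scope.
Local Open Scope complex_scope.

Definition rV_display : measure_display.
Proof. exact. Qed.

Section rV_measurable.
Variables (R : realType) (n : nat).

Definition rV_coord (i : 'I_n) (x : 'rV[R]_n) : measurableTypeR R := x 0 i.

Let rV_set0 : g_sigma_preimage rV_coord set0.
Proof. exact: sigma_algebra0. Qed.

Let rV_setC A : g_sigma_preimage rV_coord A -> g_sigma_preimage rV_coord (~` A).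
Proof. exact: sigma_algebraC. Qed.

Let rV_bigcup (F : (set 'rV[R]_n)^nat) :
  (forall i, g_sigma_preimage rV_coord (F i)) ->
  g_sigma_preimage rV_coord (\bigcup_i F i).
Proof. exact: sigma_algebra_bigcup. Qed.

(* generated by the coordinate maps: the Borel sigma-algebra of R^n *)
HB.instance Definition _ := @isMeasurable.Build rV_display
  'rV[R]_n (g_sigma_preimage rV_coord) rV_set0 rV_setC rV_bigcup.

Lemma measurable_rV_coord (i : 'I_n) : measurable_fun setT (rV_coord i).
Proof.
move=> _ Y mY; rewrite setTI; apply: sub_sigma_algebra => /=.
rewrite -bigcup_seq/=; exists i => /=; first by rewrite mem_index_enum.
by exists Y => //; rewrite setTI.
Qed.

Lemma measurable_fun_rVP d (T : measurableType d) (f : T -> 'rV[R]_n) :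
  (forall i, measurable_fun setT (rV_coord i \o f)) -> measurable_fun setT f.
Proof.
move=> mf _ A mA; rewrite setTI.
have : g_sigma_preimage (fun i => rV_coord i \o f) `<=` measurable.
  apply: smallest_sub; first exact: sigma_algebra_measurable.
  rewrite -bigcup_seq => B [i _] [C mC <-].
  exact: mf.
apply; rewrite g_sigma_preimage_comp; exists A => //.
by rewrite setTI.
Qed.

End rV_measurable.

Section rV_cons.
Variables (R : realType) (n : nat).

Definition rV_cons (p : measurableTypeR R * 'rV[R]_n) : 'rV[R]_n.+1 :=
  row_mx (p.1)%:M p.2.

Lemma measurable_rV_cons : measurable_fun setT rV_cons.
Proof.
apply: measurable_fun_rVP => i.
have [k|k] := fintype.splitP (i : 'I_(1 + n)) => ik.
  rewrite (_ : _ \o _ = fst)//; apply/funext => -[t x] /=.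
  rewrite /rV_coord /rV_cons.
  have -> : i = lshift n k by apply: val_inj.
  by rewrite (@row_mxEl _ 1 1 n) ord1 mxE eqxx mulr1n.
rewrite (_ : _ \o _ = rV_coord k \o snd); last first.
  apply/funext => -[t x] /=; rewrite /rV_coord /rV_cons.
  have -> : i = rshift 1 k by apply: val_inj.
  by rewrite (@row_mxEr _ 1 1 n).
by apply: measurableT_comp => //; exact: measurable_rV_coord.
Qed.

Definition rV_uncons (x : 'rV[R]_n.+1) : measurableTypeR R * 'rV[R]_n :=
  (rV_coord ord0 x, \row_i rV_coord (lift ord0 i) x).

Lemma rV_consK : cancel rV_cons rV_uncons.
Proof.
move=> [t x]; rewrite /rV_uncons /rV_coord /rV_cons /=; congr pair.
  rewrite (_ : ord0 = lshift n (ord0 : 'I_1)); last exact: val_inj.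
  by rewrite (@row_mxEl _ 1 1 n) mxE eqxx mulr1n.
apply/rowP => i; rewrite mxE.
rewrite (_ : lift ord0 i = rshift 1 i); last exact: val_inj.
by rewrite (@row_mxEr _ 1 1 n).
Qed.

Lemma measurable_rV_uncons : measurable_fun setT rV_uncons.
Proof.
apply/measurable_fun_pairP; split; first exact: measurable_rV_coord.
apply: measurable_fun_rVP => i.
rewrite (_ : _ \o _ = rV_coord (lift ord0 i)); first exact: measurable_rV_coord.
by apply/funext => x /=; rewrite /rV_coord mxE.
Qed.

Variable mu : {sigma_finite_measure set 'rV[R]_n -> \bar R}.

Definition lebesgue_cons : set 'rV[R]_n.+1 -> \bar R :=
  pushforward (@lebesgue_measure R \x mu)%E rV_cons.

Let lebesgue_cons0 : lebesgue_cons set0 = 0%E.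
Proof. by rewrite /lebesgue_cons /pushforward preimage_set0 measure0. Qed.

Let lebesgue_cons_ge0 A : (0 <= lebesgue_cons A)%E.
Proof. by rewrite /lebesgue_cons /pushforward; exact: measure_ge0. Qed.

Let lebesgue_cons_sigma_additive : semi_sigma_additive lebesgue_cons.
Proof.
move=> F mF tF mUF; rewrite /lebesgue_cons /pushforward preimage_bigcup.
apply: measure_semi_sigma_additive.
- by move=> k; rewrite -[X in measurable X]setTI; exact: measurable_rV_cons.
- apply/trivIsetP => /= i j _ _ ij; rewrite -preimage_setI.
  by move/trivIsetP : tF => /(_ _ _ _ _ ij) ->//; rewrite preimage_set0.
- by rewrite -preimage_bigcup -[X in measurable X]setTI; exact: measurable_rV_cons.
Qed.

HB.instance Definition _ := isMeasure.Build _ _ _ lebesgue_cons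
  lebesgue_cons0 lebesgue_cons_ge0 lebesgue_cons_sigma_additive.

Let lebesgue_cons_sigma_finite : sigma_finite setT lebesgue_cons.
Proof.
have /sigma_finiteP[F [TF ndF Foo]] := sigma_finiteT (@lebesgue_measure R).
have /sigma_finiteP[G [TG ndG Goo]] := sigma_finiteT mu.
exists (fun k => rV_uncons @^-1` (F k `*` G k)).
  rewrite -preimage_bigcup (_ : \bigcup_k _ = setT) ?preimage_setT//.
  apply/seteqP; split=> // -[x y] _.
  have [i _ Fix] : (\bigcup_k F k) x by rewrite -TF.
  have [j _ Gjy] : (\bigcup_k G k) y by rewrite -TG.
  exists (maxn i j) => //; split.
  - by move: Fix; exact/subsetPset/ndF/leq_maxl.
  - by move: Gjy; exact/subsetPset/ndG/leq_maxr.
move=> k; have [mF Fkoo] := Foo k; have [mG Gkoo] := Goo k; split.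
  rewrite -[X in measurable X]setTI; apply: measurable_rV_uncons => //.
  exact: measurableX.
rewrite /lebesgue_cons /pushforward -comp_preimage.
rewrite (_ : rV_uncons \o rV_cons = id); last first.
  by apply/funext => p /=; rewrite rV_consK.
rewrite preimage_id product_measure1E// lte_mul_pinfty// ge0_fin_numE//.
Qed.

HB.instance Definition _ := Measure_isSigmaFinite.Build _ _ _ lebesgue_cons
  lebesgue_cons_sigma_finite.

End rV_cons.

(* Lebesgue measure on R^n as the n-fold product of the one-dimensional one. *)
Fixpoint lebesgue_rV (R : realType) (n : nat) :
    {sigma_finite_measure set 'rV[R]_n -> \bar R} :=
  match n with
  | 0 => \d_(0 : 'rV[R]_0)
  | m.+1 => lebesgue_cons (lebesgue_rV R m)
  end.

Section test_functions.
Variables (R : realType) (d : nat).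

(* partials [:: i; j; ..] f = d_i d_j .. f *)
Definition partials (s : seq 'I_d) (f : 'rV[R]_d -> R) : 'rV[R]_d -> R :=
  foldr (fun i g => 'D_(delta_mx 0 i) g) f s.

Definition smooth (f : 'rV[R]_d -> R) : Prop :=
  forall s : seq 'I_d, continuous (partials s f) /\
    forall x i, derivable (partials s f) x (delta_mx 0 i).

Definition test_function (f : 'rV[R]_d -> R[i]) : Prop :=
  [/\ smooth (fun x => complex.Re (f x)), smooth (fun x => complex.Im (f x)) &
      compact (closure [set x | f x != 0])].

End test_functions.

Section fractional_laplacian.
Variables (R : realType) (d : nat).
Implicit Types (x xi : 'rV[R]_d) (f u : 'rV[R]_d -> R[i]).

Definition dotrV x xi : R := \sum_i x 0 i * xi 0 i.

(* The norm `|xi| of the library is the sup norm. *)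
Definition enorm xi : R := Num.sqrt (dotrV xi xi).

Definition expi (t : R) : R[i] := cos t +i* sin t.

Definition Cintegral f : R[i] :=
  (\int[lebesgue_rV R d]_x complex.Re (f x)) +i*
  (\int[lebesgue_rV R d]_x complex.Im (f x)).

(* Normalized so that -Delta has symbol |xi|^2. *)
Definition fourier u xi : R[i] :=
  Cintegral (fun x => u x * expi (- dotrV x xi)).

Definition inv_fourier u x : R[i] :=
  ((2 * pi) ^- d)%:C * Cintegral (fun xi => u xi * expi (dotrV x xi)).

(* For a test function u the integrand is integrable, so the inversion integral
   gives the continuous representative of (-Delta)^s u at every point. *)
Definition fracLaplacian (s : R) u : 'rV[R]_d -> R[i] :=
  inv_fourier (fun xi => (enorm xi `^ (2 * s))%:C * fourier u xi).

Definition CLnorm (p : \bar R) f : \bar R :=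
  Lnorm (lebesgue_rV R d) p (fun x => (ComplexField.Normc.normc (f x))%:E).

End fractional_laplacian.

(* Main.v *)
Require Import Defs.
From HB Require Import structures.
From mathcomp Require Import all_boot all_order all_algebra.
From mathcomp Require Import complex ring lra.
From mathcomp Require Import all_classical all_reals all_analysis.
From mathcomp Require Import measurable_realfun ess_sup_inf.

Set Implicit Arguments.
Unset Strict Implicit.
Unset Printing Implicit Defensive.

Import Order.TTheory GRing.Theory Num.Theory.
Import numFieldNormedType.Exports.

Local Open Scope classical_set_scope.
Local Open Scope ring_scope.

(** The proof replaces the commutator by an integral of products of differences
    and estimates the differences. Put [s = 2 alpha], so that [0 < beta < s < 1].

    Subordination. Let [heat tau] be convolution with the Gaussian density
    [gauss tau]. The identity
    [frac_const s * |xi|^s = \int (1 - exp (- tau^2 |xi|^2 / 2)) tau^(- s) d tau / tau]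
    ([frac_scaling]) writes [(- Delta)^(s/2) u] as an integral of [u - heat tau u]
    ([fracLap_heat]). In [gh - heat (gh) - g (h - heat h) - h (g - heat g)] all
    terms recombine ([heat_commutator]), and the commutator becomes, up to a
    constant, the integral of [(g (x + y) - g x) (h (x + y) - h x)] against the
    positive kernel [tau^(- s) gauss tau y] and the measure [(d tau / tau) dy]
    ([commutator_le]).

    Differences. The companion identity for [|xi|^(- s)] recovers a test function
    from its fractional Laplacian ([riesz_heat]). The [L^1] distance of two
    translates of [gauss tau] by [z] is at most [min (2, |z| / tau)], and
    integrating this bound against [tau^s d tau / tau] gives
    [|u (x + z) - u x| <= C |z|^s sup |(- Delta)^(s/2) u|] for [s < 1]
    ([difference_sup]). Minkowski's integral inequality gives the same bound in
    [L^2] ([difference_L2]).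

    Interpolation. Let [M] and [N] be the sup norms of [g] and of its fractional
    Laplacian. Then [|g (x + y) - g x| <= C min (M, N |y|^s)], while the [L^2] norm
    of [h (. + y) - h] is at most [C |y|^beta] times that of
    [(- Delta)^(beta/2) h]. By Minkowski's inequality again, the commutator is
    bounded in [L^2] by the latter norm times the integral of
    [min (M, N |y|^s) |y|^beta] against the kernel. The two terms of the minimum
    balance at the scale [tau = (M / N)^(1/s)], and the integral is at most a multiple
    of [M^(beta/s) N^(1 - beta/s)] ([integral_levy_interp]), which is the claim for
    real functions ([weighted_difference_L2]).

    Throughout, the scale is parametrised by [t = ln tau]: the measure
    [d tau / tau] becomes Lebesgue measure on the line, dilations become
    translations, and the functions of the scale that occur decay exponentially at
    both ends ([integ_two_sided]). The Fourier transform of a real function is handled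
    through the real integrals [ctrans]; the complex functions of the theorem are
    split into real and imaginary parts only at the end ([commutatorE]). *)

(** * Measurability of elementary functions *)

Section measurable_combinators.
Context d (T : measurableType d) (R : realType).
Implicit Types f g : T -> R.
Local Notation mfun f := (measurable_fun setT f).

Lemma mf_cst (c : R) : mfun (fun _ : T => c). Proof. exact: measurable_cst. Qed.

Lemma mf_add f g : mfun f -> mfun g -> mfun (fun x => f x + g x).
Proof. by move=> *; exact: measurable_funD. Qed.

Lemma mf_opp f : mfun f -> mfun (fun x => - f x).
Proof. by move=> *; exact: measurable_funN. Qed.

Lemma mf_mul f g : mfun f -> mfun g -> mfun (fun x => f x * g x).
Proof. by move=> *; exact: measurable_funM. Qed.

Lemma mf_exp f n : mfun f -> mfun (fun x => f x ^+ n).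
Proof. by move=> *; exact: measurable_funX. Qed.

Lemma mf_comp (h : R -> R) f : mfun h -> mfun f -> mfun (fun x => h (f x)).
Proof. by move=> mh mf; exact: measurableT_comp mh mf. Qed.

Lemma mf_expR f : mfun f -> mfun (fun x => expR (f x)).
Proof. by move=> mf; exact: (mf_comp (@measurable_expR R) mf). Qed.

Lemma mf_cos f : mfun f -> mfun (fun x => cos (f x)).
Proof.
move=> mf; apply: (mf_comp _ mf); apply: continuous_measurable_fun => x.
exact: continuous_cos.
Qed.

Lemma mf_sin f : mfun f -> mfun (fun x => sin (f x)).
Proof.
move=> mf; apply: (mf_comp _ mf); apply: continuous_measurable_fun => x.
exact: continuous_sin.
Qed.

Lemma mf_norm f : mfun f -> mfun (fun x => `|f x|).
Proof. by move=> mf; exact: (mf_comp (@normr_measurable R setT) mf). Qed.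

Lemma mf_sqrt f : mfun f -> mfun (fun x => Num.sqrt (f x)).
Proof.
move=> mf; apply: (mf_comp _ mf); apply: continuous_measurable_fun => x.
exact: sqrt_continuous.
Qed.

Lemma mf_powR f s : mfun f -> mfun (fun x => f x `^ s).
Proof. by move=> mf; exact: (mf_comp (measurable_powR _) mf). Qed.

Lemma mf_min f g : mfun f -> mfun g -> mfun (fun x => Num.min (f x) (g x)).
Proof. by move=> *; exact: measurable_minr. Qed.

Lemma mf_inv f : mfun f -> mfun (fun x => (f x)^-1).
Proof.
move=> mf; apply: (mf_comp _ mf) => _ B mB; rewrite setTI.
have -> : (@GRing.inv R) @^-1` B =
    ([set x | x = 0 /\ B 0] `|` ([set~ (0 : R)] `&` @GRing.inv R @^-1` B)).
  apply/seteqP; split => x /=; last by case=> [[->]|[]//]; rewrite invr0.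
  have [->|x0 Bx] := eqVneq x 0; first by rewrite invr0 => B0; left.
  by right; split => //; exact/eqP.
apply: measurableU.
  have [B0|nB0] := pselect (B 0).
    by rewrite (_ : [set x | _] = [set 0])//; apply/seteqP; split=> x //= [].
  by rewrite (_ : [set x | _] = set0)//; apply/seteqP; split=> x //= [].
have mC : measurable [set~ (0:R)] by exact: measurableC.
have : measurable_fun [set~ (0:R)] (@GRing.inv R).
  apply: open_continuous_measurable_fun; first exact/closed_openC/closed_eq.
  by move=> x /set_mem /eqP x0; exact: inv_continuous.
by move=> /(_ mC _ mB).
Qed.

End measurable_combinators.

Section measurable_rV.
Context (R : realType) (n : nat).

Lemma measurable_rV_mxball (x : 'rV[R]_n) (e : R) : measurable (ball x e).
Proof.
have [e0|e0] := leP e 0.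
  rewrite (_ : ball x e = set0)//; apply/seteqP; split=> y //= [].
  by rewrite ltNge e0.
rewrite (_ : ball x e =
    \bigcap_(i in [set: 'I_n]) ((@rV_coord R n i) @^-1` ball (x 0 i) e)).
  apply: fin_bigcap_measurable; first exact: finite_finset.
  move=> i _.
  rewrite -[X in measurable X]setTI; apply: measurable_rV_coord => //.
  exact: measurable_ball.
apply/seteqP; split=> y /=; first by case=> _ + i _; exact.
by move=> H; split=> // i j; rewrite ord1; exact: H.
Qed.

(** The sigma-algebra generated by the coordinates contains every open set
    because the topology has the countable basis of balls with rational
    centre and radius [1/(k+1)]. *)
Lemma open_measurable_rV (U : set 'rV[R]_n) : open U -> measurable U.
Proof.
move=> oU; pose B (p : 'rV[rat]_n * nat) : set 'rV[R]_n :=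
  if pselect (ball (map_mx ratr p.1 : 'rV[R]_n) (p.2.+1%:R^-1) `<=` U)
  then ball (map_mx ratr p.1 : 'rV[R]_n) (p.2.+1%:R^-1) else set0.
have -> : U = \bigcup_p B p.
  apply/seteqP; split=> x; last first.
    by case=> p _; rewrite /B; case: pselect => //= BU; exact: BU.
  move=> Ux; have /nbhs_ballP[e /= e0 eU] : nbhs x U by exact: open_nbhs_nbhs.
  pose k := Num.truncn (2 / e).
  have ke : (k.+1%:R^-1 : R) < e / 2.
    by rewrite invf_plt ?posrE ?divr_gt0// invf_div truncnS_gt.
  have qP i : {q : rat | ball (x 0 i) (k.+1%:R^-1) (ratr q : R)}.
    have : x 0 i - k.+1%:R^-1 < x 0 i + k.+1%:R^-1.
      by rewrite ltrD2l gtrN ?invr_gt0.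
    move=> /rat_in_itvoo/cid[q]; rewrite in_itv/= => /andP[q1 q2].
    by exists q; rewrite /ball/= ltr_distlC q1 q2.
  exists (\row_i projT1 (qP i), k) => //; rewrite /B /=.
  have kx : ball (map_mx ratr (\row_i projT1 (qP i)) : 'rV[R]_n)
      (k.+1%:R^-1) x.
    split; first by rewrite invr_gt0.
    by move=> a i; rewrite ord1 !mxE; apply: ball_sym; case: (qP i).
  case: pselect => //; case=> y yb; apply: eU.
  apply: (@le_ball _ _ _ (k.+1%:R^-1 + k.+1%:R^-1)); last first.
    by apply: ball_triangle (ball_sym kx) yb.
  by rewrite ltW// [ltRHS]splitr ltrD.
apply: countable_bigcupT_measurable.
  exact: (countableP [set: ('rV[rat]_n * nat)%type]).
by move=> p; rewrite /B; case: pselect => ? /=; [exact: measurable_rV_mxball|exact: measurable0].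
Qed.

Lemma continuous_measurable_rV (f : 'rV[R]_n -> R) :
  continuous f -> measurable_fun setT f.
Proof.
move=> /continuousP cf; apply: (measurability _ (RGenOpens.measurableE R)).
move=> _ [_ [a [b ->] <-]]; rewrite setTI; apply: open_measurable_rV.
exact/cf/interval_open.
Qed.

End measurable_rV.

Section measurable_rV_operations.
Context d (T : measurableType d) (R : realType) (n : nat).
Implicit Types f g : T -> 'rV[R]_n.
Local Notation mfun f := (measurable_fun setT f).

Lemma mf_coord f i : mfun f -> mfun (fun x => f x 0 i).
Proof.
by move=> mf; exact: (measurableT_comp (@measurable_rV_coord R n i) mf).
Qed.

Lemma mf_rVP f : (forall i, mfun (fun x => f x 0 i : R)) -> mfun f.
Proof. by move=> mf; apply: measurable_fun_rVP => i; exact: mf. Qed.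

Lemma mf_rV_add f g : mfun f -> mfun g -> mfun (fun x => f x + g x).
Proof.
move=> mf mg; apply: mf_rVP => i; under eq_fun do rewrite mxE.
by apply: mf_add; exact: mf_coord.
Qed.

Lemma mf_rV_opp f : mfun f -> mfun (fun x => - f x).
Proof.
move=> mf; apply: mf_rVP => i; under eq_fun do rewrite mxE.
by apply: mf_opp; exact: mf_coord.
Qed.

Lemma mf_rV_scale (c : T -> R) f :
  mfun c -> mfun f -> mfun (fun x => c x *: f x).
Proof.
move=> mc mf; apply: mf_rVP => i; under eq_fun do rewrite mxE.
by apply: mf_mul => //; exact: mf_coord.
Qed.

Lemma mf_dot f g : mfun f -> mfun g -> mfun (fun x => dotrV (f x) (g x)).
Proof.
move=> mf mg; apply: measurable_sum => i.
by apply: mf_mul; exact: mf_coord.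
Qed.

Lemma mf_enorm f : mfun f -> mfun (fun x => enorm (f x)).
Proof. by move=> mf; apply: mf_sqrt; exact: mf_dot. Qed.

End measurable_rV_operations.

Lemma mf_fst d1 d2 (T1 : measurableType d1) (T2 : measurableType d2) :
  measurable_fun setT (fun p : T1 * T2 => p.1).
Proof. exact: measurable_fst. Qed.

Lemma mf_snd d1 d2 (T1 : measurableType d1) (T2 : measurableType d2) :
  measurable_fun setT (fun p : T1 * T2 => p.2).
Proof. exact: measurable_snd. Qed.

Ltac meas_step := first
  [ assumption
  | apply: mf_cst | apply: mf_fst | apply: mf_snd | apply: measurable_id
  | apply: mf_add | apply: mf_opp | apply: mf_mul | apply: mf_exp
  | apply: mf_inv
  | apply: mf_expR | apply: mf_cos | apply: mf_sin | apply: mf_norm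
  | apply: mf_powR | apply: mf_sqrt | apply: mf_min
  | apply: mf_dot | apply: mf_enorm
  | apply: mf_rV_add | apply: mf_rV_opp | apply: mf_rV_scale
  | apply: mf_coord | apply: measurable_cst ].
Ltac meas := repeat meas_step.

(** * Real-valued integrals *)

Section real_integrals.
Context d (T : measurableType d) (R : realType).
Variable mu : {measure set T -> \bar R}.
Implicit Types f g : T -> R.
Local Notation integ f := (mu.-integrable setT (EFin \o f)).
Local Notation mfun f := (measurable_fun setT f).

Lemma integ_meas f : integ f -> mfun f.
Proof. by move=> /measurable_int/measurable_EFinP. Qed.

Lemma integ_le f g : mfun f -> integ g -> (forall x, `|f x| <= g x) -> integ f.
Proof.
move=> mf ig fg; apply: (le_integrable _ _ _ ig) => //.
  exact/measurable_EFinP.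
by move=> x _ /=; rewrite lee_fin (le_trans (fg x))// ler_norm.
Qed.

Lemma integ_add f g : integ f -> integ g -> integ (fun x => f x + g x).
Proof. by move=> intf intg; exact: (integrableD _ intf intg). Qed.

Lemma integ_opp f : integ f -> integ (fun x => - f x).
Proof. by move=> intf; exact: (integrableN intf). Qed.

Lemma integ_sub f g : integ f -> integ g -> integ (fun x => f x - g x).
Proof. by move=> intf intg; apply: integ_add => //; exact: integ_opp. Qed.

Lemma integ_mull c f : integ f -> integ (fun x => c * f x).
Proof. by move=> intf; exact: (integrableZl _ c intf). Qed.

Lemma integ_mulr c f : integ f -> integ (fun x => f x * c).
Proof. by move=> /(integ_mull c); under eq_fun do rewrite mulrC. Qed.

Lemma integ_abs f : integ f -> integ (fun x => `|f x|).
Proof. by move=> intf; exact: (integrable_abse intf). Qed.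

Lemma integ_boundl c g f : (forall x, `|g x| <= c) -> mfun g -> integ f ->
  integ (fun x => g x * f x).
Proof.
move=> gc mg intf; apply: (@integ_le _ (fun x => c * `|f x|)).
- by apply: mf_mul => //; exact: integ_meas.
- exact/integ_mull/integ_abs.
- by move=> x; rewrite normrM ler_wpM2r.
Qed.

Lemma ge0_integ f : mfun f -> (forall x, 0 <= f x) ->
  (\int[mu]_x (f x)%:E < +oo)%E -> integ f.
Proof.
move=> mf f0 fy; apply/integrableP; split; first exact/measurable_EFinP.
by under eq_integral do rewrite /= ger0_norm//.
Qed.

Lemma integ_lty f : integ f -> (\int[mu]_x `|f x|%:E < +oo)%E.
Proof. by move=> /integrableP[]. Qed.

Lemma EFin_Rint f : integ f -> (\int[mu]_x f x)%:E = (\int[mu]_x (f x)%:E)%E.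
Proof. by move=> intf; rewrite /Rintegral fineK//; exact: integrable_fin_num. Qed.

Lemma Rint_add f g : integ f -> integ g ->
  \int[mu]_x (f x + g x) = \int[mu]_x f x + \int[mu]_x g x.
Proof. by move=> intf intg; rewrite RintegralD. Qed.

Lemma Rint_sub f g : integ f -> integ g ->
  \int[mu]_x (f x - g x) = \int[mu]_x f x - \int[mu]_x g x.
Proof. by move=> intf intg; rewrite RintegralB. Qed.

Lemma Rint_mull c f : integ f ->
  \int[mu]_x (c * f x) = c * \int[mu]_x f x.
Proof. by move=> intf; rewrite RintegralZl. Qed.

Lemma Rint_mulr c f : integ f ->
  \int[mu]_x (f x * c) = \int[mu]_x f x * c.
Proof. by move=> intf; rewrite RintegralZr. Qed.

Lemma Rint_opp f : integ f -> \int[mu]_x (- f x) = - \int[mu]_x f x.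
Proof.
move=> intf; under eq_Rintegral do rewrite -mulN1r.
by rewrite Rint_mull// mulN1r.
Qed.

Lemma Rint_le f g : integ f -> integ g -> (forall x, f x <= g x) ->
  \int[mu]_x f x <= \int[mu]_x g x.
Proof. by move=> intf intg fg; apply: le_Rintegral. Qed.

Lemma normr_Rint_le f : mfun f ->
  (`|\int[mu]_x f x|%:E <= \int[mu]_x `|f x|%:E)%E.
Proof.
move=> mf; have [fy|] := eqVneq (\int[mu]_x `|f x|%:E)%E +oo%E.
  by rewrite fy leey.
rewrite -ltey => fy.
have intf : integ f by apply/integrableP; split => //; exact/measurable_EFinP.
by rewrite EFin_normr_Rintegral//; exact: le_abse_integral (measurable_int _ intf).
Qed.

Lemma normr_Rint_leR f : integ f ->
  `|\int[mu]_x f x| <= \int[mu]_x `|f x|.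
Proof. by move=> intf; exact: le_normr_Rintegral. Qed.

Lemma Rint_cvg (f_ : nat -> T -> R) f g : (forall n, mfun (f_ n)) ->
  (forall x, f_ n x @[n --> \oo] --> f x) -> integ g ->
  (forall n x, `|f_ n x| <= g x) ->
  \int[mu]_x f_ n x @[n --> \oo] --> \int[mu]_x f x.
Proof.
move=> mf_ f_f intg f_g.
have mf : mfun f.
  by apply: (measurable_fun_cvg mf_) => x _; exact: f_f.
have intf : integ f.
  apply: (integ_le mf intg) => x.
  apply: (@cvgr_to_le _ \oo _ _ (fun n => `|f_ n x|)).
    exact: cvg_norm (f_f x).
  by apply: nearW => n; exact: f_g.
apply: fine_cvg; rewrite EFin_Rint//.
apply: (@dominated_cvg _ _ _ mu setT measurableT (fun n => EFin \o f_ n)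
  (EFin \o f) (EFin \o g)) => //.
- by move=> n; exact/measurable_EFinP.
- by move=> x _; apply/cvg_EFin; [exact: nearW|exact: f_f].
- by move=> n x _; rewrite lee_fin.
Qed.

End real_integrals.

Section real_fubini.
Context d1 d2 (T1 : measurableType d1) (T2 : measurableType d2) (R : realType).
Variables (m1 : {sigma_finite_measure set T1 -> \bar R})
  (m2 : {sigma_finite_measure set T2 -> \bar R}).
Implicit Type f : T1 * T2 -> R.
Local Notation integ m f := (m.-integrable setT (EFin \o f)).

Lemma integ_prod f (phi : T1 -> R) : measurable_fun setT f -> integ m1 phi ->
  (forall x, (\int[m2]_y `|f (x, y)|%:E <= (phi x)%:E)%E) ->
  integ (m1 \x m2)%E f.
Proof.
move=> mf iphi fphi; apply/integrable12ltyP; first exact/measurable_EFinP.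
apply: (@le_lt_trans _ _ (\int[m1]_x `|phi x|%:E)%E); last exact: integ_lty.
apply: ge0_le_integral => //.
- by move=> x _; exact: integral_ge0.
- apply: (measurable_fun_fubini_tonelli_F (fun z => `|f z|%:E)) => //.
  by apply/measurable_EFinP; exact: mf_norm.
- by apply/measurable_EFinP; apply: mf_norm; exact: integ_meas iphi.
- by move=> x _; apply: (le_trans (fphi x)); rewrite lee_fin ler_norm.
Qed.

Lemma measurable_Rint f : measurable_fun setT f ->
  measurable_fun setT (fun x => \int[m2]_y f (x, y)).
Proof.
move=> mf; apply: (measurableT_comp (@fine_measurable R setT measurableT)) => //=.
under eq_fun do rewrite integralE.
have mF : measurable_fun setT (EFin \o f) by exact/measurable_EFinP.
apply: emeasurable_funB.
  rewrite (_ : (fun _ => _) = fubini_F m2 (EFin \o f)^\+%E).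
    by apply: measurable_fun_fubini_tonelli_F => [|x];
      [exact: measurable_funepos|exact: funepos_ge0].
  by apply/funext => x; rewrite /fubini_F; apply: eq_integral => y _; rewrite ?funeposE ?funenegE.
rewrite (_ : (fun _ => _) = fubini_F m2 (EFin \o f)^\-%E).
  by apply: measurable_fun_fubini_tonelli_F => [|x];
    [exact: measurable_funeneg|exact: funeneg_ge0].
by apply/funext => x; rewrite /fubini_F; apply: eq_integral => y _; rewrite ?funeposE ?funenegE.
Qed.

Lemma measurable_Rint_swap (f : T2 * T1 -> R) : measurable_fun setT f ->
  measurable_fun setT (fun x => \int[m2]_y f (y, x)).
Proof.
move=> mf; apply: (@measurable_Rint (fun p => f (p.2, p.1))).
by apply: (measurableT_comp mf); apply: measurable_fun_pair.
Qed.

Lemma Rint_prod1 f : integ (m1 \x m2)%E f ->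
  integ m1 (fun x => \int[m2]_y f (x, y)) /\
  \int[(m1 \x m2)%E]_z f z = \int[m1]_x \int[m2]_y f (x, y).
Proof.
move=> intf; have mf := integ_meas intf.
have iF := integrable_fubini_F intf.
have aeF : ae_eq m1 setT (EFin \o (fun x => \int[m2]_y f (x, y)))
    (fubini_F m2 (EFin \o f)).
  apply: filterS (integrable_ae measurableT iF) => x /= xfin _.
  by rewrite /Rintegral fineK//; exact: xfin.
have mR : measurable_fun setT (EFin \o (fun x => \int[m2]_y f (x, y))).
  by apply/measurable_EFinP; exact: measurable_Rint.
split.
  apply/integrableP; split => //.
  rewrite (ae_eq_integral (fun x => `|fubini_F m2 (EFin \o f) x|%E))//.
  - by case/integrableP: iF.
  - exact: measurableT_comp.
  - by apply: measurableT_comp => //; exact: measurable_int iF.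
  - by apply: filterS aeF => x H _; exact: (congr1 abse (H Logic.I)).
rewrite /Rintegral -(integral12_prod_meas1 intf); congr fine.
by apply/esym/ae_eq_integral => //; exact: measurable_int iF.
Qed.

End real_fubini.

Lemma Rint_Fubini d1 d2 (T1 : measurableType d1) (T2 : measurableType d2)
    (R : realType) (m1 : {sigma_finite_measure set T1 -> \bar R})
    (m2 : {sigma_finite_measure set T2 -> \bar R}) (f : T1 * T2 -> R) :
  (m1 \x m2)%E.-integrable setT (EFin \o f) ->
  m2.-integrable setT (EFin \o (fun y => \int[m1]_x f (x, y))) /\
  \int[m1]_x \int[m2]_y f (x, y) = \int[m2]_y \int[m1]_x f (x, y).
Proof.
move=> intf; have mf := integ_meas intf.
pose g (p : T2 * T1) := f (p.2, p.1).
have mg : measurable_fun setT g.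
  by apply: (measurableT_comp mf); apply: measurable_fun_pair.
have intg : (m2 \x m1)%E.-integrable setT (EFin \o g).
  apply/integrable12ltyP; first exact/measurable_EFinP.
  by move/integrable21ltyP : intf; apply; exact/measurable_EFinP.
have [ig gE] := Rint_prod1 intg; have [_ fE] := Rint_prod1 intf.
split; first exact: ig.
rewrite -fE -[RHS]gE /Rintegral; congr fine.
rewrite -(integral12_prod_meas1 intf) -(integral12_prod_meas1 intg).
exact: (Fubini intf).
Qed.

(** * Translation and reflection of Lebesgue measure *)

Section lebesgue_invariance.
Context (R : realType).
Implicit Type F : R -> \bar R.
Local Notation leb := (@lebesgue_measure R).

Lemma ge0_integral_lebesgue_shift F (c : R) : measurable_fun setT F ->
  (forall t, 0 <= F t)%E ->
  (\int[leb]_t F (t + c)%R = \int[leb]_t F t)%E.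
Proof.
move=> mF F0; pose phi : measurableTypeR R -> measurableTypeR R := fun t => (t : R) + c.
have mphi : measurable_fun setT phi by apply: measurable_funD; [exact: measurable_id|exact: measurable_cst].
rewrite -[LHS](@ge0_integral_pushforward _ _ _ _ _ phi mphi leb setT F)//.
apply: eq_measure_integral => A mA _; apply/esym.
apply: (@lebesgue_measure_unique _ (pushforward leb phi)) => //.
move=> _ [[a b]] _ <-; transitivity (leb `](a - c), (b - c)]%classic).
  rewrite !lebesgue_measure_itv/= !lte_fin ltrD2r.
  by case: ifPn => // _; rewrite -!EFinD; congr EFin; ring.
congr leb; apply/seteqP; split=> x;
  by rewrite /pushforward /phi/= !in_itv/= ltrBlDr lerBrDr.
Qed.

Lemma ge0_integral_lebesgue_opp F : measurable_fun setT F ->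
  (forall t, 0 <= F t)%E -> (\int[leb]_t F (- t)%R = \int[leb]_t F t)%E.
Proof.
move=> mF F0; pose phi : measurableTypeR R -> measurableTypeR R := fun t => - (t : R).
have mphi : measurable_fun setT phi by exact: oppr_measurable.
rewrite -[LHS](@ge0_integral_pushforward _ _ _ _ _ phi mphi leb setT F)//.
by apply: eq_measure_integral => A mA _; exact: lebesgue_measureN.
Qed.

End lebesgue_invariance.

Section rV_cons_integral.
Context (R : realType).
Local Notation leb := (@lebesgue_measure R).
Local Notation mu := (lebesgue_rV R).

Lemma ge0_integral_rV_cons n (F : 'rV[R]_n.+1 -> \bar R) :
  measurable_fun setT F -> (forall x, 0 <= F x)%E ->
  (\int[mu n.+1]_x F x = \int[leb]_t \int[mu n]_x F (rV_cons (t, x)))%E.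
Proof.
move=> mF F0.
have mG : measurable_fun setT (F \o @rV_cons R n).
  by apply: measurableT_comp => //; exact: measurable_rV_cons.
rewrite -(fubini_tonelli1 (F \o @rV_cons R n))//=.
exact: (ge0_integral_pushforward (@measurable_rV_cons R n)).
Qed.

Lemma rV_consE0 n t (x : 'rV[R]_n) : (rV_cons (t, x)) 0 0 = t.
Proof. exact: (congr1 fst (rV_consK (t, x))). Qed.

Lemma rV_consE_lift n t (x : 'rV[R]_n) i :
  (rV_cons (t, x)) 0 (lift ord0 i) = x 0 i.
Proof.
by have /(congr1 snd)/rowP/(_ i) := rV_consK (t, x); rewrite mxE.
Qed.

Lemma rV_cons_eta n (x : 'rV[R]_n.+1) :
  x = rV_cons (x 0 0, \row_i x 0 (lift ord0 i)).
Proof.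
apply/rowP => i; case: (unliftP 0 i) => [j ->|->]; last by rewrite rV_consE0.
by rewrite rV_consE_lift mxE.
Qed.

(** By induction on the dimension, one coordinate at a time. *)
Lemma ge0_integral_rV_shift n (F : 'rV[R]_n -> \bar R) (z : 'rV[R]_n) :
  measurable_fun setT F -> (forall x, 0 <= F x)%E ->
  (\int[mu n]_x F (x + z)%R = \int[mu n]_x F x)%E.
Proof.
elim: n F z => [|n IH] F z mF F0.
  by apply: eq_integral => x _; congr F; apply/rowP => -[].
have mFz : measurable_fun setT (fun x : 'rV[R]_n.+1 => F (x + z)).
  apply: (measurableT_comp mF).
  by apply: mf_rV_add; [exact: measurable_id|exact: measurable_cst].
rewrite (ge0_integral_rV_cons mF F0) (ge0_integral_rV_cons mFz (fun x => F0 _)).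
pose z' : 'rV[R]_n := \row_i z 0 (lift ord0 i).
have E t x : rV_cons (t, x) + z = rV_cons (t + z 0 0, x + z').
  apply/rowP => i; rewrite mxE; case: (unliftP 0 i) => [j ->|->].
    by rewrite !rV_consE_lift !mxE.
  by rewrite !rV_consE0.
have mFc : measurable_fun setT (fun p => F (rV_cons p)).
  by apply: measurableT_comp => //; exact: measurable_rV_cons.
transitivity (\int[leb]_t \int[mu n]_x F (rV_cons (t + z 0 0, x))%R)%E.
  apply: eq_integral => t _; under eq_integral do rewrite E.
  apply: (IH (fun x => F (rV_cons (t + z 0 0, x)))) => //.
  exact: (measurableT_comp mFc (pair1_measurable _)).
apply: (ge0_integral_lebesgue_shift
  (F := fun t => (\int[mu n]_x F (rV_cons (t, x)))%E)).
  exact: (measurable_fun_fubini_tonelli_F (fun p => F (rV_cons p))).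
by move=> t; exact: integral_ge0.
Qed.

Lemma ge0_integral_rV_opp n (F : 'rV[R]_n -> \bar R) :
  measurable_fun setT F -> (forall x, 0 <= F x)%E ->
  (\int[mu n]_x F (- x)%R = \int[mu n]_x F x)%E.
Proof.
elim: n F => [|n IH] F mF F0.
  by apply: eq_integral => x _; congr F; apply/rowP => -[].
have mFz : measurable_fun setT (fun x : 'rV[R]_n.+1 => F (- x)).
  by apply: (measurableT_comp mF); apply: mf_rV_opp; exact: measurable_id.
rewrite (ge0_integral_rV_cons mF F0) (ge0_integral_rV_cons mFz (fun x => F0 _)).
have E t (x : 'rV[R]_n) : - rV_cons (t, x) = rV_cons (- t, - x).
  apply/rowP => i; rewrite mxE; case: (unliftP 0 i) => [j ->|->].
    by rewrite !rV_consE_lift !mxE.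
  by rewrite !rV_consE0.
have mFc : measurable_fun setT (fun p => F (rV_cons p)).
  by apply: measurableT_comp => //; exact: measurable_rV_cons.
transitivity (\int[leb]_t \int[mu n]_x F (rV_cons (- t, x))%R)%E.
  apply: eq_integral => t _; under eq_integral do rewrite E.
  apply: (IH (fun x => F (rV_cons (- t, x)))) => //.
  exact: (measurableT_comp mFc (pair1_measurable _)).
apply: (ge0_integral_lebesgue_opp
  (F := fun t => (\int[mu n]_x F (rV_cons (t, x)))%E)).
  exact: (measurable_fun_fubini_tonelli_F (fun p => F (rV_cons p))).
by move=> t; exact: integral_ge0.
Qed.

Lemma measurable_hyperplane n (i : 'I_n) (c : R) :
  measurable [set x : 'rV[R]_n | x 0 i = c].
Proof.
have := @measurable_rV_coord R n i measurableT _ (measurable_set1 c).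
by rewrite setTI.
Qed.

Lemma measurable_rV_set1 n (z : 'rV[R]_n) : measurable [set z].
Proof.
rewrite (_ : [set z] = \bigcap_(i in [set: 'I_n])
    [set x : 'rV[R]_n | x 0 i = z 0 i]).
  apply: fin_bigcap_measurable; first exact: finite_finset.
  by move=> i _; exact: measurable_hyperplane.
apply/seteqP; split=> x /=; first by move=> ->.
by move=> H; apply/rowP => i; exact: H.
Qed.

(** The singleton is negligible only in positive dimension; in dimension 0
    the measure is a Dirac mass. *)
Lemma lebesgue_rV_set1 n (z : 'rV[R]_n.+1) : mu n.+1 [set z] = 0%E.
Proof.
have mH := measurable_hyperplane (0 : 'I_n.+1) (z 0 0).
have mz := measurable_rV_set1 z.
apply/eqP; rewrite -measure_le0.
apply: (@le_trans _ _ (mu n.+1 [set x : 'rV[R]_n.+1 | x 0 0 = z 0 0])).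
  by apply: le_measure; rewrite ?inE// => x /= ->.
have -> : mu n.+1 [set x : 'rV[R]_n.+1 | x 0 0 = z 0 0] =
    (\int[mu n.+1]_x (\1_[set x : 'rV[R]_n.+1 | x 0 0 = z 0 0] x)%:E)%E.
  by rewrite integral_indic// setIT.
rewrite ge0_integral_rV_cons//; last first.
  by apply/measurable_EFinP; exact: measurable_indic.
rewrite (_ : (fun t => _) = fun t => ((\1_[set z 0 0] t)%:E * mu n setT)%E).
  rewrite ge0_integralZr//; last first.
    by apply/measurable_EFinP; exact: measurable_indic.
  rewrite integral_indic// setIT [X in (X * _)%E](_ : _ = 0%E) ?mul0e//.
  exact: lebesgue_measure_set1.
apply/funext => t; rewrite -integral_cst//; apply: eq_integral => x _.
rewrite /= !indicE; congr ((nat_of_bool _)%:R%:E); apply/idP/idP; rewrite !inE /=.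
  by rewrite rV_consE0.
by rewrite rV_consE0.
Qed.

End rV_cons_integral.

(** An equality between integrals of nonnegative functions passes to signed
    functions through the positive and negative parts. *)
Section measure_preserving.
Context d (T : measurableType d) (R : realType).
Variables (mu : {measure set T -> \bar R}) (phi : T -> T).
Hypothesis phiE : forall F : T -> \bar R, measurable_fun setT F ->
  (forall x, 0 <= F x)%E -> (\int[mu]_x F (phi x) = \int[mu]_x F x)%E.
Implicit Type f : T -> R.
Local Notation integ f := (mu.-integrable setT (EFin \o f)).

Lemma integ_measure_preserving f : measurable_fun setT phi ->
  integ f -> integ (fun x => f (phi x)).
Proof.
move=> mphi intf; have mf := integ_meas intf.
apply/integrableP; split.
  by apply/measurable_EFinP; exact: measurableT_comp.
rewrite (phiE (F := fun x => `|f x|%:E))//; first exact: integ_lty.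
by apply/measurable_EFinP; exact: mf_norm.
Qed.

Lemma Rint_measure_preserving f : measurable_fun setT f ->
  \int[mu]_x f (phi x) = \int[mu]_x f x.
Proof.
move=> mf; rewrite /Rintegral integralE [in RHS]integralE.
have mF : measurable_fun setT (EFin \o f) by exact/measurable_EFinP.
rewrite -(phiE (F := (EFin \o f)^\+%E)); last 2 first.
  exact: measurable_funepos.
  by move=> x; exact: funepos_ge0.
rewrite -(phiE (F := (EFin \o f)^\-%E)); last 2 first.
  exact: measurable_funeneg.
  by move=> x; exact: funeneg_ge0.
by congr (fine (_ - _)); apply: eq_integral => x _;
  rewrite ?funeposE ?funenegE.
Qed.

Lemma Rint_odd f : integ f -> (forall x, f (phi x) = - f x) ->
  \int[mu]_x f x = 0.
Proof.
move=> intf fN; have := Rint_measure_preserving (integ_meas intf).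
under eq_Rintegral do rewrite fN.
by rewrite Rint_opp// => H; lra.
Qed.

End measure_preserving.

Section signed_invariance.
Context (R : realType) (n : nat).
Local Notation leb := (@lebesgue_measure R).
Local Notation mu := (lebesgue_rV R n).
Implicit Type f : 'rV[R]_n -> R.
Local Notation integ f := (mu.-integrable setT (EFin \o f)).

Let m_shift z : measurable_fun setT (fun x : 'rV[R]_n => x + z).
Proof. by apply: mf_rV_add; [exact: measurable_id|exact: measurable_cst]. Qed.

Lemma integ_shift f z : integ f -> integ (fun x => f (x + z)).
Proof.
move=> intf; apply: (@integ_measure_preserving _ _ _ mu (fun x => x + z) _ f) => //.
move=> F mF F0.
exact: ge0_integral_rV_shift.
Qed.

Lemma Rint_shift f z : measurable_fun setT f ->
  \int[mu]_x f (x + z) = \int[mu]_x f x.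
Proof.
move=> mf.
apply: (@Rint_measure_preserving _ _ _ mu (fun x => x + z) _ f) => // F mF F0.
exact: ge0_integral_rV_shift.
Qed.

Lemma Rint_rV_odd f : integ f -> (forall x, f (- x) = - f x) ->
  \int[mu]_x f x = 0.
Proof.
move=> intf fN.
apply: (@Rint_odd _ _ _ mu (fun x => - x) _ f) => // F mF F0.
exact: ge0_integral_rV_opp.
Qed.

Lemma Rint_lebesgue_shift (f : R -> R) c : measurable_fun setT f ->
  \int[leb]_t f (t + c) = \int[leb]_t f t.
Proof.
move=> mf.
apply: (@Rint_measure_preserving _ _ _ leb (fun t => (t : R) + c) _ f) => //.
by move=> F mF F0; exact: ge0_integral_lebesgue_shift.
Qed.

End signed_invariance.

(** * Integrals over the line *)

Section one_dimensional_integrals.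
Context (R : realType).
Local Notation leb := (@lebesgue_measure R).
Local Notation integ f := (leb.-integrable setT (EFin \o f)).
Implicit Types f phi : R -> R.

Lemma integ_oneDsqrV : integ (fun t : R => (1 + t ^+ 2)^-1).
Proof.
have ge0 (t : R) : 0 <= (1 + t ^+ 2)^-1 by rewrite invr_ge0 addr_ge0// sqr_ge0.
apply: ge0_integ => //.
  by apply: mf_inv; apply: mf_add; [exact: mf_cst|apply: mf_exp; exact: measurable_id].
rewrite ge0_symfun_integralT//; last 2 first.
- exact: continuous_oneDsqrV.
- by move=> t /=; rewrite sqrrN.
by rewrite -set_itvcy integral0y_oneDsqr -EFinM ltry.
Qed.

Lemma expR_ge_sqr (x : R) : 0 <= x -> x ^+ 2 / 2 <= expR x.
Proof.
by move=> /(expR_ge1Dxn 1); apply: le_trans; rewrite lerDr.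
Qed.

Lemma integ_expRN_abs (a : R) : 0 < a -> integ (fun t => expR (- (a * `|t|))).
Proof.
move=> a0; pose c := 1 + 2 / a ^+ 2.
apply: (@integ_le _ _ _ leb _ (fun t => c * (1 + t ^+ 2)^-1)).
- apply: mf_expR; apply: mf_opp; apply: mf_mul; first exact: mf_cst.
  by apply: mf_norm; exact: measurable_id.
- exact/integ_mull/integ_oneDsqrV.
move=> t; rewrite ger0_norm ?expR_ge0// expRN.
have at0 : 0 <= a * `|t| by rewrite mulr_ge0// ltW.
have E1 : 1 <= expR (a * `|t|) by rewrite -expR0 ler_expR.
have E2 := expR_ge_sqr at0.
have t2 : 0 < 1 + t ^+ 2 by rewrite ltr_pwDl// sqr_ge0.
set E := expR _ in E1 E2 *; have E0 : 0 < E by exact: expR_gt0.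
rewrite ler_pdivlMr// [leLHS]mulrC ler_pdivrMr//.
have -> : t ^+ 2 = (2 / a ^+ 2) * ((a * `|t|) ^+ 2 / 2).
  by rewrite exprMn real_normK ?num_real//; field; rewrite gt_eqF.
rewrite /c; have : 0 <= 2 / a ^+ 2 by rewrite divr_ge0// sqr_ge0.
move: (2 / a ^+ 2) => k k0; rewrite mulrDl mul1r lerD//.
exact: ler_wpM2l.
Qed.

(** The typical integrand in the logarithmic variable [t = ln tau]: decay at
    both ends at an exponential rate. *)
Lemma integ_two_sided phi (C a b : R) : 0 < a -> 0 < b ->
  measurable_fun setT phi -> (forall t, 0 <= phi t) ->
  (forall t, phi t <= C * expR (a * t)) ->
  (forall t, phi t <= C * expR (- (b * t))) -> integ phi.
Proof.
move=> a0 b0 mphi phi0 phia phib; pose c := Num.min a b.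
have c0 : 0 < c by rewrite lt_min a0.
have C0 : 0 <= C.
  by rewrite -(@pmulr_lge0 _ (expR (a * 0))) ?expR_gt0// (le_trans _ (phia 0)).
apply: (@integ_le _ _ _ leb _ (fun t => C * expR (- (c * `|t|)))) => //.
  exact/integ_mull/integ_expRN_abs.
move=> t; rewrite ger0_norm//; have [t0|t0] := leP 0 t.
  apply: (le_trans (phib t)); rewrite ger0_norm// ler_wpM2l// ler_expR lerN2.
  by rewrite ler_wpM2r// ge_min lexx orbT.
apply: (le_trans (phia t)); rewrite ltr0_norm// ler_wpM2l// ler_expR mulrN opprK.
by apply: ler_wnM2r; [exact: ltW|rewrite ge_min lexx].
Qed.

Lemma Rint_gt0 phi : integ phi -> (forall t, 0 < phi t) ->
  0 < \int[leb]_t phi t.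
Proof.
move=> iphi phi0; rewrite lt0r Rintegral_ge0 ?andbT; last by move=> t _; exact: ltW.
apply/eqP => H.
have : (\int[leb]_t `|(phi t)%:E| = 0)%E.
  under eq_integral do rewrite /= gtr0_norm//.
  by rewrite -EFin_Rint// H.
move/ae_eq_integral_abs => /(_ measurableT (measurable_int _ iphi)).
case=> N [mN N0 sub].
have : (leb setT <= leb N)%E.
  apply: le_measure; rewrite ?inE// => t _; apply: sub => /= /(_ I).
  by move=> [] /eqP; rewrite gt_eqF.
by rewrite N0 -set_itvNyy lebesgue_measure_itv.
Qed.

(** Fundamental theorem of calculus on the whole line for a primitive that
    vanishes at infinity. *)
Lemma Rint_derive_eq0 (psi dpsi : R -> R) :
  (forall t : R, is_derive t 1 psi (dpsi t)) -> continuous dpsi -> integ dpsi ->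
  psi n%:R @[n --> \oo] --> (0 : R) -> psi (- n%:R) @[n --> \oo] --> (0 : R) ->
  \int[leb]_t dpsi t = 0.
Proof.
move=> dp cd id p1 p2.
pose f_ (n : nat) := dpsi \_ `[- n.+1%:R, n.+1%:R].
have H : \int[leb]_t f_ n t @[n --> \oo] --> \int[leb]_t dpsi t.
  apply: (@Rint_cvg _ _ _ leb f_ dpsi (fun t => `|dpsi t|)).
  - move=> n; apply/measurable_restrict => //.
    by apply: measurable_funTS; exact: continuous_measurable_fun.
  - move=> t; apply: cvg_near_cst.
    near=> n; rewrite /f_ patchE ifT// inE/= in_itv/= -ler_norml.
    have : `|t| <= n%:R by near: n; exact: nbhs_infty_ger.
    by move=> /le_trans; apply; rewrite ler_nat.
  - exact: integ_abs.
  - by move=> n t; rewrite /f_ patchE; case: ifPn => // _; rewrite normr0.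
suff E : \int[leb]_t f_ n t @[n --> \oo] --> (0 : R).
  exact: cvg_unique H E.
have -> : (fun n => \int[leb]_t f_ n t) =
    (fun n => psi n.+1%:R - psi (- n.+1%:R)).
  apply/funext => n; rewrite -Rintegral_mkcond /Rintegral.
  have p1x (t : R) : derivable psi t 1 by case: (dp t).
  have cpsi : continuous psi.
    by move=> t; apply/differentiable_continuous/derivable1_diffP.
  rewrite (@continuous_FTC2 _ dpsi psi)//.
  - by rewrite gtrN.
  - exact: continuous_subspaceT.
  - split=> [t _//||]; first by apply: cvg_at_right_filter; exact: cpsi.
    by apply: cvg_at_left_filter; exact: cpsi.
  - by move=> t _; rewrite derive1E; case: (dp t).
rewrite -[X in _ --> X](subrr 0).
apply: cvgB.
  by rewrite (cvg_shiftS (fun n => psi n%:R)).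
by rewrite (cvg_shiftS (fun n => psi (- n%:R))).
Unshelve. all: by end_near. Qed.

End one_dimensional_integrals.

(** * Oscillatory integrals and the inner product *)

Section bounded_oscillation.
Context d (T : measurableType d) (R : realType).
Variable mu : {measure set T -> \bar R}.
Implicit Types f w : T -> R.
Local Notation integ f := (mu.-integrable setT (EFin \o f)).

Lemma integ_cos w f : measurable_fun setT w -> integ f ->
  integ (fun x => cos (w x) * f x).
Proof.
move=> mw; apply: (@integ_boundl _ _ _ mu 1); last exact: mf_cos.
by move=> x; exact: cos_max.
Qed.

Lemma integ_sin w f : measurable_fun setT w -> integ f ->
  integ (fun x => sin (w x) * f x).
Proof.
move=> mw; apply: (@integ_boundl _ _ _ mu 1); last exact: mf_sin.
by move=> x; exact: sin_max.
Qed.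

End bounded_oscillation.

Section dot_product.
Context (R : realType) (n : nat).
Implicit Types x y z : 'rV[R]_n.

Lemma dotrVC x y : dotrV x y = dotrV y x.
Proof. by apply: eq_bigr => i _; rewrite mulrC. Qed.

Lemma dotrVDl x y z : dotrV (x + y) z = dotrV x z + dotrV y z.
Proof. by rewrite -big_split; apply: eq_bigr => i _; rewrite mxE mulrDl. Qed.

Lemma dotrVZl c x z : dotrV (c *: x) z = c * dotrV x z.
Proof. by rewrite mulr_sumr; apply: eq_bigr => i _; rewrite mxE mulrA. Qed.

Lemma dotrVNl x z : dotrV (- x) z = - dotrV x z.
Proof. by rewrite -scaleN1r dotrVZl mulN1r. Qed.

Lemma dotrVDr x y z : dotrV z (x + y) = dotrV z x + dotrV z y.
Proof. by rewrite dotrVC dotrVDl dotrVC [X in _ + X]dotrVC. Qed.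

Lemma dotrVZr c x z : dotrV z (c *: x) = c * dotrV z x.
Proof. by rewrite dotrVC dotrVZl dotrVC. Qed.

Lemma dotrVNr x z : dotrV z (- x) = - dotrV z x.
Proof. by rewrite dotrVC dotrVNl dotrVC. Qed.

Lemma dotrV_ge0 x : 0 <= dotrV x x.
Proof. by apply: sumr_ge0 => i _; rewrite -expr2 sqr_ge0. Qed.

Lemma enorm_ge0 x : 0 <= enorm x. Proof. exact: sqrtr_ge0. Qed.

Lemma sqr_enorm x : enorm x ^+ 2 = dotrV x x.
Proof. by rewrite sqr_sqrtr// dotrV_ge0. Qed.

Lemma enormN x : enorm (- x) = enorm x.
Proof. by rewrite /enorm dotrVNl dotrVNr opprK. Qed.

Lemma enorm_eq0 x : enorm x = 0 -> x = 0.
Proof.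
move=> x0; have : dotrV x x = 0 by rewrite -sqr_enorm x0 expr0n.
move=> /psumr_eq0P H; apply/rowP => i; rewrite mxE.
by apply/eqP; rewrite -sqrf_eq0 expr2; apply/eqP/H => // j _;
  rewrite -expr2 sqr_ge0.
Qed.

End dot_product.

Lemma dotrV_cons (R : realType) n t (x : 'rV[R]_n) (xi : 'rV[R]_n.+1) :
  dotrV (rV_cons (t, x)) xi =
  t * xi 0 0 + dotrV x (\row_i xi 0 (lift ord0 i)).
Proof.
rewrite /dotrV big_ord_recl rV_consE0; congr (_ + _).
by apply: eq_bigr => i _; rewrite rV_consE_lift mxE.
Qed.

Lemma Rint_rV_cons (R : realType) n (f : 'rV[R]_n.+1 -> R) :
  (lebesgue_rV R n.+1).-integrable setT (EFin \o f) ->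
  \int[lebesgue_rV R n.+1]_x f x =
  \int[@lebesgue_measure R]_t \int[lebesgue_rV R n]_x f (rV_cons (t, x)).
Proof.
move=> intf; have mf := integ_meas intf.
have mfc : measurable_fun setT (fun p => f (rV_cons p)).
  by apply: measurableT_comp => //; exact: measurable_rV_cons.
have intc : (@lebesgue_measure R \x lebesgue_rV R n)%E.-integrable setT
    (EFin \o (fun p => f (rV_cons p))).
  apply/integrableP; split; first exact/measurable_EFinP.
  have := integ_lty intf; rewrite [X in (X < _)%E -> _]
    (ge0_integral_pushforward (@measurable_rV_cons R n))//.
  by apply/measurable_EFinP; exact: mf_norm.
have [_ <-] := Rint_prod1 intc.
rewrite /Rintegral; congr fine.
apply: (integral_pushforward (@measurable_rV_cons R n)) => //.
exact/measurable_EFinP.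
Qed.

(** * Gaussian densities *)

Section gaussian.
Context (R : realType).
Local Notation leb := (@lebesgue_measure R).

Definition gauss_peak (tau : R) : R := (tau * Num.sqrt (2 * pi))^-1.

Definition gauss1 (tau t : R) : R :=
  gauss_peak tau * expR (- (t ^+ 2 / (2 * tau ^+ 2))).

(** The density of [tau] times a standard Gaussian vector, that is, the heat
    kernel at time [tau ^ 2 / 2]. *)
Definition gauss n (tau : R) (y : 'rV[R]_n) : R :=
  gauss_peak tau ^+ n * expR (- (dotrV y y / (2 * tau ^+ 2))).

Variable tau : R.
Hypothesis tau0 : 0 < tau.

Let sqrt2pi_gt0 : 0 < Num.sqrt (2 * pi) :> R.
Proof. by rewrite sqrtr_gt0 mulr_gt0// pi_gt0. Qed.

Lemma gauss_peak_gt0 : 0 < gauss_peak tau.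
Proof. by rewrite invr_gt0 mulr_gt0. Qed.

Lemma gauss1E : gauss1 tau = normal_pdf 0 tau.
Proof.
apply/funext => t; rewrite normal_pdfE ?gt_eqF//; congr (_ * expR _).
  rewrite /gauss_peak /normal_peak -mulrnAr [in RHS]sqrtrM ?sqr_ge0// sqrtr_sqr.
  by rewrite gtr0_norm// mulr_natl.
by rewrite /normal_fun subr0 mulNr -[tau ^+ 2 *+ 2]mulr_natl.
Qed.

Lemma integ_gauss1 : leb.-integrable setT (EFin \o gauss1 tau).
Proof. by rewrite gauss1E; exact: integrable_normal_pdf. Qed.

Lemma integral_gauss1 : (\int[leb]_t (gauss1 tau t)%:E)%E = 1%E.
Proof. by rewrite gauss1E integral_normal_pdf. Qed.

Lemma gauss1_ge0 t : 0 <= gauss1 tau t.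
Proof. by rewrite mulr_ge0 ?expR_ge0// ltW// gauss_peak_gt0. Qed.

End gaussian.

Section gaussian_fourier_1d.
Context (R : realType).
Local Notation leb := (@lebesgue_measure R).
Variable tau : R.
Hypothesis tau0 : 0 < tau.

Lemma gauss_peak_sqrt2 : gauss_peak tau = Num.sqrt 2 * gauss_peak (Num.sqrt 2 * tau).
Proof.
rewrite /gauss_peak; field.
rewrite !gt_eqF ?sqrtr_gt0 ?mulr_gt0 ?pi_gt0//.
Qed.

(** A quadratic factor is absorbed by widening the Gaussian, because
    [x exp (- 2 x) <= exp (- x)]. *)
Lemma sqr_expRN_le (x : R) : 0 <= x ->
  x / (2 * tau ^+ 2) * expR (- (x / (2 * tau ^+ 2))) <=
  2 * expR (- (x / (2 * (Num.sqrt 2 * tau) ^+ 2))).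
Proof.
move=> x0; rewrite exprMn sqr_sqrtr//.
set u := x / (2 * (2 * tau ^+ 2)).
have -> : x / (2 * tau ^+ 2) = 2 * u.
  by rewrite /u; field; rewrite gt_eqF.
have -> : - (2 * u) = - u + - u by ring.
rewrite expRD; have -> : 2 * u * (expR (- u) * expR (- u)) =
  2 * expR (- u) * (u * expR (- u)) by ring.
rewrite ler_piMr ?mulr_ge0 ?expR_ge0// expRN ler_pdivrMr ?expR_gt0// mul1r.
by apply: le_trans (expR_ge1Dx u); rewrite lerDr.
Qed.

Lemma integ_sqr_gauss1 :
  leb.-integrable setT (EFin \o (fun t : R => t ^+ 2 * gauss1 tau t)).
Proof.
have t20 : 0 < Num.sqrt 2 * tau :> R by rewrite mulr_gt0// sqrtr_gt0.
apply: (@integ_le _ _ _ leb _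
  (fun t => 4 * tau ^+ 2 * Num.sqrt 2 * gauss1 (Num.sqrt 2 * tau) t)).
- apply: mf_mul; first by apply: mf_exp; exact: measurable_id.
  exact/integ_meas/integ_gauss1.
- exact/integ_mull/integ_gauss1.
move=> t; rewrite ger0_norm; last by rewrite mulr_ge0// ?gauss1_ge0// sqr_ge0.
have c0 : 0 <= 2 * tau ^+ 2 * gauss_peak tau.
  by rewrite mulr_ge0 ?ltW ?gauss_peak_gt0// mulr_gt0// exprn_gt0.
move: (ler_wpM2l c0 (sqr_expRN_le (sqr_ge0 t))).
rewrite /gauss1 gauss_peak_sqrt2.
set p := gauss_peak _; set e1 := expR _; set e2 := expR _.
have -> : 2 * tau ^+ 2 * (Num.sqrt 2 * p) * (t ^+ 2 / (2 * tau ^+ 2) * e1)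
    = t ^+ 2 * (Num.sqrt 2 * p * e1) by field; rewrite gt_eqF.
move/le_trans; apply; rewrite le_eqVlt; apply/orP; left; apply/eqP.
by rewrite /p /e2; ring.
Qed.

Let phi := gauss1 tau.

Let derive_phi (t : R) : is_derive t 1 phi (- (t / tau ^+ 2) * phi t).
Proof.
have H : is_derive t (1:R) (fun t => - (t ^+ 2 / (2 * tau ^+ 2)))
    (- (t / tau ^+ 2)).
  apply: is_derive_eq.
  rewrite /GRing.scale/=; field; rewrite gt_eqF//.
rewrite /phi /gauss1; apply: is_derive_eq.
rewrite /GRing.scale/=; ring.
Qed.

Let gauss1_cvg0 (s : R) : s ^+ 2 = 1 -> phi (s * n%:R) @[n --> \oo] --> 0.
Proof.
move=> s1; pose c : R := (2 * tau ^+ 2)^-1; pose m := Num.min 1 c.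
have c0 : 0 < c by rewrite invr_gt0 mulr_gt0// exprn_gt0.
have m0 : 0 < m by rewrite lt_min ltr01.
have p0 := gauss_peak_gt0 tau0.
apply: (@squeeze_cvgr _ _ _ _ (fun=> 0) (fun n => gauss_peak tau / m * n.+1%:R^-1)).
- apply: nearW => n; rewrite gauss1_ge0//= -mulrA ler_wpM2l ?(ltW p0)//.
  rewrite expRN -invfM lef_pV2 ?posrE ?expR_gt0 ?mulr_gt0//.
  apply: le_trans (expR_ge1Dx _); rewrite exprMn s1 mul1r -/c.
  rewrite -natr1 mulrDr mulr1 addrC lerD ?ge_min ?lexx//.
  rewrite mulrC ler_pM ?(ltW m0)//; last by rewrite ge_min lexx orbT.
  by rewrite -natrX ler_nat -{1}[n]expn1; case: n => // n; rewrite leq_pexp2l.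
- exact: cvg_cst.
- rewrite -[X in _ --> X](mulr0 (gauss_peak tau / m)).
  by apply: cvgM; [exact: cvg_cst|exact: cvg_harmonic].
Qed.

Let iphi : leb.-integrable setT (EFin \o phi).
Proof. exact: integ_gauss1. Qed.

Let itphi : leb.-integrable setT (EFin \o (fun t : R => `|t| * phi t)).
Proof.
apply: (@integ_le _ _ _ leb _ (fun t => phi t + t ^+ 2 * phi t)).
- apply: mf_mul; last exact: integ_meas iphi.
  by apply: mf_norm; exact: measurable_id.
- by apply: integ_add => //; exact: integ_sqr_gauss1.
move=> t; rewrite normrM normr_id (ger0_norm (gauss1_ge0 tau0 t)).
rewrite -[X in _ <= X + _]mul1r -mulrDl ler_wpM2r ?gauss1_ge0//.
rewrite -(@real_normK _ t) ?num_real//.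
by move: (normr_ge0 t) => ?; nra.
Qed.

Let F (a : R) := \int[leb]_t (cos (a * t) * phi t).

Let sin_moment (a : R) :
  \int[leb]_t (sin (a * t) * (t * phi t)) = tau ^+ 2 * (a * F a).
Proof.
have icos : leb.-integrable setT (EFin \o (fun t : R => cos (a * t) * phi t)).
  exact: integ_cos.
have itp : leb.-integrable setT (EFin \o (fun t : R => t * phi t)).
  apply: (@integ_le _ _ _ leb _ (fun t => `|t| * phi t)) => //.
    by apply: mf_mul; [exact: measurable_id|exact: integ_meas iphi].
  by move=> t; rewrite normrM (ger0_norm (gauss1_ge0 tau0 t)).
have isin : leb.-integrable setT
    (EFin \o (fun t : R => sin (a * t) * (t * phi t))).
  exact: integ_sin.
have H := @Rint_derive_eq0 _ (fun t => sin (a * t) * phi t)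
  (fun t => a * (cos (a * t) * phi t)
    - (tau ^+ 2)^-1 * (sin (a * t) * (t * phi t))).
have /H : forall t : R, is_derive t 1 (fun t => sin (a * t) * phi t)
    (a * (cos (a * t) * phi t) - (tau ^+ 2)^-1 * (sin (a * t) * (t * phi t))).
  move=> t; have dphi := derive_phi t; apply: is_derive_eq.
  by rewrite /GRing.scale/=; field; rewrite gt_eqF.
move=> {H}; have cphi : continuous phi.
  by rewrite /phi gauss1E//; apply: continuous_normal_pdf; rewrite gt_eqF.
have cM : continuous (fun t : R => a * t).
  by move=> t; apply: cvgM; [exact: cvg_cst|exact: cvg_id].
have cc : continuous (fun t : R => cos (a * t)).
  by move=> t; apply: continuous_comp; [exact: cM|exact: continuous_cos].
have cs : continuous (fun t : R => sin (a * t)).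
  by move=> t; apply: continuous_comp; [exact: cM|exact: continuous_sin].
have cd : continuous (fun t => a * (cos (a * t) * phi t)
    - (tau ^+ 2)^-1 * (sin (a * t) * (t * phi t))).
  move=> t; apply: cvgB; apply: cvgM; do ?exact: cvg_cst.
    by apply: cvgM; [exact: cc|exact: cphi].
  by apply: cvgM; [exact: cs|apply: cvgM; [exact: cvg_id|exact: cphi]].
move=> /(_ cd); have i1 := integ_mull a icos.
have i2 := integ_mull (tau ^+ 2)^-1 isin.
move=> /(_ (integ_sub i1 i2)).
have sq (s : R) : s ^+ 2 = 1 -> sin (a * (s * n%:R)) * phi (s * n%:R)
    @[n --> \oo] --> 0.
  move=> s1; apply: norm_cvg0.
  apply: (@squeeze_cvgr _ _ _ _ (fun=> 0) (fun n => phi (s * n%:R))).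
  - apply: nearW => n; rewrite normr_ge0/= normrM.
    by rewrite (ger0_norm (gauss1_ge0 tau0 _)) ler_piMl ?gauss1_ge0 ?sin_max.
  - exact: cvg_cst.
  - exact: gauss1_cvg0.
have := sq 1; rewrite expr1n => /(_ erefl).
under eq_cvg do rewrite mul1r.
move=> H /(_ H) {H}; have := sq (-1); rewrite sqrrN expr1n => /(_ erefl).
under eq_cvg do rewrite mulN1r.
move=> H /(_ H) {H}; rewrite Rint_sub// !Rint_mull//.
move/eqP; rewrite subr_eq0 => /eqP E; rewrite /F E mulrA divff ?mul1r//.
by rewrite gt_eqF// exprn_gt0.
Qed.

Let derive_F (a : R) : is_derive a 1 F (- (tau ^+ 2 * (a * F a))).
Proof.
pose f (x t : R) := cos (x * t) * phi t.
have intf (x : R) : `]a - 1, a + 1[%classic x ->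
    leb.-integrable setT (EFin \o f x).
  by move=> _; exact: integ_cos.
have df (x t : R) : is_derive x (1 : R) (f ^~ t) (- (sin (x * t) * (t * phi t))).
  by rewrite /f; apply: is_derive_eq; rewrite /GRing.scale/=; ring.
have pf (x t : R) : partial1of2 f x t = - (sin (x * t) * (t * phi t)).
  by rewrite partial1of2E; case: (df x t).
have Ia : `]a - 1, a + 1[%classic a by rewrite /= in_itv/= ltrBlDr !ltrDl ltr01.
have derf (x t : R) : `]a - 1, a + 1[%classic x -> setT t -> derivable (f ^~ t) x 1.
  by move=> _ _; case: (df x t).
have Gub (x t : R) : `]a - 1, a + 1[%classic x -> setT t ->
    `|partial1of2 f x t| <= `|t| * phi t.
  move=> _ _; rewrite pf normrN normrM [`|t * _|]normrM.
  by rewrite (ger0_norm (gauss1_ge0 tau0 t)) ler_piMl ?sin_max// mulr_ge0// gauss1_ge0.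
have G0 (t : R) : 0 <= `|t| * phi t by rewrite mulr_ge0// gauss1_ge0.
have := differentiation_under_integral measurableT Ia intf derf G0 itphi Gub.
have := derivable_under_integral measurableT Ia intf derf G0 itphi Gub.
rewrite -[fun x' => _]/F => dF F'.
apply: DeriveDef => //; rewrite -derive1E F'.
under eq_Rintegral do rewrite pf.
rewrite Rint_opp ?sin_moment//.
have itp : leb.-integrable setT (EFin \o (fun t : R => t * phi t)).
  apply: (@integ_le _ _ _ leb _ (fun t => `|t| * phi t)) => //.
    by apply: mf_mul; [exact: measurable_id|exact: integ_meas iphi].
  by move=> t; rewrite normrM (ger0_norm (gauss1_ge0 tau0 t)).
exact: integ_sin.
Qed.

(** The transform [F] solves [F' a = - tau^2 a F a]: differentiation under the
    integral sign gives [- t sin (a t)], and integrating by parts turns the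
    factor [t] back into a derivative of the Gaussian. *)
Lemma gauss1_fourier (a : R) :
  \int[leb]_t (cos (a * t) * gauss1 tau t) = expR (- (tau ^+ 2 * a ^+ 2 / 2)).
Proof.
pose D (x : R) := F x * expR (tau ^+ 2 * x ^+ 2 / 2).
have dD (x : R) : is_derive x (1 : R) D 0.
  have dF := derive_F x.
  have dE : is_derive x (1:R) (fun x => tau ^+ 2 * x ^+ 2 / 2) (tau ^+ 2 * x).
    by apply: is_derive_eq; rewrite /GRing.scale/=; field.
  by rewrite /D; apply: is_derive_eq; rewrite /GRing.scale/=; ring.
have := is_derive_0_is_cst a 0 dD.
rewrite /D expr0n/= mulr0 mul0r expR0 mulr1.
have -> : F 0 = 1.
  rewrite /F; under eq_Rintegral do rewrite mul0r cos0 mul1r.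
  by rewrite /Rintegral integral_gauss1.
by move=> H; rewrite -[LHS](mulfK (negbT (expR_eq0 (tau ^+ 2 * a ^+ 2 / 2)))) H expRN mul1r.
Qed.

End gaussian_fourier_1d.

Lemma mf_gauss d (T : measurableType d) (R : realType) n (s : T -> R)
    (f : T -> 'rV[R]_n) : measurable_fun setT s -> measurable_fun setT f ->
  measurable_fun setT (fun x => gauss (s x) (f x)).
Proof. by move=> ms mf; rewrite /gauss /gauss_peak; meas. Qed.

Ltac meas ::= repeat first [meas_step | apply: mf_gauss].

Section gauss_rV.
Context (R : realType).
Local Notation mu := (lebesgue_rV R).
Variable tau : R.
Hypothesis tau0 : 0 < tau.

Lemma measurable_gauss n : measurable_fun setT (@gauss R n tau).
Proof. by apply: (@mf_gauss _ _ _ _ (fun=> tau) id); meas. Qed.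

Lemma gauss_gt0 n (y : 'rV[R]_n) : 0 < gauss tau y.
Proof. by rewrite mulr_gt0 ?expR_gt0// exprn_gt0// gauss_peak_gt0. Qed.

Lemma gauss_ge0 n (y : 'rV[R]_n) : 0 <= gauss tau y.
Proof. exact/ltW/gauss_gt0. Qed.

Lemma gaussN n (y : 'rV[R]_n) : gauss tau (- y) = gauss tau y.
Proof. by rewrite /gauss dotrVNl dotrVNr opprK. Qed.

Lemma gauss_cons n t (x : 'rV[R]_n) :
  gauss tau (rV_cons (t, x)) = gauss1 tau t * gauss tau x.
Proof.
rewrite /gauss /gauss1 exprS mulrACA -expRD; congr (_ * expR _).
rewrite dotrV_cons rV_consE0 -expr2 mulrDl opprD; congr (_ - _ / _).
by apply: eq_bigr => i _; rewrite mxE rV_consE_lift.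
Qed.

Lemma integral_gauss n : (\int[mu n]_y (gauss tau y)%:E)%E = 1%E.
Proof.
elim: n => [|n IH].
  rewrite integral_dirac//; last first.
    by apply/measurable_EFinP; exact: measurable_gauss.
  by rewrite diracT mul1e /gauss /dotrV big_ord0 mul0r oppr0 expR0 mulr1 expr0.
rewrite ge0_integral_rV_cons; last 2 first.
- by apply/measurable_EFinP; exact: measurable_gauss.
- by move=> x; rewrite lee_fin gauss_ge0.
rewrite -[RHS](integral_gauss1 tau0); apply: eq_integral => t _.
under eq_integral do rewrite gauss_cons EFinM.
rewrite ge0_integralZl//.
- by rewrite IH mule1.
- by apply/measurable_EFinP; exact: measurable_gauss.
- by move=> x _; rewrite lee_fin gauss_ge0.
- by rewrite lee_fin gauss1_ge0.
Qed.

Lemma integ_gauss n : (mu n).-integrable setT (EFin \o @gauss R n tau).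
Proof.
apply: ge0_integ; [exact: measurable_gauss|exact: gauss_ge0|].
by rewrite integral_gauss ltry.
Qed.

Lemma Rint_gauss n : \int[mu n]_y gauss tau y = 1.
Proof. by rewrite /Rintegral integral_gauss. Qed.

Lemma mf_dotl n (xi : 'rV[R]_n) : measurable_fun setT (fun y : 'rV[R]_n => dotrV y xi).
Proof. by apply: mf_dot; meas. Qed.

Lemma gauss_fourier_sin n (xi : 'rV[R]_n) :
  \int[mu n]_y (sin (dotrV y xi) * gauss tau y) = 0.
Proof.
apply: Rint_rV_odd => [|y]; last by rewrite dotrVNl sinN gaussN mulNr.
by apply: integ_sin; [exact: mf_dotl|exact: integ_gauss].
Qed.

(** The exponential factorises over the coordinates, and the products of sines
    that appear integrate to zero by parity. *)
Lemma gauss_fourier n (xi : 'rV[R]_n) :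
  \int[mu n]_y (cos (dotrV y xi) * gauss tau y) =
  expR (- (tau ^+ 2 * dotrV xi xi / 2)).
Proof.
elim: n xi => [|n IH] xi.
  transitivity (\int[mu 0]_y gauss tau y).
    by apply: eq_Rintegral => y _; rewrite /dotrV big_ord0 cos0 mul1r.
  by rewrite Rint_gauss /dotrV big_ord0 mulr0 mul0r oppr0 expR0.
pose xi' : 'rV[R]_n := \row_i xi 0 (lift ord0 i).
have ic : (mu n).-integrable setT
    (EFin \o (fun x : 'rV[R]_n => cos (dotrV x xi') * gauss tau x)).
  by apply: integ_cos; [exact: mf_dotl|exact: integ_gauss].
have is_ : (mu n).-integrable setT
    (EFin \o (fun x : 'rV[R]_n => sin (dotrV x xi') * gauss tau x)).
  by apply: integ_sin; [exact: mf_dotl|exact: integ_gauss].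
rewrite Rint_rV_cons; last first.
  by apply: integ_cos; [exact: mf_dotl|exact: integ_gauss].
transitivity (\int[@lebesgue_measure R]_t
    (cos (xi 0 0 * t) * gauss1 tau t * expR (- (tau ^+ 2 * dotrV xi' xi' / 2)))).
  apply: eq_Rintegral => t _.
  transitivity (\int[mu n]_x
      (cos (xi 0 0 * t) * gauss1 tau t * (cos (dotrV x xi') * gauss tau x)
      - sin (xi 0 0 * t) * gauss1 tau t * (sin (dotrV x xi') * gauss tau x))).
    apply: eq_Rintegral => x _.
    by rewrite dotrV_cons gauss_cons cosD (mulrC t); ring.
  rewrite Rint_sub ?Rint_mull//; [|exact: integ_mull..].
  by rewrite gauss_fourier_sin mulr0 subr0 IH.
rewrite Rint_mulr; last first.
  apply: integ_cos; last exact: integ_gauss1.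
  by apply: mf_mul; [exact: mf_cst|exact: measurable_id].
rewrite gauss1_fourier// -expRD; congr expR.
have -> : dotrV xi xi = xi 0 0 * xi 0 0 + dotrV xi' xi'.
  by rewrite {1}(rV_cons_eta xi) dotrV_cons.
by field.
Qed.

End gauss_rV.

Section gauss_estimates.
Context (R : realType) (n : nat).
Local Notation mu := (lebesgue_rV R n).
Variable tau : R.
Hypothesis tau0 : 0 < tau.
Implicit Types y z : 'rV[R]_n.

(** Fourier inversion for the Gaussian itself: up to a constant the transform
    of [gauss tau] is [gauss tau^-1]. *)
Lemma gauss_inv_fourier y :
  \int[mu]_xi (cos (dotrV xi y) * expR (- (tau ^+ 2 * dotrV xi xi / 2))) =
  (2 * pi) ^+ n * gauss tau y.
Proof.
have it0 : 0 < tau^-1 by rewrite invr_gt0.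
have s2pi : 0 < Num.sqrt (2 * pi) :> R by rewrite sqrtr_gt0 mulr_gt0// pi_gt0.
have p0 : gauss_peak tau^-1 != 0 by rewrite gt_eqF// gauss_peak_gt0.
have E (xi : 'rV[R]_n) : expR (- (tau ^+ 2 * dotrV xi xi / 2)) =
    (gauss_peak tau^-1) ^- n * gauss tau^-1 xi.
  rewrite /gauss mulKf ?expf_neq0//; congr expR; field; rewrite gt_eqF//.
transitivity (\int[mu]_xi
    ((gauss_peak tau^-1) ^- n * (cos (dotrV xi y) * gauss tau^-1 xi))).
  by apply: eq_Rintegral => xi _; rewrite E mulrCA.
rewrite Rint_mull; last first.
  by apply: integ_cos; [exact: mf_dotl|exact: integ_gauss].
rewrite gauss_fourier// /gauss mulrA; congr (_ * expR _); last first.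
  by field; rewrite gt_eqF.
rewrite -exprVn -exprMn; congr (_ ^+ n).
have {1}<- : Num.sqrt (2 * pi) ^+ 2 = 2 * pi :> R.
  by rewrite sqr_sqrtr// mulr_ge0// pi_ge0.
by rewrite /gauss_peak; field; rewrite !gt_eqF.
Qed.

(** An upper bound for the second moment of the standard Gaussian vector, not
    its exact value: it comes out of [sqr_expRN_le]. *)
Definition gauss_moment2 : R := 4 * Num.sqrt 2 ^+ n.

Lemma dotrV_gauss_le y : dotrV y y * gauss tau y <=
  gauss_moment2 * tau ^+ 2 * gauss (Num.sqrt 2 * tau) y.
Proof.
have c0 : 0 <= 2 * tau ^+ 2 * gauss_peak tau ^+ n.
  by rewrite mulr_ge0 ?exprn_ge0 ?ltW ?gauss_peak_gt0// mulr_gt0// exprn_gt0.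
move: (ler_wpM2l c0 (sqr_expRN_le tau0 (dotrV_ge0 y))).
rewrite /gauss (gauss_peak_sqrt2 tau0) /gauss_moment2 exprMn.
set p := gauss_peak _ ^+ n; set e1 := expR _; set e2 := expR _.
have -> : 2 * tau ^+ 2 * (Num.sqrt 2 ^+ n * p)
     * (dotrV y y / (2 * tau ^+ 2) * e1) =
    dotrV y y * (Num.sqrt 2 ^+ n * p * e1) by field; rewrite gt_eqF.
move/le_trans; apply; rewrite le_eqVlt; apply/orP; left; apply/eqP.
by ring.
Qed.

Lemma gauss_moment2_ge0 : 0 <= gauss_moment2.
Proof. by rewrite mulr_ge0// exprn_ge0// sqrtr_ge0. Qed.

Let sqrt2tau : 0 < Num.sqrt 2 * tau.
Proof. by rewrite mulr_gt0// sqrtr_gt0. Qed.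

Lemma integral_dotrV_gauss_le :
  (\int[mu]_y (dotrV y y * gauss tau y)%:E <= (gauss_moment2 * tau ^+ 2)%:E)%E.
Proof.
have m0 : 0 <= gauss_moment2 * tau ^+ 2.
  by rewrite mulr_ge0 ?gauss_moment2_ge0// sqr_ge0.
rewrite -[leRHS]mule1 -(integral_gauss sqrt2tau n) -ge0_integralZl//; last 2 first.
- by apply/measurable_EFinP; exact: measurable_gauss.
- by move=> y _; rewrite lee_fin gauss_ge0.
apply: ge0_le_integral => //.
- by move=> y _; rewrite lee_fin mulr_ge0 ?dotrV_ge0// gauss_ge0.
- by apply/measurable_EFinP; meas.
- by apply/measurable_EFinP; meas.
- by move=> y _; rewrite lee_fin dotrV_gauss_le.
Qed.

Lemma powR_le_1Dsqr (r a : R) : 0 <= r -> 0 <= a <= 2 -> r `^ a <= 1 + r ^+ 2.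
Proof.
move=> r0 /andP[a0 a2]; have [r1|r1] := leP r 1.
  apply: (@le_trans _ _ (1 `^ a)); first by apply: ge0_ler_powR; rewrite ?nnegrE.
  by rewrite powR1 lerDl sqr_ge0.
apply: (@le_trans _ _ (r `^ 2)); first by apply: ler_powR => //; exact: ltW.
by rewrite powR_mulrn// lerDr.
Qed.

(** After division by [tau] the moment of order [a] lies below the sum of the
    moments of orders 0 and 2. *)
Lemma integral_powR_enorm_gauss_le (a : R) : 0 <= a <= 2 ->
  (\int[mu]_y (enorm y `^ a * gauss tau y)%:E <=
   ((1 + gauss_moment2) * tau `^ a)%:E)%E.
Proof.
move=> a02; have ta : 0 <= tau `^ a by exact: powR_ge0.
have mg := @measurable_gauss R tau n.
have H y : enorm y `^ a * gauss tau y <=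
    tau `^ a * (gauss tau y + tau ^- 2 * (dotrV y y * gauss tau y)).
  have -> : tau `^ a * (gauss tau y + tau ^- 2 * (dotrV y y * gauss tau y)) =
     tau `^ a * (1 + (enorm y / tau) ^+ 2) * gauss tau y.
    by rewrite exprMn exprVn sqr_enorm; ring.
  rewrite ler_wpM2r ?gauss_ge0//.
  rewrite -{1}[enorm y](mulfVK (negbT (gt_eqF tau0))) mulrC.
  rewrite powRM ?divr_ge0 ?enorm_ge0 ?(ltW tau0)//.
  by rewrite ler_wpM2l// powR_le_1Dsqr// divr_ge0 ?enorm_ge0// ltW.
apply: (@le_trans _ _ (\int[mu]_y ((tau `^ a)%:E * ((gauss tau y)%:E +
    (tau ^- 2)%:E * (dotrV y y * gauss tau y)%:E)))%E).
  apply: ge0_le_integral => //.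
  - by move=> y _; rewrite lee_fin mulr_ge0 ?powR_ge0// gauss_ge0.
  - by apply/measurable_EFinP; apply: mf_mul; [meas|].
  - by apply/measurable_EFinP; meas.
  - by move=> y _; exact: H.
have t2 : 0 <= tau ^- 2 by rewrite invr_ge0 sqr_ge0.
have dg0 y : (0 <= (dotrV y y * gauss tau y)%:E)%E.
  by rewrite lee_fin mulr_ge0 ?dotrV_ge0// gauss_ge0.
have mdg : measurable_fun setT (fun y => (dotrV y y * gauss tau y)%:E).
  by apply/measurable_EFinP; meas.
have mge : measurable_fun setT (fun y : 'rV[R]_n => (gauss tau y)%:E).
  exact/measurable_EFinP.
rewrite ge0_integralZl//; last 2 first.
- by apply: emeasurable_funD => //; exact: measurable_funeM.
- move=> y _; apply: adde_ge0; first by rewrite lee_fin gauss_ge0.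
  by apply: mule_ge0 => //; rewrite lee_fin.
rewrite ge0_integralD//; last 3 first.
- by move=> y _; rewrite lee_fin gauss_ge0.
- by move=> y _; apply: mule_ge0 => //; rewrite lee_fin.
- exact: measurable_funeM.
rewrite integral_gauss// ge0_integralZl// mulrC EFinM.
apply: lee_wpmul2l; first by rewrite lee_fin.
rewrite EFinD; apply: leeD2l.
apply: (@le_trans _ _ ((tau ^- 2)%:E * (gauss_moment2 * tau ^+ 2)%:E)%E).
  apply: lee_wpmul2l; first by rewrite lee_fin.
  exact: integral_dotrV_gauss_le.
by rewrite -EFinM lee_fin mulrCA mulVf ?mulr1// gt_eqF// exprn_gt0.
Qed.

(** With [c ^ 2 = a b], the factorisation
    [(a - b) ^ 2 = (a + b - 2 c) (a + b + 2 c)] and the arithmetic-geometric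
    inequality bound [|a - b|] by a combination whose integral is explicit when
    [a], [b] are translated Gaussians and [c] is again a Gaussian. *)
Lemma normrB_le_geometric (a b c l : R) : 0 <= a -> 0 <= b -> 0 < l ->
  c ^+ 2 = a * b ->
  `|a - b| <= (l * (a + b - 2 * c) + l^-1 * (a + b + 2 * c)) / 2.
Proof.
move=> a0 b0 l0 cab; set P := a + b - 2 * c; set Q := a + b + 2 * c.
have PQ : (a - b) ^+ 2 = P * Q by rewrite /P /Q; nra.
have cs : `|2 * c| <= a + b.
  rewrite -ler_sqr ?nnegrE ?addr_ge0// real_normK ?num_real//.
  by rewrite exprMn cab; have := sqr_ge0 (a - b); nra.
have [P0 Q0] : 0 <= P /\ 0 <= Q.
  by move: cs; rewrite ler_norml => /andP[? ?]; rewrite /P /Q; split; lra.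
have li : 0 < l^-1 by rewrite invr_gt0.
have X0 : 0 <= (l * P + l^-1 * Q) / 2.
  by rewrite divr_ge0// addr_ge0// mulr_ge0// ltW.
rewrite -ler_sqr ?nnegrE// real_normK ?num_real// PQ -subr_ge0.
have -> : ((l * P + l^-1 * Q) / 2) ^+ 2 - P * Q = ((l * P - l^-1 * Q) / 2) ^+ 2.
  by field; rewrite gt_eqF.
exact: sqr_ge0.
Qed.

Lemma gauss_midpoint y z :
  (gauss tau (y - 2^-1 *: z) * expR (- (dotrV z z / (8 * tau ^+ 2)))) ^+ 2 =
  gauss tau (y - z) * gauss tau y.
Proof.
rewrite /gauss !dotrVDl !dotrVDr !dotrVNl !dotrVNr !dotrVZl !dotrVZr.
rewrite (dotrVC z y); set p := gauss_peak tau ^+ n.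
rewrite -mulrA -expRD exprMn -expRM_natl mulrACA -expRD -expr2; congr (_ * expR _).
by field; rewrite gt_eqF.
Qed.

Lemma integral_gauss_shift z : (\int[mu]_y (gauss tau (y - z))%:E)%E = 1%E.
Proof.
rewrite (ge0_integral_rV_shift (- z) (F := fun y => (gauss tau y)%:E)).
- exact: integral_gauss.
- by apply/measurable_EFinP; exact: measurable_gauss.
- by move=> y; rewrite lee_fin gauss_ge0.
Qed.

Lemma measurable_gauss_shift z : measurable_fun setT (fun y => gauss tau (y - z)).
Proof. by apply: mf_gauss; meas. Qed.

Lemma integ_gauss_shift z :
  mu.-integrable setT (EFin \o (fun y => gauss tau (y - z))).
Proof.
apply: ge0_integ; [exact: measurable_gauss_shift|by move=> y; exact: gauss_ge0|].
by rewrite integral_gauss_shift ltry.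
Qed.

Lemma Rint_gauss_shift z : \int[mu]_y gauss tau (y - z) = 1.
Proof. by rewrite /Rintegral integral_gauss_shift. Qed.

Lemma integral_gauss_diff_le2 z :
  (\int[mu]_y `|gauss tau (y - z) - gauss tau y|%:E <= 2%:E)%E.
Proof.
have mg := measurable_gauss_shift z; have mg0 := @measurable_gauss R tau n.
apply: (@le_trans _ _
    (\int[mu]_y ((gauss tau (y - z))%:E + (gauss tau y)%:E))%E).
  apply: ge0_le_integral => //.
  - by apply/measurable_EFinP; meas.
  - by apply/measurable_EFinP; apply: mf_add.
  - move=> y _; rewrite -EFinD lee_fin (le_trans (ler_normB _ _))//.
    by rewrite !ger0_norm ?gauss_ge0.
rewrite ge0_integralD//; last 4 first.
- by move=> y _; rewrite lee_fin gauss_ge0.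
- exact/measurable_EFinP.
- by move=> y _; rewrite lee_fin gauss_ge0.
- exact/measurable_EFinP.
by rewrite integral_gauss_shift integral_gauss.
Qed.

(** The geometric mean of two translates is a multiple of the Gaussian centred
    at the midpoint, so [normrB_le_geometric] can be integrated exactly. The
    choice [l = 4 tau / |z|] balances its two terms. *)
Lemma integral_gauss_diff_le z :
  (\int[mu]_y `|gauss tau (y - z) - gauss tau y|%:E <= (enorm z / tau)%:E)%E.
Proof.
have [/eqP/enorm_eq0 ->|z0] := boolP (enorm z == 0).
  rewrite (_ : enorm 0 = 0); last by rewrite /enorm -[0](scale0r (0 : 'rV_n)) dotrVZl mul0r sqrtr0.
  rewrite mul0r; under eq_integral do rewrite subr0 subrr normr0.
  by rewrite integral0.
have {}z0 : 0 < enorm z by rewrite lt_neqAle eq_sym z0 enorm_ge0.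
pose q := expR (- (dotrV z z / (8 * tau ^+ 2))).
pose c y := gauss tau (y - 2^-1 *: z) * q.
pose l := 4 * tau / enorm z; have l0 : 0 < l by rewrite divr_gt0// mulr_gt0.
have ig := integ_gauss_shift z; have ig0 := @integ_gauss R tau tau0 n.
have ic : mu.-integrable setT (EFin \o c).
  exact/integ_mulr/integ_gauss_shift.
pose B y := (l * (gauss tau (y - z) + gauss tau y - 2 * c y) +
    l^-1 * (gauss tau (y - z) + gauss tau y + 2 * c y)) / 2.
have i1 : mu.-integrable setT
    (EFin \o (fun y => gauss tau (y - z) + gauss tau y)) by exact: integ_add.
have i2 : mu.-integrable setT (EFin \o (fun y => 2 * c y)) by exact: integ_mull.
have i3 : mu.-integrable setT (EFin \o
    (fun y => l * (gauss tau (y - z) + gauss tau y - 2 * c y))).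
  exact/integ_mull/integ_sub.
have i4 : mu.-integrable setT (EFin \o
    (fun y => l^-1 * (gauss tau (y - z) + gauss tau y + 2 * c y))).
  exact/integ_mull/integ_add.
have iB : mu.-integrable setT (EFin \o B) by exact/integ_mulr/integ_add.
have HB y : `|gauss tau (y - z) - gauss tau y| <= B y.
  apply: normrB_le_geometric; rewrite ?gauss_ge0//.
  by rewrite /c gauss_midpoint.
apply: (@le_trans _ _ (\int[mu]_y B y)%:E%E).
  rewrite EFin_Rint//; apply: ge0_le_integral => //.
  - by apply/measurable_EFinP; apply: mf_norm;
      apply: integ_meas (integ_sub ig ig0).
  - exact: measurable_int iB.
  - by move=> y _; exact: HB.
have Ec : \int[mu]_y (2 * c y) = 2 * q.
  rewrite (Rint_mull 2 ic) /c (Rint_mulr q (integ_gauss_shift (2^-1 *: z))).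
  by rewrite Rint_gauss_shift mul1r.
have Es : \int[mu]_y (gauss tau (y - z) + gauss tau y) = 2.
  by rewrite (Rint_add ig ig0) Rint_gauss_shift Rint_gauss.
rewrite lee_fin (Rint_mulr 2^-1 (integ_add i3 i4)) (Rint_add i3 i4).
rewrite (Rint_mull l (integ_sub i1 i2)) (Rint_mull l^-1 (integ_add i1 i2)).
rewrite (Rint_sub i1 i2) (Rint_add i1 i2) Ec Es.
have q1 : 1 - q <= enorm z ^+ 2 / (8 * tau ^+ 2).
  have := expR_ge1Dx (- (dotrV z z / (8 * tau ^+ 2))).
  by rewrite -/q sqr_enorm; lra.
have q2 : q <= 1.
  rewrite /q -expR0 ler_expR oppr_le0 divr_ge0 ?dotrV_ge0//.
  by rewrite mulr_ge0// sqr_ge0.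
have li0 : 0 < l^-1 by rewrite invr_gt0.
apply: (@le_trans _ _ (l * (enorm z ^+ 2 / (8 * tau ^+ 2)) + l^-1 * 2)).
  have := ler_wpM2l (ltW l0) q1; have := ler_wpM2l (ltW li0) q2; lra.
rewrite le_eqVlt /l; apply/orP; left; apply/eqP; field.
by rewrite !gt_eqF.
Qed.

End gauss_estimates.

(** * Real test functions *)

Section real_test_functions.
Context (R : realType) (n : nat).
Implicit Types (u v : 'rV[R]_n -> R) (i : 'I_n).
Local Notation e_ i := (delta_mx 0 i : 'rV[R]_n).

Definition real_test u : Prop := smooth u /\ compact (closure [set x | u x != 0]).

(** Smoothness truncated at a finite order, on which closure properties can be
    proved by induction. *)
Fixpoint differentiable_upto (k : nat) u : Prop :=
  [/\ continuous u, forall x i, derivable u x (e_ i) &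
    if k is k'.+1 then forall i, differentiable_upto k' ('D_(e_ i) u) else True].

Lemma partials_rcons s i u : partials (rcons s i) u = partials s ('D_(e_ i) u).
Proof. by rewrite /partials -cats1 foldr_cat. Qed.

Lemma smooth_derive u i : smooth u -> smooth ('D_(e_ i) u).
Proof. by move=> su s; rewrite -partials_rcons; exact: su. Qed.

Lemma smooth_uptoP u : smooth u <-> forall k, differentiable_upto k u.
Proof.
split=> [su k|Hu s].
  elim: k u su => [|k IH] u su; have [cu du] := su [::]; split => //.
  by move=> i; apply: IH; exact: smooth_derive.
elim/last_ind: s u Hu => [|s i IH] u Hu.
  by have [cu du _] := Hu 0%N; split; [exact: cu|exact: du].
by rewrite partials_rcons; apply: IH => k; case: (Hu k.+1) => _ _; exact.
Qed.

Lemma differentiable_uptoW k u :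
  differentiable_upto k.+1 u -> differentiable_upto k u.
Proof.
elim: k u => [|k IH] u; first by case.
by case=> cu du Hu; split => // i; exact/IH/Hu.
Qed.

Lemma differentiable_uptoD k u v : differentiable_upto k u ->
  differentiable_upto k v -> differentiable_upto k (fun x => u x + v x).
Proof.
elim: k u v => [|k IH] u v [cu du Hu] [cv dv Hv]; split=> [x|x i|].
- exact: (continuousD (cu x) (cv x)).
- exact: (derivableD (du x i) (dv x i)).
- by [].
- exact: (continuousD (cu x) (cv x)).
- exact: (derivableD (du x i) (dv x i)).
- move=> i; have -> : 'D_(e_ i) (fun x => u x + v x) =
      fun x => 'D_(e_ i) u x + 'D_(e_ i) v x.
    by apply/funext => x; exact: (deriveD (du x i) (dv x i)).
  exact: (IH _ _ (Hu i) (Hv i)).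
Qed.

Lemma differentiable_uptoM k u v : differentiable_upto k u ->
  differentiable_upto k v -> differentiable_upto k (fun x => u x * v x).
Proof.
elim: k u v => [|k IH] u v Su Sv; have [cu du Hu] := Su;
    have [cv dv Hv] := Sv; split=> [x|x i|].
- exact: (continuousM (cu x) (cv x)).
- exact: (derivableM (du x i) (dv x i)).
- by [].
- exact: (continuousM (cu x) (cv x)).
- exact: (derivableM (du x i) (dv x i)).
- move=> i; have -> : 'D_(e_ i) (fun x => u x * v x) =
      fun x => u x * 'D_(e_ i) v x + v x * 'D_(e_ i) u x.
    by apply/funext => x; exact: (deriveM (du x i) (dv x i)).
  apply: differentiable_uptoD.
    exact: (IH _ _ (differentiable_uptoW Su) (Hv i)).
  exact: (IH _ _ (differentiable_uptoW Sv) (Hu i)).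
Qed.

Lemma differentiable_upto_cst k (c : R) : differentiable_upto k (fun=> c).
Proof.
elim: k c => [|k IH] c; split=> [x|x i|].
- exact: cst_continuous.
- exact: derivable_cst.
- by [].
- exact: cst_continuous.
- exact: derivable_cst.
- move=> i; have -> : 'D_(e_ i) (fun=> c) = fun=> 0; last exact: IH.
  by apply/funext => x; rewrite derive_cst.
Qed.

Lemma real_test_mul u v : real_test u -> real_test v ->
  real_test (fun x => u x * v x).
Proof.
move=> [su cu] [sv cv]; split.
  apply/smooth_uptoP => k; apply: differentiable_uptoM.
    by move/smooth_uptoP : su; exact.
  by move/smooth_uptoP : sv; exact.
apply: (subclosed_compact _ cu); first exact: closed_closure.
by apply: closure_subset => x /=; rewrite mulf_eq0 negb_or => /andP[].
Qed.

Lemma real_test_addZ (c : R) u v : real_test u -> real_test v ->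
  real_test (fun x => u x + c * v x).
Proof.
move=> [su cu] [sv cv]; split.
  apply/smooth_uptoP => k.
  apply: differentiable_uptoD; first by move/smooth_uptoP : su; exact.
  apply: differentiable_uptoM; first exact: differentiable_upto_cst.
  by move/smooth_uptoP : sv; exact.
apply: (subclosed_compact _ (compactU cu cv)); first exact: closed_closure.
rewrite -closureU; apply: closure_subset => x /= uv.
have [u0|u0] := eqVneq (u x) 0; last by left.
by right => /=; move: uv; rewrite u0 add0r mulf_eq0 negb_or => /andP[].
Qed.

Lemma real_test_sub u v : real_test u -> real_test v ->
  real_test (fun x => u x - v x).
Proof.
move=> tu tv; have := real_test_addZ (-1) tu tv.
by under eq_fun do rewrite mulN1r.
Qed.

Lemma real_test_derive u i : real_test u -> real_test ('D_(e_ i) u).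
Proof.
move=> [su cu]; split; first exact: smooth_derive.
apply: (subclosed_compact _ cu); first exact: closed_closure.
have := closure_id (closure [set x | u x != 0]) => -[/(_ (@closed_closure _ _)) E _].
rewrite E; apply: closure_subset => x /= Dx; apply: contrapT => nx.
move/eqP : Dx; apply; transitivity ('D_(e_ i) (fun=> 0 : R) x); last first.
  by rewrite derive_cst.
apply: near_eq_derive.
have : nbhs x (~` closure [set x | u x != 0]).
  by apply: open_nbhs_nbhs; split => //; exact/closed_openC/closed_closure.
apply: filterS => y /= ny; apply/eqP; apply: contrapT => /negP uy.
by apply: ny; exact: subset_closure.
Qed.

Lemma real_test_continuous u : real_test u -> continuous u.
Proof. by move=> [/(_ [::]) []]. Qed.

Lemma real_test_measurable u : real_test u -> measurable_fun setT u.
Proof.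
by move=> tu; apply: continuous_measurable_rV; exact: real_test_continuous.
Qed.

Lemma real_test_derivable u x i : real_test u -> derivable u x (e_ i).
Proof. by move=> [/(_ [::]) []]. Qed.

Lemma real_test_bounded u : real_test u ->
  exists B M : R, [/\ 0 <= B, 0 <= M, forall x, `|u x| <= M &
    forall x, B < `|x| -> u x = 0].
Proof.
move=> tu; have [_ cK] := tu; set K := closure _ in cK.
have [B [_ BK]] := compact_bounded cK.
have cuK : compact (u @` K).
  apply: continuous_compact => //.
  by apply: continuous_subspaceT; exact: real_test_continuous.
have [M [_ MK]] := compact_bounded cuK.
have u0 x : ~ K x -> u x = 0.
  move=> nKx; apply/eqP; apply: contrapT => /negP ux; apply: nKx.
  exact: subset_closure.
exists (Num.max 0 (B + 1)), (Num.max 0 (M + 1)); split.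
- by rewrite le_max lexx.
- by rewrite le_max lexx.
- move=> x; have [Kx|/u0 ->] := pselect (K x); last by rewrite normr0 le_max lexx.
  rewrite le_max; apply/orP; right.
  by apply: (MK (M + 1)); [rewrite ltrDl|exists x].
- move=> x Bx; apply: u0 => Kx.
  have : `|x| <= B + 1 by apply: (BK (B + 1)); rewrite ?ltrDl.
  by apply/negP; rewrite -ltNge; apply: le_lt_trans Bx; rewrite le_max lexx orbT.
Qed.

Lemma normr_coord_le (x : 'rV[R]_n) i : `|x 0 i| <= `|x|.
Proof.
rewrite /Num.norm/= mx_normrE.
exact: (le_bigmax _ (fun ij => `|x ij.1 ij.2|) (0, i)).
Qed.
End real_test_functions.

(** * Fourier transforms of test functions *)

Section cosine_transform.
Context (R : realType) (n : nat).
Local Notation mu := (lebesgue_rV R n).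
Implicit Types (u v : 'rV[R]_n -> R) (x y xi : 'rV[R]_n) (i : 'I_n).
Local Notation e_ i := (delta_mx 0 i : 'rV[R]_n).
Local Notation integ f := (mu.-integrable setT (EFin \o f)).

(** The real form of [e^{i theta}] times the Fourier transform of [u]; a single
    function carries both the cosine transform ([theta = 0]) and the sine
    transform ([theta = pi / 2]). *)
Definition ctrans u xi (theta : R) : R :=
  \int[mu]_y (cos (dotrV y xi - theta) * u y).

Definition gauss_majorant (B M : R) : R :=
  M / (gauss_peak 1 ^+ n * expR (- (n%:R * B ^+ 2 / 2))).

Lemma bounded_support_gauss v (B M : R) : 0 <= B -> 0 <= M ->
  (forall x, `|v x| <= M) -> (forall x, B < `|x| -> v x = 0) ->
  forall x, `|v x| <= gauss_majorant B M * gauss 1 x.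
Proof.
move=> B0 M0 vM vB x.
have p0 : 0 < gauss_peak 1 ^+ n :> R by rewrite exprn_gt0 ?gauss_peak_gt0.
have c0 : 0 < gauss_peak 1 ^+ n * expR (- (n%:R * B ^+ 2 / 2)) :> R.
  by rewrite mulr_gt0 ?expR_gt0.
have [xB|/vB ->] := leP `|x| B; last first.
  by rewrite normr0 mulr_ge0 ?gauss_ge0// divr_ge0// ltW.
apply: (le_trans (vM x)); rewrite /gauss_majorant mulrAC ler_pdivlMr//.
rewrite ler_wpM2l// /gauss ler_wpM2l ?(ltW p0)// ler_expR lerN2 expr1n mulr1.
rewrite ler_wpM2r// /dotrV; apply: (@le_trans _ _ (\sum_(i < n) B ^+ 2)).
  apply: ler_sum => i _; rewrite -expr2 -(@real_normK _ (x 0 i)) ?num_real//.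
  by rewrite lerXn2r ?nnegrE// (le_trans (normr_coord_le x i)).
by rewrite sumr_const card_ord mulr_natl.
Qed.

Lemma bounded_support_integ v (B M : R) : measurable_fun setT v ->
  0 <= B -> 0 <= M ->
  (forall x, `|v x| <= M) -> (forall x, B < `|x| -> v x = 0) -> integ v.
Proof.
move=> mv B0 M0 vM vB.
apply: (integ_le mv _ (bounded_support_gauss B0 M0 vM vB)).
exact/integ_mull/integ_gauss.
Qed.

Lemma real_test_integ u : real_test u -> integ u.
Proof.
move=> tu; have [B [M [B0 M0 uM uB]]] := real_test_bounded tu.
by apply: (bounded_support_integ _ B0 M0) => //; exact: real_test_measurable.
Qed.

Lemma measurable_phase xi (theta : R) :
  measurable_fun setT (fun y : 'rV[R]_n => dotrV y xi - theta).
Proof. by meas. Qed.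

Lemma ctrans_expand u xi theta : integ u ->
  ctrans u xi theta =
  cos theta * ctrans u xi 0 + sin theta * ctrans u xi (pi / 2).
Proof.
move=> iu; rewrite /ctrans.
rewrite -!Rint_mull; [|by apply: integ_cos => //; exact: measurable_phase..].
rewrite -Rint_add; [|by apply: integ_mull; apply: integ_cos => //;
  exact: measurable_phase..].
apply: eq_Rintegral => y _.
by rewrite subr0 cosB cosBpihalf; ring.
Qed.

Lemma ctrans_le u xi theta : integ u ->
  `|ctrans u xi theta| <= \int[mu]_y `|u y|.
Proof.
move=> iu; have ic : integ (fun y => cos (dotrV y xi - theta) * u y).
  by apply: integ_cos => //; exact: measurable_phase.
apply: (le_trans (normr_Rint_leR ic)).
apply: Rint_le; [exact: integ_abs|exact: integ_abs|] => y.
by rewrite normrM ler_piMl ?cos_max.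
Qed.

Lemma is_derive_line u : real_test u -> forall y i (h : R),
  is_derive h (1 : R) (fun h : R => u (y + h *: e_ i)) ('D_(e_ i) u (y + h *: e_ i)).
Proof.
move=> tu y i h; have du : derivable u (y + h *: e_ i) (e_ i) by exact: real_test_derivable.
have E : (fun k : R => k^-1 *: (((fun h : R => u (y + h *: e_ i)) \o shift h)
      (k *: (1 : R)) - u (y + h *: e_ i))) =
   (fun k : R => k^-1 *: ((u \o shift (y + h *: e_ i)) (k *: e_ i)
     - u (y + h *: e_ i))).
  apply/funext => k /=; congr (_ *: (u _ - _)).
  transitivity (y + (k + h) *: e_ i); last by rewrite scalerDl addrCA.
  by congr (y + (_ + h) *: _); exact: mulr1.
apply: DeriveDef; first by rewrite /derivable E.
by rewrite /derive E.
Qed.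

Lemma dotrV_delta xi i : dotrV (e_ i) xi = xi 0 i.
Proof.
rewrite /dotrV (bigD1 i)//= big1 ?addr0 => [|j ji]; first by rewrite mxE !eqxx mul1r.
by rewrite mxE (negbTE ji) andbF mul0r.
Qed.

(** Differentiate [h |-> ctrans (u (. + h e_i))] at 0 in two ways: under the
    integral sign, and after translating the variable, which turns [h] into a
    change of phase. This is integration by parts without boundary terms. *)
Lemma ctrans_derive u i xi theta : real_test u ->
  ctrans ('D_(e_ i) u) xi theta = xi 0 i * ctrans u xi (theta + pi / 2).
Proof.
move=> tu; have iu := real_test_integ tu; have mu_ := real_test_measurable tu.
have tdu := real_test_derive i tu.
have [B [M [B0 M0 duM duB]]] := real_test_bounded tdu.
have [Bu [Mu [Bu0 Mu0 uM uB]]] := real_test_bounded tu.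
pose f (h : R) y := cos (dotrV y xi - theta) * u (y + h *: e_ i).
have intf (h : R) : `](0 - 1), (0 + 1)[%classic h -> integ (f h).
  move=> _; apply: integ_cos; first exact: measurable_phase.
  exact: integ_shift.
have df (h : R) y : is_derive h (1 : R) (f ^~ y)
    (cos (dotrV y xi - theta) * 'D_(e_ i) u (y + h *: e_ i)).
  have D := is_derive_line tu y i h.
  by rewrite /f; apply: is_derive_eq.
have pf (h : R) y : partial1of2 f h y =
    cos (dotrV y xi - theta) * 'D_(e_ i) u (y + h *: e_ i).
  by rewrite partial1of2E; case: (df h y).
have Ia : `](0 - 1), (0 + 1)[%classic (0 : R).
  by rewrite /= in_itv/= sub0r add0r ltrN10 ltr01.
have derf (h : R) y : `](0 - 1), (0 + 1)[%classic h -> setT y ->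
    derivable (f ^~ y) h 1.
  by move=> _ _; case: (df h y).
pose G y := gauss_majorant (B + 1) M * gauss 1 y.
have B10 : 0 <= B + 1 by rewrite addr_ge0.
have G0 y : 0 <= G y.
  by rewrite mulr_ge0 ?gauss_ge0// divr_ge0// mulr_ge0 ?expR_ge0// exprn_ge0//
    ltW// gauss_peak_gt0.
have iG : integ G by exact/integ_mull/integ_gauss.
have Gub (h : R) y : `](0 - 1), (0 + 1)[%classic h -> setT y ->
    `|partial1of2 f h y| <= G y.
  rewrite /= in_itv/= sub0r add0r => /andP[h1 h2] _.
  rewrite pf normrM (@le_trans _ _ (`|'D_(e_ i) u (y + h *: e_ i)|))//.
    by rewrite ler_piMl ?cos_max.
  apply: (@bounded_support_gauss (fun y => 'D_(e_ i) u (y + h *: e_ i))) => //.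
  move=> z Bz; apply: duB.
  have he : `|h *: e_ i| <= 1.
    rewrite normrZ -[leRHS]mulr1 ler_pM//.
      by rewrite ler_norml !ltW.
    rewrite /Num.norm/= mx_normrE bigmax_le// => -[a j] _ /=.
    by rewrite mxE; case: (_ && _); rewrite ?normr1 ?normr0.
  have := ler_normB (z + h *: e_ i) (h *: e_ i); rewrite addrK.
  by move=> H; rewrite -(ltrD2r 1) (lt_le_trans Bz)// (le_trans H)// lerD2l.
have D1 := differentiation_under_integral measurableT Ia intf derf G0 iG Gub.
have FE (h : R) : \int[mu]_y f h y = ctrans u xi (theta + h * xi 0 i).
  pose g y := cos (dotrV y xi - (theta + h * xi 0 i)) * u y.
  rewrite /ctrans -(@Rint_shift _ _ g (h *: e_ i)); last first.
    by apply: mf_mul => //; apply: mf_cos; exact: measurable_phase.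
  apply: eq_Rintegral => y _; rewrite /f /g; congr (cos _ * _).
  by rewrite dotrVDl dotrVZl dotrV_delta; ring.
have FE' : (fun h => \int[mu]_y f h y) =
    (fun h => cos (theta + h * xi 0 i) * ctrans u xi 0 +
       sin (theta + h * xi 0 i) * ctrans u xi (pi / 2)).
  by apply/funext => h; rewrite FE ctrans_expand.
move: D1; rewrite FE' derive1E.
have -> : \int[mu]_y partial1of2 f 0 y = ctrans ('D_(e_ i) u) xi theta.
  by apply: eq_Rintegral => y _; rewrite pf scale0r addr0.
move=> <-; rewrite (ctrans_expand xi (theta + pi / 2) iu).
set a := ctrans u xi 0; set b := ctrans u xi (pi / 2).
have H : is_derive (0 : R) (1 : R) (fun h => cos (theta + h * xi 0 i) * a +
    sin (theta + h * xi 0 i) * b)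
    (xi 0 i * (- sin theta * a + cos theta * b)).
  apply: is_derive_eq; rewrite /GRing.scale/= mul0r addr0; ring.
case: H => _ ->; congr (_ * (_ * _ + _ * _)).
  by rewrite cosDpihalf.
by rewrite sinDpihalf.
Qed.

Lemma ctrans_derive2 u i xi theta : real_test u ->
  ctrans (fun y => u y - 'D_(e_ i) ('D_(e_ i) u) y) xi theta =
  (1 + xi 0 i ^+ 2) * ctrans u xi theta.
Proof.
move=> tu; have td := real_test_derive i tu; have tdd := real_test_derive i td.
rewrite /ctrans; under eq_Rintegral do rewrite mulrBr.
rewrite Rint_sub; last 2 first.
- by apply: integ_cos; [exact: measurable_phase|exact: real_test_integ].
- by apply: integ_cos; [exact: measurable_phase|exact: real_test_integ].
rewrite -/(ctrans _ _ _) -/(ctrans ('D_(e_ i) ('D_(e_ i) u)) xi theta).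
rewrite ctrans_derive// ctrans_derive//.
have -> : ctrans u xi (theta + pi / 2 + pi / 2) = - ctrans u xi theta.
  rewrite -Rint_opp; last first.
    by apply: integ_cos; [exact: measurable_phase|exact: real_test_integ].
  apply: eq_Rintegral => y _.
  have -> : dotrV y xi - (theta + pi / 2 + pi / 2) = dotrV y xi - theta - pi.
    by field.
  by rewrite (cosB (dotrV y xi - theta)) cospi sinpi; ring.
by rewrite expr2; ring.
Qed.

(** Applying [1 - D_i^2] repeatedly keeps the class of test functions and
    multiplies the transform by [1 + xi_i^2]. *)
Lemma ctrans_decay u (s : seq 'I_n) : real_test u -> exists C : R,
  forall xi theta,
    \prod_(i <- s) (1 + xi 0 i ^+ 2) * `|ctrans u xi theta| <= C.
Proof.
elim: s u => [|i s IH] u tu.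
  exists (\int[mu]_y `|u y|) => xi theta; rewrite big_nil mul1r.
  by apply: ctrans_le; exact: real_test_integ.
have tLu : real_test (fun y => u y - 'D_(e_ i) ('D_(e_ i) u) y).
  by apply: real_test_sub => //; do 2 apply: real_test_derive.
have [C HC] := IH _ tLu; exists C => xi theta.
rewrite big_cons mulrAC -mulrA; have := HC xi theta.
rewrite ctrans_derive2// normrM (ger0_norm (_ : 0 <= 1 + _))//; last first.
  by rewrite addr_ge0// sqr_ge0.
by apply: le_trans; rewrite le_eqVlt; apply/orP; left; apply/eqP; ring.
Qed.

Lemma prod_oneDsqr_ge xi : 1 + dotrV xi xi <= \prod_i (1 + xi 0 i ^+ 2).
Proof.
suff [] : 0 <= dotrV xi xi /\ 1 + dotrV xi xi <= \prod_i (1 + xi 0 i ^+ 2) by [].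
rewrite /dotrV; elim/big_ind2: _ => [|p q p' q' [p0 pq] [p'0 pq']|i _].
- by rewrite addr0.
- by split; [exact: addr_ge0|nra].
- by rewrite -expr2 sqr_ge0.
Qed.

(** A product of functions of one coordinate, so that its integrability follows
    from the one-dimensional case. *)
Definition decay_weight xi : R := \prod_i (1 + xi 0 i ^+ 2)^-1.

Lemma decay_weight_ge0 xi : 0 <= decay_weight xi.
Proof. by apply: prodr_ge0 => i _; rewrite invr_ge0 addr_ge0// sqr_ge0. Qed.

Lemma measurable_decay_weight : measurable_fun setT decay_weight.
Proof. by apply: measurable_prod => i _; meas. Qed.

(** Each coordinate is used twice in [ctrans_decay]: once for the integrable
    weight, and once for the factor [1 + |xi|^2], which absorbs the symbols of
    order at most 2. *)
Lemma ctrans_decay_weight u : real_test u -> exists2 C : R, 0 <= C &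
  forall xi theta,
    (1 + dotrV xi xi) * `|ctrans u xi theta| <= C * decay_weight xi.
Proof.
move=> tu; have [C HC] := ctrans_decay (index_enum 'I_n ++ index_enum 'I_n) tu.
exists C; first by apply: le_trans (HC 0 0); rewrite mulr_ge0// prodr_ge0 => // i _;
  rewrite addr_ge0// sqr_ge0.
move=> xi theta; have := HC xi theta; rewrite big_cat/=.
set P := \prod_i _ => HP.
have P0 : 0 < P by apply: prodr_gt0 => i _; rewrite ltr_pwDl// sqr_ge0.
have -> : decay_weight xi = P^-1 by rewrite /decay_weight prodfV.
rewrite ler_pdivlMr//; apply: le_trans HP; rewrite mulrAC ler_wpM2r//.
by rewrite ler_wpM2r ?(ltW P0)// prod_oneDsqr_ge.
Qed.

End cosine_transform.

Lemma integ_decay_weight (R : realType) n :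
  (lebesgue_rV R n).-integrable setT (EFin \o @decay_weight R n).
Proof.
apply: ge0_integ; [exact: measurable_decay_weight|exact: decay_weight_ge0|].
elim: n => [|n IH].
  rewrite integral_dirac//; last first.
    by apply/measurable_EFinP; exact: measurable_decay_weight.
  by rewrite diracT mul1e ltry.
rewrite ge0_integral_rV_cons; last 2 first.
- by apply/measurable_EFinP; exact: measurable_decay_weight.
- by move=> x; rewrite lee_fin decay_weight_ge0.
have J0 (t : R) : 0 <= (1 + t ^+ 2)^-1 by rewrite invr_ge0 addr_ge0// sqr_ge0.
pose W := (\int[lebesgue_rV R n]_x (decay_weight x)%:E)%E.
rewrite [X in (X < _)%E](_ : _ =
    (\int[@lebesgue_measure R]_t (((1 + t ^+ 2)^-1)%:E * W))%E); last first.
  apply: eq_integral => t _; rewrite -ge0_integralZl//; last 3 first.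
  - by apply/measurable_EFinP; exact: measurable_decay_weight.
  - by move=> x _; rewrite lee_fin decay_weight_ge0.
  - by rewrite lee_fin.
  apply: eq_integral => x _; rewrite -EFinM /decay_weight big_ord_recl rV_consE0.
  by congr (_ * _)%:E; apply: eq_bigr => i _; rewrite rV_consE_lift.
have mJ : measurable_fun setT (fun t : R => ((1 + t ^+ 2)^-1)%:E).
  by apply/measurable_EFinP; exact: integ_meas (integ_oneDsqrV R).
rewrite ge0_integralZr//; last 2 first.
- by move=> t _; rewrite lee_fin.
- by apply: integral_ge0 => x _; rewrite lee_fin decay_weight_ge0.
apply: lte_mul_pinfty => //.
- by apply: integral_ge0 => t _; rewrite lee_fin.
- by rewrite -EFin_Rint ?ltry//; exact: integ_oneDsqrV.
Qed.

(** * Powers of the frequency as superpositions of Gaussians *)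

Section scaling_integrals.
Context (R : realType).
Local Notation leb := (@lebesgue_measure R).
Local Notation integ f := (leb.-integrable setT (EFin \o f)).
Implicit Types s r t : R.

(** The integrand of [\int (1 - e^{- tau^2 / 2}) tau^{- s} d tau / tau] in the
    variable [t = ln tau]. *)
Definition frac_profile s t : R := (1 - expR (- (expR t ^+ 2 / 2))) * expR (- (s * t)).

(** The integrand of [\int e^{- tau^2 / 2} tau^s d tau / tau] in the variable
    [t = ln tau]. *)
Definition riesz_profile s t : R := expR (- (expR t ^+ 2 / 2)) * expR (s * t).

Definition frac_const s : R := \int[leb]_t frac_profile s t.

Definition riesz_const s : R := \int[leb]_t riesz_profile s t.

Lemma measurable_frac_profile s : measurable_fun setT (frac_profile s).
Proof. by apply: mf_mul; meas. Qed.

Lemma measurable_riesz_profile s : measurable_fun setT (riesz_profile s).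
Proof. by apply: mf_mul; meas. Qed.

Lemma frac_profile_gt0 s t : 0 < frac_profile s t.
Proof.
rewrite mulr_gt0 ?expR_gt0// subr_gt0 expR_lt1 oppr_lt0.
by rewrite divr_gt0// exprn_gt0// expR_gt0.
Qed.

Lemma riesz_profile_gt0 s t : 0 < riesz_profile s t.
Proof. by rewrite mulr_gt0 ?expR_gt0. Qed.

Lemma integ_frac_profile s : 0 < s < 2 -> integ (frac_profile s).
Proof.
move=> /andP[s0 s2].
apply: (@integ_two_sided _ _ 1 (2 - s) s) => //.
- by rewrite subr_gt0.
- exact: measurable_frac_profile.
- by move=> t; exact/ltW/frac_profile_gt0.
- move=> t; rewrite /frac_profile.
  have -> : 1 * expR ((2 - s) * t) = expR t ^+ 2 * expR (- (s * t)).
    by rewrite mul1r mulrBl expRD expRM_natl.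
  rewrite ler_wpM2r ?expR_ge0//.
  have := expR_ge1Dx (- (expR t ^+ 2 / 2)). have := sqr_ge0 (expR t); lra.
- move=> t; by rewrite mul1r /frac_profile ler_piMl ?expR_ge0// gerBl expR_ge0.
Qed.

Lemma integ_riesz_profile s : 0 < s < 2 -> integ (riesz_profile s).
Proof.
move=> /andP[s0 s2].
apply: (@integ_two_sided _ _ 2 s (2 - s)) => //.
- by rewrite subr_gt0.
- exact: measurable_riesz_profile.
- by move=> t; exact/ltW/riesz_profile_gt0.
- move=> t; rewrite /riesz_profile ler_wpM2r ?expR_ge0//.
  by rewrite (@le_trans _ _ 1)// ?ler1n// expR_le1 oppr_le0.
- move=> t; rewrite /riesz_profile.
  have -> : 2 * expR (- ((2 - s) * t)) = 2 / expR (2 * t) * expR (s * t).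
    by rewrite mulrBl opprB expRB; ring.
  rewrite ler_wpM2r ?expR_ge0//.
  have -> : 2 / expR (2 * t) = (expR t ^+ 2 / 2)^-1.
    by rewrite expRM_natl invf_div.
  rewrite expRN.
  rewrite lef_pV2 ?posrE ?expR_gt0// ?divr_gt0 ?exprn_gt0 ?expR_gt0//.
  by apply: le_trans (expR_ge1Dx _); rewrite lerDr.
Qed.

Lemma frac_const_gt0 s : 0 < s < 2 -> 0 < frac_const s.
Proof.
by move=> s2; apply: Rint_gt0; [exact: integ_frac_profile|
  exact: frac_profile_gt0].
Qed.

Lemma riesz_const_gt0 s : 0 < s < 2 -> 0 < riesz_const s.
Proof.
by move=> s2; apply: Rint_gt0; [exact: integ_riesz_profile|
  exact: riesz_profile_gt0].
Qed.

Let powR_expR r s t : 0 < r -> expR (s * (t + ln r)) = expR (s * t) * r `^ s.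
Proof.
by move=> r0; rewrite mulrDr expRD /powR gt_eqF.
Qed.

Let sqr_expR_shift r t : 0 < r -> expR (t + ln r) ^+ 2 = expR t ^+ 2 * r ^+ 2.
Proof. by move=> r0; rewrite expRD lnK ?posrE// exprMn. Qed.

Let integ_shiftR (f : R -> R) c : integ f -> integ (fun t => f (t + c)).
Proof.
move=> intf; apply: (@integ_measure_preserving _ _ _ leb (fun t => (t : R) + c) _ f) => //.
  by move=> F mF F0; exact: ge0_integral_lebesgue_shift.
by apply: mf_add; [exact: measurable_id|exact: mf_cst].
Qed.

(** In the logarithmic variable the dilation by [r] is the translation by
    [ln r], and the exponential factor produces the power [r ^ s]. *)
Lemma frac_scaling s r : 0 < s < 2 -> 0 <= r ->
  integ (fun t => (1 - expR (- (expR t ^+ 2 * r ^+ 2 / 2))) * expR (- (s * t))) /\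
  \int[leb]_t ((1 - expR (- (expR t ^+ 2 * r ^+ 2 / 2))) * expR (- (s * t))) =
  r `^ s * frac_const s.
Proof.
move=> s2; rewrite le_eqVlt => /predU1P[<-|r0].
  have E : (fun t : R => (1 - expR (- (expR t ^+ 2 * 0 ^+ 2 / 2))) *
      expR (- (s * t))) = fun=> 0.
    by apply/funext => t; rewrite expr0n/= mulr0 mul0r oppr0 expR0 subrr mul0r.
  rewrite E powR0 ?mul0r; last by case/andP: s2 => /gt_eqF ->.
  by split; [exact: integrable0|rewrite /Rintegral integral0].
have E : (fun t : R => (1 - expR (- (expR t ^+ 2 * r ^+ 2 / 2))) *
    expR (- (s * t))) = fun t => r `^ s * frac_profile s (t + ln r).
  apply/funext => t; rewrite /frac_profile sqr_expR_shift//.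
  rewrite (_ : expR (- (s * (t + ln r))) = expR (- (s * t)) / r `^ s).
    by field; rewrite gt_eqF// powR_gt0.
  by rewrite expRN powR_expR// invfM -expRN.
have ip := integ_frac_profile s2; rewrite E; split.
  exact/integ_mull/integ_shiftR.
rewrite Rint_mull; last exact: integ_shiftR.
by rewrite Rint_lebesgue_shift//; exact: measurable_frac_profile.
Qed.

Lemma riesz_scaling s r : 0 < s < 2 -> 0 < r ->
  integ (fun t => expR (- (expR t ^+ 2 * r ^+ 2 / 2)) * expR (s * t)) /\
  \int[leb]_t (expR (- (expR t ^+ 2 * r ^+ 2 / 2)) * expR (s * t)) =
  (r `^ s)^-1 * riesz_const s.
Proof.
move=> s2 r0.
have E : (fun t : R => expR (- (expR t ^+ 2 * r ^+ 2 / 2)) * expR (s * t)) =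
    fun t => (r `^ s)^-1 * riesz_profile s (t + ln r).
  apply/funext => t; rewrite /riesz_profile sqr_expR_shift// powR_expR//.
  by field; rewrite gt_eqF// powR_gt0.
have ip := integ_riesz_profile s2; rewrite E; split.
  exact/integ_mull/integ_shiftR.
rewrite Rint_mull; last exact: integ_shiftR.
by rewrite Rint_lebesgue_shift//; exact: measurable_riesz_profile.
Qed.

End scaling_integrals.

(** * The heat semigroup and the fractional Laplacian *)

Lemma integ_prod_tensor d1 d2 (T1 : measurableType d1) (T2 : measurableType d2)
    (R : realType) (m1 : {sigma_finite_measure set T1 -> \bar R})
    (m2 : {sigma_finite_measure set T2 -> \bar R}) (f : T1 * T2 -> R)
    (phi : T1 -> R) (psi : T2 -> R) :
  measurable_fun setT f -> m1.-integrable setT (EFin \o phi) ->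
  m2.-integrable setT (EFin \o psi) -> (forall x, 0 <= phi x) ->
  (forall x y, `|f (x, y)| <= phi x * psi y) ->
  (m1 \x m2)%E.-integrable setT (EFin \o f).
Proof.
move=> mf iphi ipsi phi0 fle.
apply: (@integ_prod _ _ _ _ _ m1 m2 f (fun x => phi x * \int[m2]_y psi y)) => //.
  exact: integ_mulr.
move=> x; rewrite -Rint_mull// EFin_Rint; last exact: integ_mull.
have mfx : measurable_fun setT (fun y => f (x, y)).
  exact: (measurableT_comp mf (pair1_measurable x)).
apply: ge0_le_integral => //.
- by apply/measurable_EFinP; exact: mf_norm.
- by apply/measurable_EFinP; apply: mf_mul; [exact: mf_cst|exact: integ_meas ipsi].
- by move=> y _; rewrite lee_fin.
Qed.

Section representation.
Context (R : realType) (n : nat).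
Local Notation mu := (lebesgue_rV R n).
Local Notation leb := (@lebesgue_measure R).
Implicit Types (u : 'rV[R]_n -> R) (x y z xi : 'rV[R]_n) (s tau : R).
Local Notation integ f := (mu.-integrable setT (EFin \o f)).

(** The heat semigroup at time [tau ^ 2 / 2]. *)
Definition heat tau u x : R := \int[mu]_y (gauss tau y * u (x + y)).

(** [(2 pi)^n] times the contribution of the frequency [xi] to [u x]. *)
Definition wave u x xi : R := ctrans u xi (dotrV x xi).

(** The fractional Laplacian [(- Delta)^(s/2)] of a real function. *)
Definition real_fracLap s u x : R :=
  ((2 * pi) ^- n) * \int[mu]_xi (enorm xi `^ s * wave u x xi).

Definition heat_symbol tau xi : R := expR (- (tau ^+ 2 * dotrV xi xi / 2)).

Lemma measurable_ctrans d (T : measurableType d) u (f : T -> 'rV[R]_n)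
    (theta : T -> R) : measurable_fun setT u -> measurable_fun setT f ->
  measurable_fun setT theta ->
  measurable_fun setT (fun t => ctrans u (f t) (theta t)).
Proof.
move=> mu_ mf mt.
apply: (@measurable_Rint _ _ _ _ _ mu
  (fun p => cos (dotrV p.2 (f p.1) - theta p.1) * u p.2)).
have mf1 : measurable_fun setT (fun p : T * 'rV[R]_n => f p.1).
  exact: (measurableT_comp mf measurable_fst).
have mt1 : measurable_fun setT (fun p : T * 'rV[R]_n => theta p.1).
  exact: (measurableT_comp mt measurable_fst).
have mu1 : measurable_fun setT (fun p : T * 'rV[R]_n => u p.2).
  exact: (measurableT_comp mu_ measurable_snd).
by meas.
Qed.

Lemma measurable_wave d (T : measurableType d) u (f g : T -> 'rV[R]_n) :
  measurable_fun setT u -> measurable_fun setT f -> measurable_fun setT g ->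
  measurable_fun setT (fun t => wave u (f t) (g t)).
Proof. by move=> mu_ mf mg; apply: measurable_ctrans => //; meas. Qed.

Lemma measurable_wave1 u x : real_test u -> measurable_fun setT (wave u x).
Proof.
move=> tu; apply: (@measurable_wave _ _ u (fun=> x) id); last by meas.
  exact: real_test_measurable.
by meas.
Qed.

Lemma wave_bound u s : real_test u -> 0 <= s <= 2 -> exists2 C : R, 0 <= C &
  forall x xi, `|wave u x xi| <= C * decay_weight xi /\
    `|enorm xi `^ s * wave u x xi| <= C * decay_weight xi.
Proof.
move=> tu s2; have [C C0 HC] := ctrans_decay_weight tu; exists C => // x xi.
have H := HC xi (dotrV x xi); rewrite -/(wave u x xi) in H.
split; apply: le_trans H.
  by rewrite ler_peMl// lerDl dotrV_ge0.
rewrite normrM (ger0_norm (powR_ge0 _ _)) ler_wpM2r//.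
by rewrite -sqr_enorm powR_le_1Dsqr// enorm_ge0.
Qed.

Lemma integ_weight (C : R) : integ (fun xi => C * decay_weight xi).
Proof. exact/integ_mull/integ_decay_weight. Qed.

Lemma integ_wave u x : real_test u -> integ (wave u x).
Proof.
move=> tu; have s1 : 0 <= (1 : R) <= 2 by rewrite ler01 ler1n.
have [C C0 HC] := wave_bound tu s1.
apply: (integ_le _ (integ_weight C)).
  exact: measurable_wave1.
by move=> xi; case: (HC x xi).
Qed.

Lemma measurable_enorm_wave u x s : real_test u ->
  measurable_fun setT (fun xi => enorm xi `^ s * wave u x xi).
Proof.
move=> tu; apply: mf_mul; first by meas.
exact: measurable_wave1.
Qed.

Lemma integ_enorm_wave u x s : real_test u -> 0 <= s <= 2 ->
  integ (fun xi => enorm xi `^ s * wave u x xi).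
Proof.
move=> tu s2; have [C C0 HC] := wave_bound tu s2.
apply: (integ_le (measurable_enorm_wave x s tu) (integ_weight C)).
by move=> xi; case: (HC x xi).
Qed.

Lemma heat_symbol_ge0 tau xi : 0 <= heat_symbol tau xi.
Proof. exact: expR_ge0. Qed.

Lemma heat_symbol_le1 tau xi : heat_symbol tau xi <= 1.
Proof.
by rewrite expR_le1 oppr_le0 divr_ge0// mulr_ge0 ?sqr_ge0// dotrV_ge0.
Qed.

Lemma measurable_heat_symbol tau : measurable_fun setT (heat_symbol tau).
Proof. by rewrite /heat_symbol; meas. Qed.

Lemma integ_heat_symbol tau : 0 < tau -> integ (heat_symbol tau).
Proof.
move=> tau0; have it0 : 0 < tau^-1 by rewrite invr_gt0.
have p0 : gauss_peak tau^-1 != 0 by rewrite gt_eqF// gauss_peak_gt0.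
rewrite (_ : heat_symbol tau =
    fun xi => (gauss_peak tau^-1) ^- n * gauss tau^-1 xi).
  exact/integ_mull/integ_gauss.
apply/funext => xi; rewrite /gauss mulKf ?expf_neq0//.
by congr expR; field; rewrite gt_eqF.
Qed.

(** Write the Gaussian as a Fourier integral and exchange the integrations. *)
Lemma heat_fourier tau u x : 0 < tau -> real_test u ->
  (2 * pi) ^+ n * heat tau u x = \int[mu]_xi (heat_symbol tau xi * wave u x xi).
Proof.
move=> tau0 tu; have iu := real_test_integ tu.
have mu_ := real_test_measurable tu.
pose f (p : 'rV[R]_n * 'rV[R]_n) :=
  heat_symbol tau p.1 * (cos (dotrV p.2 p.1 - dotrV x p.1) * u p.2).
have mf : measurable_fun setT f.
  have mu1 : measurable_fun setT (fun p : 'rV[R]_n * 'rV[R]_n => u p.2).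
    exact: (measurableT_comp mu_ measurable_snd).
  by rewrite /f /heat_symbol; meas.
have intf : (mu \x mu)%E.-integrable setT (EFin \o f).
  apply: (@integ_prod_tensor _ _ _ _ _ mu mu f (heat_symbol tau)
    (fun y => `|u y|)) => //.
  - exact: integ_heat_symbol.
  - exact: integ_abs.
  - exact: heat_symbol_ge0.
  - move=> xi y; rewrite /f/= normrM (ger0_norm (heat_symbol_ge0 _ _)).
    by rewrite ler_wpM2l ?heat_symbol_ge0// normrM ler_piMl ?cos_max.
have [_ E] := Rint_Fubini intf.
transitivity (\int[mu]_xi \int[mu]_y f (xi, y)); last first.
  apply: eq_Rintegral => xi _; rewrite /f/= Rint_mull//.
  by apply: integ_cos => //; exact: measurable_phase.
have mgu : measurable_fun setT (fun y => gauss tau (y - x) * u y).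
  by apply: mf_mul => //; exact: measurable_gauss_shift.
have igu : integ (fun y => gauss tau (y - x) * u y).
  apply: (@integ_boundl _ _ _ mu (gauss_peak tau ^+ n)) => //.
    move=> y; rewrite ger0_norm ?gauss_ge0// /gauss.
    rewrite ler_piMr ?exprn_ge0 ?(ltW (gauss_peak_gt0 tau0))//.
    by rewrite expR_le1 oppr_le0 divr_ge0 ?dotrV_ge0// mulr_ge0// sqr_ge0.
  exact: measurable_gauss_shift.
rewrite E -Rint_mull; last first.
  by have := integ_shift x igu; under eq_fun do rewrite addrK addrC.
rewrite -(@Rint_shift _ _ (fun y => \int[mu]_xi f (xi, y)) x); last first.
  by apply: measurable_Rint_swap.
apply: eq_Rintegral => y _; rewrite (addrC x) mulrA -gauss_inv_fourier// -Rint_mulr.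
  by apply: eq_Rintegral => xi _; rewrite /f/= dotrVDl addrK (dotrVC xi)
    /heat_symbol; ring.
apply: integ_cos; last exact: integ_heat_symbol.
exact: mf_dotl.
Qed.

End representation.

Section inversion.
Context (R : realType) (n : nat).
Local Notation mu := (lebesgue_rV R n).
Local Notation leb := (@lebesgue_measure R).
Implicit Types (u : 'rV[R]_n -> R) (x y z xi : 'rV[R]_n) (s tau : R).
Local Notation integ f := (mu.-integrable setT (EFin \o f)).

Lemma Rint_dotrV_gauss_le tau : 0 < tau ->
  integ (fun y : 'rV[R]_n => dotrV y y * gauss tau y) /\
  \int[mu]_y (dotrV y y * gauss tau y) <= gauss_moment2 R n * tau ^+ 2.
Proof.
move=> tau0; have mg := @measurable_gauss R tau n.
have H := integral_dotrV_gauss_le n tau0.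
have intf : integ (fun y : 'rV[R]_n => dotrV y y * gauss tau y).
  apply: ge0_integ; first by meas.
    by move=> y; rewrite mulr_ge0 ?dotrV_ge0// gauss_ge0.
  by apply: le_lt_trans H _; exact: ltry.
by split => //; rewrite -lee_fin EFin_Rint.
Qed.

Lemma normr_le_enorm x : `|x| <= enorm x.
Proof.
rewrite /Num.norm/= mx_normrE bigmax_le ?enorm_ge0// => -[a i] _ /=.
rewrite ord1 -ler_sqr ?nnegrE ?enorm_ge0// sqr_enorm real_normK ?num_real//.
by rewrite /dotrV (bigD1 i)//= expr2 lerDl sumr_ge0// => j _; rewrite -expr2 sqr_ge0.
Qed.

Lemma measurable_gauss_test tau u x : measurable_fun setT u ->
  measurable_fun setT (fun y => gauss tau y * u (x + y)).
Proof.
move=> mu_; apply: mf_mul; first exact: measurable_gauss.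
by apply: (measurableT_comp mu_); meas.
Qed.

Lemma integ_gauss_bounded tau u x (M : R) : 0 < tau -> measurable_fun setT u ->
  (forall y, `|u y| <= M) -> integ (fun y => gauss tau y * u (x + y)).
Proof.
move=> tau0 mu_ uM; under eq_fun do rewrite mulrC.
apply: (@integ_boundl _ _ _ mu M); last exact: integ_gauss.
  by move=> y; exact: uM.
by apply: (measurableT_comp mu_); meas.
Qed.

(** Near [x] the function is almost constant, and the mass of the Gaussian away
    from 0 is controlled by its second moment. *)
Lemma heat_cvg u x : real_test u ->
  heat (k.+1%:R^-1) u x @[k --> \oo] --> u x.
Proof.
move=> tu; have mu_ := real_test_measurable tu.
have [_ [M [_ M0 uM _]]] := real_test_bounded tu.
have cu := real_test_continuous tu.
apply/cvgrPdist_le => e e0.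
have [del del0 Hdel] : exists2 del : R, 0 < del &
    forall y : 'rV[R]_n, `|y| < del -> `|u x - u (x + y)| <= e / 2.
  have : \forall z \near x, `|u x - u z| <= e / 2.
    have /cvgrPdist_le H : u z @[z --> x] --> u x by exact: cu.
    by apply: H; rewrite divr_gt0.
  move/nbhs_ballP => [del /= del0 H]; exists del => // y yd.
  apply: H; rewrite -ball_normE /ball_/= opprD addrA subrr sub0r normrN.
  exact: yd.
have c0 : 0 <= 2 * M / del ^+ 2 by rewrite divr_ge0 ?sqr_ge0// mulr_ge0.
pose K := 2 * M / del ^+ 2 * gauss_moment2 R n.
have K0 : 0 <= K.
  by rewrite mulr_ge0// gauss_moment2_ge0.
have bnd tau : 0 < tau -> `|u x - heat tau u x| <= e / 2 + K * tau ^+ 2.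
  move=> tau0; have [iq qle] := Rint_dotrV_gauss_le tau0.
  have ig := @integ_gauss R tau tau0 n.
  have igu := integ_gauss_bounded x tau0 mu_ uM.
  have igx : integ (fun y => gauss tau y * u x) by exact: integ_mulr.
  have -> : u x - heat tau u x =
      \int[mu]_y (gauss tau y * u x - gauss tau y * u (x + y)).
    by rewrite Rint_sub// Rint_mulr// Rint_gauss// mul1r.
  apply: le_trans (normr_Rint_leR (integ_sub igx igu)) _.
  (* Where [|y| >= del], the difference is at most [2 M |y|^2 / del^2]. *)
  pose q y := e / 2 * gauss tau y + 2 * M / del ^+ 2 * (dotrV y y * gauss tau y).
  have i1 := integ_mull (e / 2) ig.
  have i2 := integ_mull (2 * M / del ^+ 2) iq.
  apply: (@le_trans _ _ (\int[mu]_y q y)).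
    apply: Rint_le; [exact: (integ_abs (integ_sub igx igu))|
      exact: (integ_add i1 i2)|move=> y].
    rewrite -mulrBr normrM (ger0_norm (gauss_ge0 tau0 _)) /q.
    rewrite mulrC [2 * M / _ * _]mulrA -mulrDl ler_wpM2r ?gauss_ge0//.
    have [yd|yd] := ltP `|y| del.
      apply: (le_trans (Hdel y yd)); by rewrite lerDl mulr_ge0 ?dotrV_ge0.
    apply: (@le_trans _ _ (2 * M)).
      rewrite (le_trans (ler_normB _ _))// mulr_natl mulr2n lerD//.
    rewrite (@le_trans _ _ (2 * M / del ^+ 2 * dotrV y y))//; last first.
      by rewrite lerDr divr_ge0 ?(ltW e0).
    rewrite mulrAC ler_pdivlMr ?exprn_gt0// ler_wpM2l ?mulr_ge0//.
    rewrite -sqr_enorm ler_sqr ?nnegrE ?(ltW del0) ?enorm_ge0//.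
    exact: le_trans yd (normr_le_enorm y).
  rewrite /q (Rint_add i1 i2) (Rint_mull (e / 2) ig).
  rewrite (Rint_mull (2 * M / del ^+ 2) iq) Rint_gauss// mulr1 lerD2l /K.
  by rewrite -[leRHS]mulrA ler_wpM2l.
have Kc : K * k.+1%:R^-1 @[k --> \oo] --> (0 : R).
  by rewrite -[X in _ --> X](mulr0 K); apply: cvgM; [exact: cvg_cst|exact: cvg_harmonic].
have : \forall k \near \oo, `|0 - K * k.+1%:R^-1| <= e / 2.
  by move/cvgrPdist_le : Kc => H; apply: H; rewrite divr_gt0.
apply: filterS => k; rewrite sub0r normrN.
have k0 : 0 < k.+1%:R^-1 :> R by rewrite invr_gt0.
rewrite ger0_norm => [Kk|]; last exact: (mulr_ge0 K0 (ltW k0)).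
apply: (le_trans (bnd _ k0)); rewrite [leRHS](splitr e) lerD2l.
apply: le_trans Kk; rewrite ler_wpM2l// expr2 ler_piMl ?(ltW k0)//.
by rewrite invf_le1// ler1n.
Qed.

Let c_gt0 : 0 < (2 * pi) ^+ n :> R.
Proof. by rewrite exprn_gt0// mulr_gt0// pi_gt0. Qed.

(** Fourier inversion: the limit [tau -> 0] of [heat_fourier]. *)
Lemma wave_inversion u x : real_test u ->
  (2 * pi) ^+ n * u x = \int[mu]_xi wave u x xi.
Proof.
move=> tu; have iw := integ_wave x tu.
have H1 : (2 * pi) ^+ n * heat (k.+1%:R^-1) u x @[k --> \oo] -->
    (2 * pi) ^+ n * u x.
  by apply: cvgM; [exact: cvg_cst|exact: heat_cvg].
have H2 : (2 * pi) ^+ n * heat (k.+1%:R^-1) u x @[k --> \oo] -->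
    \int[mu]_xi wave u x xi.
  under eq_cvg do rewrite heat_fourier//.
  apply: (@Rint_cvg _ _ _ mu
    (fun k xi => heat_symbol k.+1%:R^-1 xi * wave u x xi) (wave u x)
    (fun xi => `|wave u x xi|)).
  - move=> k; apply: mf_mul; first exact: measurable_heat_symbol.
    exact: measurable_wave1.
  - move=> xi; rewrite -[X in _ --> X]mul1r; apply: cvgM; last exact: cvg_cst.
    pose g (t : R) := expR (- (t ^+ 2 * dotrV xi xi / 2)).
    have g0 : g 0 = 1 by rewrite /g expr0n/= !mul0r oppr0 expR0.
    have cg : {for 0, continuous g}.
      by apply/differentiable_continuous/derivable1_diffP; rewrite /g;
        exact: ex_derive.
    have H : g (k.+1%:R^-1) @[k --> \oo] --> g 0.
      exact: (cvg_comp (fun k => k.+1%:R^-1) g (@cvg_harmonic R) cg).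
    by rewrite g0 in H.
  - exact: integ_abs.
  - move=> k xi; rewrite normrM (ger0_norm (heat_symbol_ge0 _ _)).
    by rewrite ler_piMl// heat_symbol_le1.
exact: cvg_unique H1 H2.
Qed.

Lemma ctrans_phaseD u xi theta phi : integ u ->
  ctrans u xi (theta + phi) =
  cos phi * ctrans u xi theta + sin phi * ctrans u xi (theta + pi / 2).
Proof.
move=> iu; rewrite (ctrans_expand xi (theta + phi) iu) (ctrans_expand xi theta iu).
rewrite (ctrans_expand xi (theta + pi / 2) iu).
by rewrite cosDpihalf sinDpihalf cosD sinD; ring.
Qed.

Lemma measurable_real_fracLap s u : real_test u ->
  measurable_fun setT (real_fracLap s u).
Proof.
move=> tu; apply: mf_mul; first exact: mf_cst.
apply: (@measurable_Rint _ _ _ _ _ mu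
  (fun p => enorm p.2 `^ s * wave u p.1 p.2)).
apply: mf_mul; first by meas.
by apply: measurable_wave; [exact: real_test_measurable|meas|meas].
Qed.

(** The heat semigroup commutes with the fractional Laplacian, both being
    Fourier multipliers. *)
Lemma heat_real_fracLap tau s u x : 0 < tau -> real_test u -> 0 <= s <= 2 ->
  (2 * pi) ^+ n * heat tau (real_fracLap s u) x =
  \int[mu]_xi (heat_symbol tau xi * (enorm xi `^ s * wave u x xi)).
Proof.
move=> tau0 tu s2; have iu := real_test_integ tu.
have mu_ := real_test_measurable tu.
have [C C0 HC] := wave_bound tu s2.
pose f (p : 'rV[R]_n * 'rV[R]_n) :=
  gauss tau p.1 * (enorm p.2 `^ s * wave u (x + p.1) p.2).
have mf : measurable_fun setT f.
  apply: mf_mul; first by meas.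
  apply: mf_mul; first by meas.
  by apply: measurable_wave => //; meas.
have ig := @integ_gauss R tau tau0 n.
have intf : (mu \x mu)%E.-integrable setT (EFin \o f).
  apply: (@integ_prod_tensor _ _ _ _ _ mu mu f (gauss tau)
    (fun xi => C * decay_weight xi)) => //.
  - exact: integ_weight.
  - exact: gauss_ge0.
  - move=> y xi; rewrite /f/= normrM (ger0_norm (gauss_ge0 tau0 _)).
    by rewrite ler_wpM2l ?gauss_ge0//; case: (HC (x + y) xi).
have fE y : \int[mu]_xi f (y, xi) =
    gauss tau y * \int[mu]_xi (enorm xi `^ s * wave u (x + y) xi).
  by rewrite -(Rint_mull (gauss tau y) (integ_enorm_wave (x + y) tu s2)).
have cK (a b : R) : (2 * pi) ^+ n * (a * ((2 * pi) ^- n * b)) = a * b.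
  by move: c_gt0 => c0; field; rewrite gt_eqF.
have cK' (a b : R) : (2 * pi) ^- n * (a * b) = a * ((2 * pi) ^- n * b).
  exact: mulrCA.
have [ifi _] := Rint_prod1 intf.
transitivity (\int[mu]_y \int[mu]_xi f (y, xi)).
  rewrite /heat -Rint_mull.
    apply: eq_Rintegral => y _; rewrite fE; exact: cK.
  have := integ_mull ((2 * pi) ^- n) ifi.
  rewrite (_ : (fun y => _) = fun y => gauss tau y * real_fracLap s u (x + y))//.
  by apply/funext => y; rewrite fE; exact: cK'.
rewrite (proj2 (Rint_Fubini intf)); apply: eq_Rintegral => xi _.
have ic : integ (fun y => cos (dotrV y xi) * gauss tau y).
  by apply: integ_cos => //; exact: mf_dotl.
have is_ : integ (fun y => sin (dotrV y xi) * gauss tau y).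
  by apply: integ_sin => //; exact: mf_dotl.
transitivity (\int[mu]_y (enorm xi `^ s *
    (wave u x xi * (cos (dotrV y xi) * gauss tau y) +
     ctrans u xi (dotrV x xi + pi / 2) * (sin (dotrV y xi) * gauss tau y)))).
  apply: eq_Rintegral => y _.
  by rewrite /f/= /wave dotrVDl ctrans_phaseD//; ring.
have i1 := integ_mull (wave u x xi) ic.
have i2 := integ_mull (ctrans u xi (dotrV x xi + pi / 2)) is_.
rewrite (Rint_mull _ (integ_add i1 i2)) (Rint_add i1 i2).
rewrite (Rint_mull _ ic) (Rint_mull _ is_) gauss_fourier_sin// mulr0 addr0.
by rewrite gauss_fourier// /heat_symbol mulrA mulrC.
Qed.

End inversion.

(** * Subordination *)

Section heat_representation.
Context (R : realType) (n : nat).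
Local Notation mu := (lebesgue_rV R n).
Local Notation leb := (@lebesgue_measure R).
Implicit Types (u : 'rV[R]_n -> R) (x y z xi : 'rV[R]_n) (s : R).

Let c_gt0 : 0 < (2 * pi) ^+ n :> R.
Proof. by rewrite exprn_gt0// mulr_gt0// pi_gt0. Qed.

Lemma measurable_heat_symbol_exp : measurable_fun setT
  (fun p : 'rV[R]_n * measurableTypeR R => heat_symbol (expR p.2) p.1).
Proof. by rewrite /heat_symbol; meas. Qed.

Let measurable_wave_fst u x : real_test u -> measurable_fun setT
  (fun p : 'rV[R]_n * measurableTypeR R => wave u x p.1).
Proof.
by move=> tu; exact: (measurableT_comp (measurable_wave1 x tu) measurable_fst).
Qed.

Lemma heat_symbol_exp t xi :
  heat_symbol (expR t) xi = expR (- (expR t ^+ 2 * enorm xi ^+ 2 / 2)).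
Proof. by rewrite sqr_enorm. Qed.

(** Integrate [(1 - e^{- tau^2 |xi|^2 / 2}) tau^{- s} d tau / tau] in [tau] to
    obtain the symbol [|xi|^s], with [tau = e^t]. *)
Lemma fracLap_heat s u x : 0 < s < 2 -> real_test u ->
  leb.-integrable setT
    (EFin \o (fun t : R => expR (- (s * t)) * (u x - heat (expR t) u x))) /\
  frac_const s * real_fracLap s u x =
  \int[leb]_t (expR (- (s * t)) * (u x - heat (expR t) u x)).
Proof.
move=> s2 tu.
have s02 : 0 <= s <= 2 by case/andP: s2 => s0 s1; rewrite !ltW.
pose f (p : 'rV[R]_n * measurableTypeR R) := wave u x p.1 *
  ((1 - heat_symbol (expR p.2) p.1) * expR (- (s * p.2))).
have mf : measurable_fun setT f.
  apply: mf_mul; first exact: measurable_wave_fst.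
  apply: mf_mul; last by meas.
  apply: mf_add; first exact: mf_cst.
  by apply: mf_opp; exact: measurable_heat_symbol_exp.
have iw := integ_enorm_wave x tu s02; have iw0 := integ_wave x tu.
have sc xi := frac_scaling s2 (enorm_ge0 xi).
have fE1 xi : \int[leb]_t f (xi, t) = frac_const s * (enorm xi `^ s * wave u x xi).
  have [i e] := sc xi; under eq_Rintegral do rewrite /f/= heat_symbol_exp.
  rewrite (Rint_mull _ i) e; ring.
have fE2 (t : R) : \int[mu]_xi f (xi, t) =
    (2 * pi) ^+ n * (expR (- (s * t)) * (u x - heat (expR t) u x)).
  have ihw : mu.-integrable setT
      (EFin \o (fun xi => heat_symbol (expR t) xi * wave u x xi)).
    apply: (@integ_boundl _ _ _ mu 1) => //; last exact: measurable_heat_symbol.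
    by move=> xi; rewrite ger0_norm ?heat_symbol_ge0// heat_symbol_le1.
  transitivity (\int[mu]_xi (expR (- (s * t)) *
      (wave u x xi - heat_symbol (expR t) xi * wave u x xi))).
    by apply: eq_Rintegral => xi _; rewrite /f/=; ring.
  rewrite (Rint_mull _ (integ_sub iw0 ihw)) (Rint_sub iw0 ihw).
  rewrite -wave_inversion// -heat_fourier ?expR_gt0//; ring.
have intf : (mu \x leb)%E.-integrable setT (EFin \o f).
  apply: (@integ_prod _ _ _ _ _ mu leb f
    (fun xi => `|enorm xi `^ s * wave u x xi| * frac_const s)) => //.
    exact/integ_mulr/integ_abs.
  move=> xi; have [i e] := sc xi.
  have i' := integ_mull `|wave u x xi| i.
  have -> : `|enorm xi `^ s * wave u x xi| * frac_const s =
      `|wave u x xi| * (enorm xi `^ s * frac_const s).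
    by rewrite normrM (ger0_norm (powR_ge0 _ _)); ring.
  rewrite -e -(Rint_mull _ i) (EFin_Rint i') le_eqVlt; apply/orP; left; apply/eqP.
  apply: eq_integral => t _; congr EFin; rewrite /f/= heat_symbol_exp.
  rewrite normrM; congr (_ * _); rewrite ger0_norm// mulr_ge0 ?expR_ge0//.
  by rewrite subr_ge0 -heat_symbol_exp heat_symbol_le1.
have [ift E] := Rint_Fubini intf.
have ih : leb.-integrable setT
    (EFin \o (fun t : R => expR (- (s * t)) * (u x - heat (expR t) u x))).
  have := integ_mull ((2 * pi) ^- n) ift; congr (is_true (_.-integrable _ _)).
  by apply/funext => t /=; congr EFin; rewrite fE2 mulKf// gt_eqF.
split; first exact: ih.
have Eh : \int[leb]_t ((2 * pi) ^+ n *
      (expR (- (s * t)) * (u x - heat (expR t) u x))) =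
    \int[leb]_t \int[mu]_xi f (xi, t).
  by apply: eq_Rintegral => t _; rewrite fE2.
apply: (@mulfI _ ((2 * pi) ^+ n)); first by rewrite gt_eqF.
rewrite -(Rint_mull _ ih) Eh -{}E.
have -> : \int[mu]_xi \int[leb]_t f (xi, t) =
    frac_const s * \int[mu]_xi (enorm xi `^ s * wave u x xi).
  by rewrite -(Rint_mull _ iw); apply: eq_Rintegral => xi _; exact: fE1.
by rewrite /real_fracLap mulrCA; congr (_ * _); rewrite mulVKf// gt_eqF.
Qed.

End heat_representation.

Section riesz_representation.
Context (R : realType) (n : nat).
Local Notation mu := (lebesgue_rV R n.+1).
Local Notation leb := (@lebesgue_measure R).
Implicit Types (u : 'rV[R]_n.+1 -> R) (x y z xi : 'rV[R]_n.+1) (s : R).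

Let c_gt0 : 0 < (2 * pi) ^+ n.+1 :> R.
Proof. by rewrite exprn_gt0// mulr_gt0// pi_gt0. Qed.

(** A test function is the Riesz potential of its fractional Laplacian,
    [|xi|^{-s}] being a superposition of the symbols [e^{- tau^2 |xi|^2 / 2}].
    The frequency 0 is lost, which is harmless in positive dimension. *)
Lemma riesz_heat s u x : 0 < s < 2 -> real_test u ->
  leb.-integrable setT
    (EFin \o (fun t : R => expR (s * t) * heat (expR t) (real_fracLap s u) x)) /\
  riesz_const s * u x =
  \int[leb]_t (expR (s * t) * heat (expR t) (real_fracLap s u) x).
Proof.
move=> s2 tu.
have s02 : 0 <= s <= 2 by case/andP: s2 => s0 s1; rewrite !ltW.
pose f (p : 'rV[R]_n.+1 * measurableTypeR R) := enorm p.1 `^ s * wave u x p.1 *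
  (heat_symbol (expR p.2) p.1 * expR (s * p.2)).
have mf : measurable_fun setT f.
  apply: mf_mul.
    exact: (measurableT_comp (measurable_enorm_wave x s tu) measurable_fst).
  by apply: mf_mul; [exact: measurable_heat_symbol_exp|meas].
have iw := integ_enorm_wave x tu s02; have iw0 := integ_wave x tu.
have k0 := riesz_const_gt0 s2.
have sc xi (xi0 : 0 < enorm xi) := riesz_scaling s2 xi0.
have e0 xi : xi != 0 -> 0 < enorm xi.
  move=> xi0; rewrite lt_neqAle enorm_ge0 andbT eq_sym.
  by apply: contra xi0 => /eqP/enorm_eq0/eqP.
have es0 : enorm (0 : 'rV[R]_n.+1) `^ s = 0.
  have -> : enorm (0 : 'rV[R]_n.+1) = 0.
    by rewrite /enorm -[0](scale0r (0 : 'rV_n.+1)) dotrVZl mul0r sqrtr0.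
  by rewrite powR0// gt_eqF//; case/andP: s2.
have fE1 xi : xi != 0 -> \int[leb]_t f (xi, t) = riesz_const s * wave u x xi.
  move=> xi0; have [i e] := sc xi (e0 _ xi0).
  under eq_Rintegral do rewrite /f/= heat_symbol_exp.
  by rewrite (Rint_mull _ i) e; field; rewrite gt_eqF// powR_gt0// e0.
have fE2 (t : R) : \int[mu]_xi f (xi, t) = (2 * pi) ^+ n.+1 *
    (expR (s * t) * heat (expR t) (real_fracLap s u) x).
  rewrite mulrCA heat_real_fracLap ?expR_gt0// -Rint_mull; last first.
    apply: (@integ_boundl _ _ _ mu 1) => //; last exact: measurable_heat_symbol.
    by move=> xi; rewrite ger0_norm ?heat_symbol_ge0// heat_symbol_le1.
  by apply: eq_Rintegral => xi _; rewrite /f/=; ring.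
have intf : (mu \x leb)%E.-integrable setT (EFin \o f).
  apply: (@integ_prod _ _ _ _ _ mu leb f
    (fun xi => `|wave u x xi| * riesz_const s)) => //.
    exact/integ_mulr/integ_abs.
  move=> xi; have [->|xi0] := eqVneq xi 0.
    under eq_integral do rewrite /f/= es0 mul0r mul0r normr0.
    by rewrite integral0 lee_fin mulr_ge0// ltW.
  have [i e] := sc xi (e0 _ xi0).
  have i' := integ_mull `|enorm xi `^ s * wave u x xi| i.
  have -> : `|wave u x xi| * riesz_const s =
      `|enorm xi `^ s * wave u x xi| * ((enorm xi `^ s)^-1 * riesz_const s).
    rewrite normrM (ger0_norm (powR_ge0 _ _)); field.
    by rewrite gt_eqF// powR_gt0// e0.
  rewrite -e -(Rint_mull _ i) (EFin_Rint i') le_eqVlt; apply/orP; left; apply/eqP.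
  apply: eq_integral => t _; congr EFin; rewrite /f/= heat_symbol_exp.
  by rewrite normrM; congr (_ * _); rewrite ger0_norm// mulr_ge0 ?expR_ge0.
have [ift E] := Rint_Fubini intf.
have ih : leb.-integrable setT
    (EFin \o (fun t : R => expR (s * t) * heat (expR t) (real_fracLap s u) x)).
  have := integ_mull ((2 * pi) ^- n.+1) ift; congr (is_true (_.-integrable _ _)).
  by apply/funext => t /=; congr EFin; rewrite fE2 mulKf// gt_eqF.
split; first exact: ih.
have Eh : \int[leb]_t ((2 * pi) ^+ n.+1 *
      (expR (s * t) * heat (expR t) (real_fracLap s u) x)) =
    \int[leb]_t \int[mu]_xi f (xi, t).
  by apply: eq_Rintegral => t _; rewrite fE2.
apply: (@mulfI _ ((2 * pi) ^+ n.+1)); first by rewrite gt_eqF.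
rewrite -(Rint_mull _ ih) Eh -{}E mulrCA wave_inversion// -(Rint_mull _ iw0).
have [ifi _] := Rint_prod1 intf.
rewrite /Rintegral; congr fine; apply/esym/ae_eq_integral => //.
- exact: measurable_int ifi.
- by apply/measurable_EFinP; apply: integ_meas (integ_mull (riesz_const s) iw0).
- exists [set 0]; split; [exact: measurable_rV_set1|exact: lebesgue_rV_set1|].
  move=> xi /= H; apply: contrapT => /eqP xi0; apply: H => _.
  by congr EFin; exact: fE1.
Qed.

End riesz_representation.

(** * Minkowski's integral inequality *)

Section product_measure_sigma_finite.
Context d1 d2 (T1 : measurableType d1) (T2 : measurableType d2) (R : realType).
Variables (m1 : {sigma_finite_measure set T1 -> \bar R})
  (m2 : {sigma_finite_measure set T2 -> \bar R}).

Let product_measure_sigma_finite : sigma_finite setT (m1 \x m2)%E.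
Proof.
have /sigma_finiteP[F [TF ndF Foo]] := sigma_finiteT m1.
have /sigma_finiteP[G [TG ndG Goo]] := sigma_finiteT m2.
exists (fun k => F k `*` G k).
  apply/seteqP; split=> // -[x y] _.
  have [i _ Fix] : (\bigcup_k F k) x by rewrite -TF.
  have [j _ Gjy] : (\bigcup_k G k) y by rewrite -TG.
  exists (maxn i j) => //; split.
  - by move: Fix; exact/subsetPset/ndF/leq_maxl.
  - by move: Gjy; exact/subsetPset/ndG/leq_maxr.
move=> k; have [mF Fk] := Foo k; have [mG Gk] := Goo k.
split; first exact: measurableX.
by rewrite product_measure1E// lte_mul_pinfty// ge0_fin_numE.
Qed.

(* A name of its own, because the canonical structures that are attached to the
   product measure itself select the one of a product of probabilities. *)
Definition sigma_finite_product : set (T1 * T2) -> \bar R := (m1 \x m2)%E.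

HB.instance Definition _ := Measure.copy sigma_finite_product (m1 \x m2)%E.
HB.instance Definition _ := Measure_isSigmaFinite.Build _ _ _
  sigma_finite_product product_measure_sigma_finite.

End product_measure_sigma_finite.

Section minkowski_integral.
Local Open Scope ereal_scope.

Lemma poweR2E (R : realType) (x : \bar R) : 0 <= x -> x `^ 2 = x * x.
Proof.
case: x => [r| |]//; first by rewrite lee_fin => r0; rewrite poweR_EFin powR_mulrn.
by rewrite poweRyr ?mulyy// pnatr_eq0.
Qed.

Lemma cauchy_schwarz_ge0 d (T : measurableType d) (R : realType)
    (mu : {measure set T -> \bar R}) (a b : T -> R) :
  measurable_fun setT a -> measurable_fun setT b ->
  (forall x, 0 <= a x)%R -> (forall x, 0 <= b x)%R ->
  (\int[mu]_x (a x * b x)%:E) * (\int[mu]_x (a x * b x)%:E) <=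
  (\int[mu]_x (a x ^+ 2)%:E) * (\int[mu]_x (b x ^+ 2)%:E).
Proof.
move=> ma mb a0 b0.
have sq (f : T -> R) : (forall x, 0 <= f x)%R ->
    \int[mu]_x (f x ^+ 2)%:E =
    Lnorm mu 2%:E (EFin \o f) * Lnorm mu 2%:E (EFin \o f).
  move=> f0; rewrite -poweR2E ?Lnorm_ge0// poweR_Lnorm ?pnatr_eq0//.
  by apply: eq_integral => x _; rewrite /= (ger0_norm (f0 x)) powR_mulrn.
have H := @hoelder _ _ _ mu a b 2 2 ma mb (ltr0n _ 2) (ltr0n _ 2).
have half : (2^-1 + 2^-1 = 1 :> R)%R by rewrite [RHS]splitr mul1r.
move: (H half); rewrite Lnorm1 => {}H.
have {}H : \int[mu]_x (a x * b x)%:E <=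
    Lnorm mu 2%:E (EFin \o a) * Lnorm mu 2%:E (EFin \o b).
  apply: le_trans H; rewrite le_eqVlt; apply/orP; left; apply/eqP.
  by apply: eq_integral => x _; rewrite /= ger0_norm// mulr_ge0.
rewrite (sq a)// (sq b)// muleACA; apply: lee_pmul => //;
  by apply: integral_ge0 => x _; rewrite lee_fin mulr_ge0.
Qed.

(** Minkowski's integral inequality in [L^2]: Cauchy-Schwarz with the weights
    [k B] and [k / B], then Tonelli. *)
Lemma minkowski_integral2 d1 d2 (X : measurableType d1) (Q : measurableType d2)
    (R : realType) (m : {sigma_finite_measure set X -> \bar R})
    (q : {sigma_finite_measure set Q -> \bar R})
    (F : X * Q -> R) (k B : Q -> R) (S : R) :
  measurable_fun setT F -> measurable_fun setT k -> measurable_fun setT B ->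
  (forall p, 0 <= F p)%R -> (forall y, 0 <= k y)%R -> (forall y, 0 <= B y)%R ->
  (forall y, B y = 0 -> k y = 0)%R ->
  (forall y, (0 < B y)%R -> \int[m]_x (F (x, y) ^+ 2)%:E <= (B y ^+ 2)%:E) ->
  \int[q]_y (k y * B y)%:E <= S%:E ->
  \int[m]_x ((\int[q]_y (F (x, y) * k y)%:E) * (\int[q]_y (F (x, y) * k y)%:E))
    <= (S ^+ 2)%:E.
Proof.
move=> mF mk mB F0 k0 B0 Bk HF HS.
have S0 : (0 <= S)%R.
  rewrite -lee_fin; apply: le_trans HS; apply: integral_ge0 => y _.
  by rewrite lee_fin mulr_ge0.
pose G (p : X * Q) : R := (F p ^+ 2 * (k p.2 / B p.2))%R.
have mk2 : measurable_fun setT (fun p : X * Q => k p.2).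
  exact: (measurableT_comp mk measurable_snd).
have mB2 : measurable_fun setT (fun p : X * Q => B p.2).
  exact: (measurableT_comp mB measurable_snd).
have mG : measurable_fun setT (EFin \o G).
  by apply/measurable_EFinP; rewrite /G; meas.
have G0 p : 0 <= (EFin \o G) p.
  by rewrite lee_fin mulr_ge0 ?sqr_ge0// divr_ge0.
have mFk : measurable_fun setT (fun p : X * Q => (F p * k p.2)%:E).
  by apply/measurable_EFinP; meas.
have mI : measurable_fun setT (fun x => \int[q]_y (F (x, y) * k y)%:E).
  apply: (measurable_fun_fubini_tonelli_F (fun p : X * Q => (F p * k p.2)%:E)) => //.
  by move=> p; rewrite lee_fin mulr_ge0.
have I0 x : 0 <= \int[q]_y (F (x, y) * k y)%:E.
  by apply: integral_ge0 => y _; rewrite lee_fin mulr_ge0.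
have mIG : measurable_fun setT (fun x => \int[q]_y (EFin \o G) (x, y)).
  exact: (measurable_fun_fubini_tonelli_F (EFin \o G)).
have IG0 x : 0 <= \int[q]_y (EFin \o G) (x, y) by exact: integral_ge0.
have pointwise x : (\int[q]_y (F (x, y) * k y)%:E) *
    (\int[q]_y (F (x, y) * k y)%:E) <= S%:E * \int[q]_y (EFin \o G) (x, y).
  have mFx : measurable_fun setT (fun y => F (x, y)).
    exact: (measurableT_comp mF (pair1_measurable x)).
  pose a y : R := Num.sqrt (k y * B y).
  pose b y : R := (F (x, y) * Num.sqrt (k y / B y))%R.
  have ma : measurable_fun setT a by rewrite /a; meas.
  have mb : measurable_fun setT b by rewrite /b; meas.
  have a0 y : (0 <= a y)%R by exact: sqrtr_ge0.
  have b0 y : (0 <= b y)%R by rewrite mulr_ge0// sqrtr_ge0.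
  have E : \int[q]_y (F (x, y) * k y)%:E = \int[q]_y (a y * b y)%:E.
    apply: eq_integral => y _; congr EFin; rewrite /a /b.
    have [By|By] := eqVneq (B y) 0%R; first by rewrite (Bk _ By) mulr0 mul0r sqrtr0 mul0r.
    rewrite mulrCA -sqrtrM ?mulr_ge0//.
    by rewrite mulrACA mulfV// mulr1 -expr2 sqrtr_sqr ger0_norm.
  rewrite E; apply: le_trans (cauchy_schwarz_ge0 q ma mb a0 b0) _.
  apply: lee_pmul.
  - by apply: integral_ge0 => y _; rewrite lee_fin sqr_ge0.
  - by apply: integral_ge0 => y _; rewrite lee_fin sqr_ge0.
  - apply: le_trans HS; rewrite le_eqVlt; apply/orP; left; apply/eqP.
    by apply: eq_integral => y _; rewrite /a sqr_sqrtr// mulr_ge0.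
  - rewrite le_eqVlt; apply/orP; left; apply/eqP.
    by apply: eq_integral => y _; rewrite /b /G/= exprMn sqr_sqrtr// divr_ge0.
apply: (@le_trans _ _ (\int[m]_x (S%:E * \int[q]_y (EFin \o G) (x, y)))).
  apply: ge0_le_integral => //.
  - by move=> x _; exact: mule_ge0.
  - exact: emeasurable_funM.
  - exact: measurable_funeM.
rewrite ge0_integralZl//.
rewrite expr2 EFinM; apply: lee_wpmul2l; first by rewrite lee_fin.
rewrite (fubini_tonelli (EFin \o G))//; apply: le_trans HS.
apply: ge0_le_integral => //.
- by move=> y _; exact: integral_ge0.
- exact: (measurable_fun_fubini_tonelli_G (EFin \o G)).
- by apply/measurable_EFinP; meas.
move=> y _; have [By|By] := eqVneq (B y) 0%R.
  rewrite By mulr0; under eq_integral do rewrite /G/= (Bk _ By) mul0r mulr0.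
  by rewrite integral0.
have {}By : (0 < B y)%R by rewrite lt_neqAle eq_sym By B0.
have kB0 : (0 <= k y / B y)%R by rewrite divr_ge0.
have mFy : measurable_fun setT (fun x => F (x, y)).
  exact: (measurableT_comp mF (pair2_measurable y)).
under eq_integral do rewrite /G/= mulrC EFinM.
rewrite ge0_integralZl//; last 2 first.
- by apply/measurable_EFinP; meas.
- by move=> x _; rewrite lee_fin sqr_ge0.
- apply: (@le_trans _ _ ((k y / B y)%:E * (B y ^+ 2)%:E)).
    by apply: lee_wpmul2l; [rewrite lee_fin|exact: HF].
  by rewrite -EFinM lee_fin expr2 mulrA divfK// gt_eqF.
Qed.

(** The index of integration will be a pair of a scale and a translation. *)
Lemma minkowski_integral2_product d1 d2 d3 (X : measurableType d1)
    (Q1 : measurableType d2) (Q2 : measurableType d3) (R : realType)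
    (m : {sigma_finite_measure set X -> \bar R})
    (q1 : {sigma_finite_measure set Q1 -> \bar R})
    (q2 : {sigma_finite_measure set Q2 -> \bar R})
    (F : X * (Q1 * Q2) -> R) (k B : Q1 * Q2 -> R) (S : R) :
  measurable_fun setT F -> measurable_fun setT k -> measurable_fun setT B ->
  (forall p, 0 <= F p)%R -> (forall y, 0 <= k y)%R -> (forall y, 0 <= B y)%R ->
  (forall y, B y = 0 -> k y = 0)%R ->
  (forall y, (0 < B y)%R -> \int[m]_x (F (x, y) ^+ 2)%:E <= (B y ^+ 2)%:E) ->
  \int[q1 \x q2]_y (k y * B y)%:E <= S%:E ->
  \int[m]_x ((\int[q1 \x q2]_y (F (x, y) * k y)%:E) *
    (\int[q1 \x q2]_y (F (x, y) * k y)%:E)) <= (S ^+ 2)%:E.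
Proof.
by move=> *; apply: (@minkowski_integral2 _ _ _ _ _ m
  (sigma_finite_product q1 q2) F k B).
Qed.

End minkowski_integral.

(** * Hoelder estimates of differences *)

Section riesz_kernel.
Context (R : realType) (n : nat).
Local Notation mu := (lebesgue_rV R n).
Local Notation leb := (@lebesgue_measure R).
Local Notation Q := (leb \x mu)%E.
Implicit Types (x y z : 'rV[R]_n) (s t : R).

(** The kernel of the difference quotient of the Riesz potential, before the
    integration in [t = ln tau]. *)
Definition riesz_kernel s z (p : measurableTypeR R * 'rV[R]_n) : R :=
  expR (s * p.1) * `|gauss (expR p.1) (p.2 - z) - gauss (expR p.1) p.2|.

(** The two bounds for the [L^1] distance of Gaussians, with the scale measured
    relative to the length of the translation. *)
Definition holder_profile s t : R := Num.min 2 (expR (- t)) * expR (s * t).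

Definition holder_const s : R := \int[leb]_t holder_profile s t.

Lemma measurable_riesz_kernel s z : measurable_fun setT (riesz_kernel s z).
Proof.
have m1 : measurable_fun setT
    (fun p : measurableTypeR R * 'rV[R]_n => expR p.1).
  exact: (measurableT_comp (@measurable_expR R) measurable_fst).
apply: mf_mul; first by apply: mf_expR; apply: mf_mul; [exact: mf_cst|exact: mf_fst].
apply: mf_norm; apply: mf_add.
  apply: mf_gauss => //.
  by apply: mf_rV_add; [exact: mf_snd|exact: measurable_cst].
by apply: mf_opp; apply: mf_gauss => //; exact: mf_snd.
Qed.

Lemma riesz_kernel_ge0 s z p : 0 <= riesz_kernel s z p.
Proof. by rewrite mulr_ge0 ?expR_ge0. Qed.

Lemma measurable_holder_profile s : measurable_fun setT (holder_profile s).
Proof.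
apply: mf_mul; last first.
  by apply: mf_expR; apply: mf_mul; [exact: mf_cst|exact: measurable_id].
by apply: mf_min; [exact: mf_cst|
  apply: mf_expR; apply: mf_opp; exact: measurable_id].
Qed.

Lemma holder_profile_ge0 s t : 0 <= holder_profile s t.
Proof. by rewrite mulr_ge0 ?expR_ge0// le_min expR_ge0 ler0n. Qed.

Lemma integ_holder_profile s : 0 < s < 1 ->
  leb.-integrable setT (EFin \o holder_profile s).
Proof.
move=> /andP[s0 s1]; apply: (@integ_two_sided _ _ 2 s (1 - s)) => //.
- by rewrite subr_gt0.
- exact: measurable_holder_profile.
- exact: holder_profile_ge0.
- by move=> t; rewrite ler_wpM2r ?expR_ge0// ge_min lexx.
- move=> t; have -> : - ((1 - s) * t) = - t + s * t by ring.
  rewrite expRD mulrA ler_wpM2r ?expR_ge0//.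
  rewrite ge_min; apply/orP; right.
  by rewrite -[leLHS]mul1r ler_wpM2r ?expR_ge0// ler1n.
Qed.

Lemma holder_const_ge0 s : 0 <= holder_const s.
Proof. by apply: Rintegral_ge0 => t _; exact: holder_profile_ge0. Qed.

Lemma integral_riesz_kernel_fiber s z t :
  (\int[mu]_y (riesz_kernel s z (t, y))%:E <=
   (expR (s * t) * Num.min 2 (enorm z / expR t))%:E)%E.
Proof.
have mg : measurable_fun setT (fun y => `|gauss (expR t) (y - z) - gauss (expR t) y|%:E).
  apply/measurable_EFinP; apply: mf_norm; apply: mf_add.
    exact: measurable_gauss_shift.
  by apply: mf_opp; exact: measurable_gauss.
rewrite /riesz_kernel/=; under eq_integral do rewrite EFinM.
rewrite ge0_integralZl//.
rewrite EFinM; apply: lee_wpmul2l; first by rewrite lee_fin expR_ge0.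
rewrite EFin_min le_min; apply/andP; split.
  exact: (integral_gauss_diff_le2 (expR_gt0 t)).
exact: (integral_gauss_diff_le (expR_gt0 t)).
Qed.

Lemma riesz_kernel_fiber_scaling s z t : 0 < enorm z ->
  expR (s * t) * Num.min 2 (enorm z / expR t) =
  enorm z `^ s * holder_profile s (t - ln (enorm z)).
Proof.
move=> z0; rewrite /holder_profile opprB expRD lnK ?posrE// expRN.
rewrite mulrBr expRB.
have -> : enorm z `^ s = expR (s * ln (enorm z)) by rewrite /powR gt_eqF.
by field; rewrite gt_eqF// expR_gt0.
Qed.

(** The integral over the scales converges at small scales because [s > 0] and at
    large scales because [s < 1]. *)
Lemma integral_riesz_kernel s z : 0 < s < 1 ->
  (\int[Q]_p (riesz_kernel s z p)%:E <= (holder_const s * enorm z `^ s)%:E)%E.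
Proof.
move=> s1; have mK := measurable_riesz_kernel s z.
have mKE : measurable_fun setT (fun p => (riesz_kernel s z p)%:E).
  exact/measurable_EFinP.
rewrite fubini_tonelli1//; last first.
  by move=> p; rewrite lee_fin riesz_kernel_ge0.
have [z0|z0] := eqVneq (enorm z) 0.
  rewrite (enorm_eq0 z0) /fubini_F integral0_eq => [|t _].
    by rewrite lee_fin mulr_ge0 ?holder_const_ge0// powR_ge0.
  rewrite integral0_eq// => y _.
  by rewrite /riesz_kernel/= subr0 subrr normr0 mulr0.
have {}z0 : 0 < enorm z by rewrite lt_neqAle eq_sym z0 enorm_ge0.
have ih := integ_holder_profile s1.
have mh := measurable_holder_profile s.
have mhE : measurable_fun setT (fun t : R => (holder_profile s t)%:E).
  exact/measurable_EFinP.
have mhs : measurable_fun setT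
    (fun t : R => (holder_profile s (t - ln (enorm z)))%:E).
  apply/measurable_EFinP; apply: (mf_comp mh).
  by apply: mf_add; [exact: measurable_id|exact: mf_cst].
apply: (@le_trans _ _ (\int[leb]_t ((enorm z `^ s)%:E *
    (holder_profile s (t - ln (enorm z)))%:E))%E).
  apply: ge0_le_integral => //.
  - by move=> t _; apply: integral_ge0 => y _; rewrite lee_fin riesz_kernel_ge0.
  - apply: (measurable_fun_fubini_tonelli_F (fun p => (riesz_kernel s z p)%:E)) => //.
    by move=> p; rewrite lee_fin riesz_kernel_ge0.
  - exact: measurable_funeM.
  - move=> t _; rewrite -EFinM -riesz_kernel_fiber_scaling//.
    exact: integral_riesz_kernel_fiber.
rewrite ge0_integralZl//; last 2 first.
- by move=> t _; rewrite lee_fin holder_profile_ge0.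
- by rewrite lee_fin powR_ge0.
rewrite (ge0_integral_lebesgue_shift
  (F := fun t => (holder_profile s t)%:E) (- ln (enorm z)))//; last first.
  by move=> t; rewrite lee_fin holder_profile_ge0.
by rewrite -(EFin_Rint ih) -EFinM mulrC.
Qed.

End riesz_kernel.

(* Unification must not unfold the Gaussian when it compares two translates. *)
Opaque gauss.

Section difference_estimates.
Context (R : realType) (n : nat).
Local Notation mu := (lebesgue_rV R n.+1).
Local Notation leb := (@lebesgue_measure R).
Local Notation Q := (leb \x mu)%E.
Implicit Types (u : 'rV[R]_n.+1 -> R) (x y z : 'rV[R]_n.+1) (s t : R).

Definition diff_const s : R := (riesz_const s)^-1 * holder_const s.

Lemma real_fracLap_bounded s u : real_test u -> 0 <= s <= 2 ->
  exists M, forall x, `|real_fracLap s u x| <= M.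
Proof.
move=> tu s2; have [C C0 HC] := wave_bound tu s2.
exists ((2 * pi) ^- n.+1 * \int[mu]_xi (C * decay_weight xi)) => x.
have c0 : 0 <= (2 * pi : R) ^- n.+1.
  by rewrite invr_ge0 exprn_ge0// mulr_ge0// pi_ge0.
have iw := integ_enorm_wave x tu s2.
rewrite normrM ger0_norm// ler_wpM2l//.
apply: (le_trans (normr_Rint_leR iw)); apply: Rint_le.
- exact: integ_abs.
- exact: integ_weight.
- by move=> xi; case: (HC x xi).
Qed.

(** Subtract the two Riesz potentials under the integral sign and put the
    translation on the Gaussian. *)
Lemma difference_le_kernel s u x z : 0 < s < 2 -> real_test u ->
  (`|u (x + z) - u x|%:E <= ((riesz_const s)^-1)%:E *
    \int[Q]_p (`|real_fracLap s u (x + p.2)| * riesz_kernel s z p)%:E)%E.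
Proof.
move=> s2 tu; have s02 : 0 <= s <= 2 by case/andP: s2 => s0 s1; rewrite !ltW.
have k0 := riesz_const_gt0 s2.
have kn0 : riesz_const s != 0 by rewrite gt_eqF.
have ki0 : 0 <= (riesz_const s)^-1 by rewrite invr_ge0 ltW.
have kK a : riesz_const s * ((riesz_const s)^-1 * a) = a by rewrite mulVKf.
set f := real_fracLap s u.
have mf : measurable_fun setT f by exact: measurable_real_fracLap.
have [M fM] := real_fracLap_bounded tu s02.
have mfx : measurable_fun setT (fun y => f (x + y)).
  by apply: (measurableT_comp mf); meas.
pose g (t : R) y := (gauss (expR t) (y - z) - gauss (expR t) y) * f (x + y).
have shE y : x + z + (y - z) = x + y by rewrite addrACA subrr addr0.
have dE (t : R) : heat (expR t) f (x + z) - heat (expR t) f x = \int[mu]_y g t y.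
  have t0 := expR_gt0 t.
  have E1 : (fun y => gauss (expR t) (y - z) * f (x + z + (y - z))) =
      (fun y => gauss (expR t) (y - z) * f (x + y)).
    by apply/funext => y; rewrite shE.
  have ig2 : mu.-integrable setT (EFin \o (fun y => gauss (expR t) (y - z) * f (x + y))).
    rewrite -E1.
    exact: (integ_shift (- z) (integ_gauss_bounded (x + z) t0 mf fM)).
  have -> : heat (expR t) f (x + z) = \int[mu]_y (gauss (expR t) (y - z) * f (x + y)).
    have H := Rint_shift (- z) (measurable_gauss_test (expR t) (x + z) mf).
    exact: (etrans (esym H) (congr1 (fun h => \int[mu]_y h y) E1)).
  have ig1 := integ_gauss_bounded x t0 mf fM.
  rewrite -(Rint_sub ig2 ig1).
  by apply: eq_Rintegral => y _; rewrite /g mulrBl.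
have mg (t : R) : measurable_fun setT (g t).
  apply: mf_mul; last exact: mfx.
  apply: mf_add; first exact: measurable_gauss_shift.
  by apply: mf_opp; exact: measurable_gauss.
have [i1 e1] := riesz_heat x s2 tu; have [i2 e2] := riesz_heat (x + z) s2 tu.
have uE : u (x + z) - u x =
    (riesz_const s)^-1 * \int[leb]_t (expR (s * t) * \int[mu]_y g t y).
  apply: (mulfI kn0); rewrite kK mulrBr e1 e2 -(Rint_sub i2 i1).
  by apply: eq_Rintegral => t _; rewrite -mulrBr dE.
rewrite uE normrM (ger0_norm ki0) EFinM.
apply: lee_wpmul2l; first by rewrite lee_fin.
have ii : leb.-integrable setT (EFin \o (fun t : R => expR (s * t) * \int[mu]_y g t y)).
  have := integ_sub i2 i1.
  by under eq_fun do rewrite -mulrBr dE.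
have H := @normr_Rint_le _ _ _ leb _ (integ_meas ii).
apply: (le_trans H); move: H => _.
have mF : measurable_fun setT (fun p : measurableTypeR R * 'rV[R]_n.+1 =>
    (`|f (x + p.2)| * riesz_kernel s z p)%:E).
  apply/measurable_EFinP; apply: mf_mul; last exact: measurable_riesz_kernel.
  by apply: mf_norm; exact: (measurableT_comp mfx measurable_snd).
have F0 p : (0 <= (`|f (x + p.2)| * riesz_kernel s z p)%:E)%E.
  by rewrite lee_fin mulr_ge0// riesz_kernel_ge0.
rewrite fubini_tonelli1//; apply: ge0_le_integral => //.
- by apply/measurable_EFinP; apply: mf_norm; exact: integ_meas ii.
- by apply: (measurable_fun_fubini_tonelli_F
    (fun p => (`|f (x + p.2)| * riesz_kernel s z p)%:E)).
move=> t _; rewrite normrM ger0_norm ?expR_ge0// EFinM.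
apply: (@le_trans _ _ ((expR (s * t))%:E * \int[mu]_y `|g t y|%:E)%E).
  apply: lee_wpmul2l; first by rewrite lee_fin expR_ge0.
  exact: normr_Rint_le.
have mgE : measurable_fun setT (fun y => `|g t y|%:E).
  by apply/measurable_EFinP; apply: mf_norm; exact: mg.
rewrite -ge0_integralZl//.
rewrite le_eqVlt; apply/orP; left; apply/eqP; apply: eq_integral => y _.
by rewrite -EFinM /g normrM /riesz_kernel/=; congr EFin; ring.
Qed.

End difference_estimates.

Section difference_norms.
Context (R : realType) (n : nat).
Local Notation mu := (lebesgue_rV R n.+1).
Local Notation leb := (@lebesgue_measure R).
Local Notation Q := (leb \x mu)%E.
Implicit Types (u f : 'rV[R]_n.+1 -> R) (x y z : 'rV[R]_n.+1) (s t : R).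

Lemma ae_bound_convolution f (w : 'rV[R]_n.+1 -> R) (N : R) x :
  measurable_fun setT f -> measurable_fun setT w -> (forall y, 0 <= w y) ->
  0 <= N -> (\forall y \ae mu, `|f y| <= N) ->
  (\int[mu]_y (`|f (x + y)| * w y)%:E <= N%:E * \int[mu]_y (w y)%:E)%E.
Proof.
move=> mf mw w0 N0 fN.
pose F y := (`|f y| * w (y - x))%:E.
have mwx : measurable_fun setT (fun y => w (y - x)).
  by apply: (measurableT_comp mw); apply: mf_rV_add;
    [exact: measurable_id|exact: measurable_cst].
have mF : measurable_fun setT F.
  by apply/measurable_EFinP; apply: mf_mul => //; exact: mf_norm.
have F0 y : (0 <= F y)%E by rewrite lee_fin mulr_ge0.
have mwE : measurable_fun setT (fun y => (w y)%:E) by exact/measurable_EFinP.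
have wE0 y : (0 <= (w y)%:E)%E by rewrite lee_fin.
have mwxE : measurable_fun setT (fun y => (w (y - x))%:E).
  exact/measurable_EFinP.
have -> : (\int[mu]_y (`|f (x + y)| * w y)%:E = \int[mu]_y F y)%E.
  rewrite -(ge0_integral_rV_shift x mF F0); apply: eq_integral => y _.
  by rewrite /F addrK addrC.
rewrite -(ge0_integral_rV_shift (- x) mwE wE0) -ge0_integralZl//.
apply: ae_ge0_le_integral => //.
- by move=> y _; rewrite -EFinM lee_fin mulr_ge0.
- exact: measurable_funeM.
apply: filterS fN => y fy _.
by rewrite /F -EFinM lee_fin ler_wpM2r.
Qed.

(** The average of [u] against the Gaussians of shrinking width recovers every
    value of [u], so that an almost everywhere bound holds everywhere. *)
Lemma ae_bound_everywhere u (M : R) : real_test u -> 0 <= M ->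
  (\forall y \ae mu, `|u y| <= M) -> forall x, `|u x| <= M.
Proof.
move=> tu M0 uM x; have mu_ := real_test_measurable tu.
have H : heat (k.+1%:R^-1) u x @[k --> \oo] --> u x by exact: heat_cvg.
apply: (@cvgr_to_le _ \oo _ _ (fun k => `|heat (k.+1%:R^-1) u x|)).
  exact: cvg_norm H.
apply: nearW => k; have k0 : 0 < k.+1%:R^-1 :> R by rewrite invr_gt0.
have mgu := measurable_gauss_test (k.+1%:R^-1) x mu_.
rewrite -lee_fin /=.
have H1 := @normr_Rint_le _ _ _ mu _ mgu.
apply: (le_trans H1); move: H1 => _.
have := ae_bound_convolution x mu_ (measurable_gauss k.+1%:R^-1 (n:=n.+1))
  (fun y => gauss_ge0 k0 y) M0 uM.
rewrite integral_gauss// mule1; apply: le_trans.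
rewrite le_eqVlt; apply/orP; left; apply/eqP; apply: eq_integral => y _.
by rewrite normrM (ger0_norm (gauss_ge0 k0 y)) mulrC.
Qed.

(** Hoelder estimate: a bounded fractional Laplacian of order [s < 1] controls
    the modulus of continuity of order [s]. *)
Lemma difference_sup s u (N : R) x z : 0 < s < 1 -> real_test u -> 0 <= N ->
  (\forall y \ae mu, `|real_fracLap s u y| <= N) ->
  `|u (x + z) - u x| <= diff_const s * N * enorm z `^ s.
Proof.
move=> s1 tu N0 fN.
have s2 : 0 < s < 2.
  by case/andP: s1 => -> /= s1; apply: (lt_trans s1); rewrite ltr1n.
have mf := measurable_real_fracLap s tu.
have mK := measurable_riesz_kernel s z.
have k0 := riesz_const_gt0 s2.
have KE0 (p : measurableTypeR R * 'rV[R]_n.+1) : (0 <= (riesz_kernel s z p)%:E)%E.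
  by rewrite lee_fin riesz_kernel_ge0.
have mKE : measurable_fun setT (fun p => (riesz_kernel s z p)%:E).
  exact/measurable_EFinP.
rewrite -lee_fin; apply: (le_trans (difference_le_kernel x z s2 tu)).
rewrite /diff_const -!mulrA EFinM.
apply: lee_wpmul2l; first by rewrite lee_fin invr_ge0 ltW.
have mFK : measurable_fun setT (fun p : measurableTypeR R * 'rV[R]_n.+1 =>
    (`|real_fracLap s u (x + p.2)| * riesz_kernel s z p)%:E).
  apply/measurable_EFinP; apply: mf_mul; last exact: mK.
  apply: mf_norm; apply: (measurableT_comp mf); apply: mf_rV_add.
    exact: measurable_cst.
  exact: mf_snd.
rewrite fubini_tonelli1//; last first.
  by move=> p; rewrite lee_fin mulr_ge0// riesz_kernel_ge0.
apply: (@le_trans _ _ (\int[leb]_t (N%:E * \int[mu]_y (riesz_kernel s z (t, y))%:E))%E).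
  apply: ge0_le_integral => //.
  - move=> t _; apply: integral_ge0 => y _.
    by rewrite lee_fin mulr_ge0// riesz_kernel_ge0.
  - apply: (measurable_fun_fubini_tonelli_F (fun p =>
      (`|real_fracLap s u (x + p.2)| * riesz_kernel s z p)%:E)) => //.
    by move=> p; rewrite lee_fin mulr_ge0// riesz_kernel_ge0.
  - apply: measurable_funeM.
    exact: (measurable_fun_fubini_tonelli_F (fun p => (riesz_kernel s z p)%:E)).
  - move=> t _; apply: ae_bound_convolution => //.
      exact: (measurableT_comp mK (pair1_measurable t)).
    by move=> y; exact: riesz_kernel_ge0.
rewrite ge0_integralZl//; last 2 first.
- exact: (measurable_fun_fubini_tonelli_F (fun p => (riesz_kernel s z p)%:E)).
- by move=> t _; apply: integral_ge0.
have := integral_riesz_kernel z s1; rewrite fubini_tonelli1// => H.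
apply: le_trans (lee_wpmul2l _ H) _; first by rewrite lee_fin.
by rewrite -EFinM lee_fin mulrCA mulrA.
Qed.

(** The same estimate in [L^2], by Minkowski's inequality. *)
Lemma difference_L2 s u (b : R) z : 0 < s < 1 -> real_test u -> 0 < b ->
  (\int[mu]_x (real_fracLap s u x ^+ 2)%:E <= (b ^+ 2)%:E)%E ->
  (\int[mu]_x ((u (x + z)%R - u x) ^+ 2)%:E <=
   ((diff_const s * enorm z `^ s * b) ^+ 2)%:E)%E.
Proof.
move=> s1 tu b0 fb.
have s2 : 0 < s < 2.
  by case/andP: s1 => -> /= s1; apply: (lt_trans s1); rewrite ltr1n.
have mf := measurable_real_fracLap s tu.
have mK := measurable_riesz_kernel s z.
have k0 := riesz_const_gt0 s2.
have mut := real_test_measurable tu.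
pose f := real_fracLap s u.
pose F (p : 'rV[R]_n.+1 * (measurableTypeR R * 'rV[R]_n.+1)) : R :=
  `|f (p.1 + p.2.2)|.
have mF : measurable_fun setT F.
  apply: mf_norm; apply: (measurableT_comp mf); apply: mf_rV_add.
    exact: mf_fst.
  exact: (measurableT_comp measurable_snd measurable_snd).
have K0 := @riesz_kernel_ge0 R n.+1 s z.
have kS : (\int[Q]_p (riesz_kernel s z p * b)%:E <=
    (holder_const s * enorm z `^ s * b)%:E)%E.
  under eq_integral do rewrite mulrC EFinM.
  rewrite ge0_integralZl//; last 3 first.
  - exact/measurable_EFinP.
  - by move=> p _; rewrite lee_fin.
  - by rewrite lee_fin ltW.
  rewrite [X in (_ <= X)%E]EFinM muleC; apply: lee_wpmul2r.
    by rewrite lee_fin ltW.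
  exact: integral_riesz_kernel.
have HF (p : measurableTypeR R * 'rV[R]_n.+1) : 0 < b ->
    (\int[mu]_x (F (x, p) ^+ 2)%:E <= (b ^+ 2)%:E)%E.
  move=> _; apply: le_trans fb; rewrite le_eqVlt; apply/orP; left; apply/eqP.
  rewrite -[RHS](ge0_integral_rV_shift p.2); last 2 first.
  - by apply/measurable_EFinP; apply: mf_exp.
  - by move=> x; rewrite lee_fin sqr_ge0.
  by apply: eq_integral => x _; rewrite /F/= real_normK ?num_real.
have Bk (p : measurableTypeR R * 'rV[R]_n.+1) : b = 0 -> riesz_kernel s z p = 0.
  by move=> b00; move: b0; rewrite b00 ltxx.
have c0 : 0 <= (riesz_const s)^-1 by rewrite invr_ge0 ltW.
pose I x := (\int[Q]_p (F (x, p) * riesz_kernel s z p)%:E)%E.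
have H : (\int[mu]_x (I x * I x) <=
    ((holder_const s * enorm z `^ s * b) ^+ 2)%:E)%E.
  exact: (@minkowski_integral2_product _ _ _ _ _ _ _ mu leb mu F _ (cst b) _
    mF mK (measurable_cst b) (fun p => normr_ge0 _) K0 (fun=> ltW b0) Bk HF kS).
have mFK : measurable_fun setT
    (fun p : 'rV[R]_n.+1 * (measurableTypeR R * 'rV[R]_n.+1) =>
      (F p * riesz_kernel s z p.2)%:E).
  apply/measurable_EFinP; apply: mf_mul => //.
  exact: (measurableT_comp mK measurable_snd).
have FK0 (p : 'rV[R]_n.+1 * (measurableTypeR R * 'rV[R]_n.+1)) :
    (0 <= (F p * riesz_kernel s z p.2)%:E)%E.
  by rewrite lee_fin mulr_ge0// normr_ge0.
have mI : measurable_fun setT I.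
  exact: (@measurable_fun_fubini_tonelli_F _ _ _ _ _ (sigma_finite_product leb mu) (fun p =>
    (F p * riesz_kernel s z p.2)%:E) mFK FK0).
have I0 x : (0 <= I x)%E by apply: integral_ge0 => p _; exact: (FK0 (x, p)).
apply: (@le_trans _ _ (\int[mu]_x (((riesz_const s)^-1 ^+ 2)%:E * (I x * I x)))%E).
  apply: ge0_le_integral => //.
  - by move=> x _; rewrite lee_fin sqr_ge0.
  - apply/measurable_EFinP; apply: mf_exp; apply: mf_add; last exact: mf_opp.
    by apply: (measurableT_comp mut); apply: mf_rV_add => //; exact: measurable_cst.
  - by apply: measurable_funeM; exact: emeasurable_funM.
  move=> x _; rewrite -(real_normK (num_real _)) !expr2 !EFinM muleACA.
  have D := difference_le_kernel x z s2 tu.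
  by apply: lee_pmul => //; rewrite lee_fin.
rewrite ge0_integralZl//; last 3 first.
- exact: emeasurable_funM.
- by move=> x _; exact: mule_ge0.
- by rewrite lee_fin sqr_ge0.
apply: le_trans (lee_wpmul2l _ H) _; first by rewrite lee_fin sqr_ge0.
by rewrite -EFinM lee_fin -exprMn /diff_const !mulrA.
Qed.

End difference_norms.

(** * The commutator as an integral of products of differences *)

Section carre_du_champ.
Context (R : realType) (n : nat).
Local Notation mu := (lebesgue_rV R n).
Local Notation leb := (@lebesgue_measure R).
Local Notation Q := (leb \x mu)%E.
Implicit Types (u g h : 'rV[R]_n -> R) (x y z : 'rV[R]_n) (s t : R).

(** The Levy kernel of the fractional Laplacian, before the integration in
    [t = ln tau]. *)
Definition levy_kernel s (p : measurableTypeR R * 'rV[R]_n) : R :=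
  expR (- (s * p.1)) * gauss (expR p.1) p.2.

Lemma measurable_levy_kernel s : measurable_fun setT (levy_kernel s).
Proof.
have m1 : measurable_fun setT
    (fun p : measurableTypeR R * 'rV[R]_n => expR p.1).
  exact: (measurableT_comp (@measurable_expR R) measurable_fst).
apply: mf_mul; last by apply: mf_gauss => //; exact: mf_snd.
apply: mf_expR; apply: mf_opp; apply: mf_mul; [exact: mf_cst|exact: mf_fst].
Qed.

Lemma levy_kernel_ge0 s p : 0 <= levy_kernel s p.
Proof. by rewrite mulr_ge0 ?expR_ge0// gauss_ge0// expR_gt0. Qed.

Definition commutator s g h x : R :=
  real_fracLap s (fun y => g y * h y) x - g x * real_fracLap s h x -
  h x * real_fracLap s g x.

Lemma measurable_rV_translate u x : measurable_fun setT u ->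
  measurable_fun setT (fun y => u (x + y)).
Proof.
move=> mu_; apply: (measurableT_comp mu_); apply: mf_rV_add.
  exact: measurable_cst.
exact: measurable_id.
Qed.

(** The Gaussian has integral 1, so the term [g x * h x] can be put under the
    integral sign, where the four products combine into one. *)
Lemma heat_commutator g h x (tau : R) : 0 < tau -> real_test g -> real_test h ->
  (g x * h x - heat tau (fun y => g y * h y) x) - g x * (h x - heat tau h x) -
    h x * (g x - heat tau g x) =
  - \int[mu]_y (gauss tau y * ((g (x + y) - g x) * (h (x + y) - h x))).
Proof.
move=> t0 tg th.
have bdd u : real_test u -> mu.-integrable setT
    (EFin \o (fun y => gauss tau y * u (x + y))).
  move=> tu; have [_ [M [_ _ uM _]]] := real_test_bounded tu.
  exact: (integ_gauss_bounded x t0 (real_test_measurable tu) uM).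
have igh := bdd _ (real_test_mul tg th); have ih := bdd _ th; have ig := bdd _ tg.
have i1 := integ_gauss t0 n; have e1 := Rint_gauss t0 n.
have jh := integ_mull (g x) ih; have jg := integ_mull (h x) ig.
have j1 := integ_mull (g x * h x) i1.
have E : (fun y => gauss tau y * ((g (x + y) - g x) * (h (x + y) - h x))) =
    (fun y => (gauss tau y * (g (x + y) * h (x + y)) - g x * (gauss tau y * h (x + y))) -
     (h x * (gauss tau y * g (x + y)) - (g x * h x) * gauss tau y)).
  by apply/funext => y; ring.
rewrite E (Rint_sub (integ_sub igh jh) (integ_sub jg j1)) (Rint_sub igh jh).
rewrite (Rint_sub jg j1) (Rint_mull _ ih) (Rint_mull _ ig) (Rint_mull _ i1) e1.
by rewrite /heat; ring.
Qed.

(** Since [1 - e^{t Delta}] annihilates constants, the commutator is the bilinear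
    form of the two difference functions with respect to the Levy kernel. *)
Lemma commutator_le s g h x : 0 < s < 2 -> real_test g -> real_test h ->
  (`|commutator s g h x|%:E <= ((frac_const s)^-1)%:E *
    \int[Q]_p (`|g (x + p.2) - g x| * `|h (x + p.2) - h x| *
      levy_kernel s p)%:E)%E.
Proof.
move=> s2 tg th.
have c0 := frac_const_gt0 s2; have cn0 : frac_const s != 0 by rewrite gt_eqF.
have ci0 : 0 <= (frac_const s)^-1 by rewrite invr_ge0 ltW.
have [i1 e1] := fracLap_heat x s2 (real_test_mul tg th).
have [i2 e2] := fracLap_heat x s2 th; have [i3 e3] := fracLap_heat x s2 tg.
have mg := real_test_measurable tg; have mh := real_test_measurable th.
pose I t := \int[mu]_y (gauss (expR t) y * ((g (x + y) - g x) * (h (x + y) - h x))).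
have j2 := integ_mull (g x) i2; have j3 := integ_mull (h x) i3.
have E : (fun t => expR (- (s * t)) * (g x * h x - heat (expR t) (fun y => g y * h y) x) -
    g x * (expR (- (s * t)) * (h x - heat (expR t) h x)) -
    h x * (expR (- (s * t)) * (g x - heat (expR t) g x))) =
    (fun t => expR (- (s * t)) * - I t).
  by apply/funext => t; rewrite /I -heat_commutator ?expR_gt0//; ring.
have TE : commutator s g h x = (frac_const s)^-1 *
    \int[leb]_t (expR (- (s * t)) * - I t).
  apply: (mulfI cn0); rewrite mulVKf//.
  rewrite -E (Rint_sub (integ_sub i1 j2) j3) (Rint_sub i1 j2).
  rewrite (Rint_mull _ i2) (Rint_mull _ i3) -e1 -e2 -e3.
  rewrite /commutator; move: (real_fracLap s _ x) (real_fracLap s _ x) (real_fracLap s _ x).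
  by move=> a b c; ring.
have mI : measurable_fun setT (fun t : R => expR (- (s * t)) * - I t).
  by rewrite -E; exact: integ_meas (integ_sub (integ_sub i1 j2) j3).
move=> {i1 i2 i3 e1 e2 e3 j2 j3 E}.
rewrite TE normrM (ger0_norm ci0) EFinM.
apply: lee_wpmul2l; first by rewrite lee_fin.
have H := @normr_Rint_le _ _ _ leb _ mI.
apply: (le_trans H); move: H => _.
pose F (p : measurableTypeR R * 'rV[R]_n) : R :=
  `|g (x + p.2) - g x| * `|h (x + p.2) - h x| * levy_kernel s p.
have md u : measurable_fun setT u -> measurable_fun setT (fun y => u (x + y) - u x).
  move=> mu_; apply: mf_add; first exact: measurable_rV_translate.
  exact: mf_cst.
have mF : measurable_fun setT (EFin \o F).
  apply/measurable_EFinP; apply: mf_mul; last exact: measurable_levy_kernel.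
  apply: mf_mul; apply: mf_norm.
    exact: (measurableT_comp (md g mg) measurable_snd).
  exact: (measurableT_comp (md h mh) measurable_snd).
have F0 p : (0 <= (EFin \o F) p)%E.
  by rewrite lee_fin mulr_ge0 ?levy_kernel_ge0// mulr_ge0.
rewrite (fubini_tonelli1 (EFin \o F))//; apply: ge0_le_integral => //.
- by apply/measurable_EFinP; apply: mf_norm.
- exact: (measurable_fun_fubini_tonelli_F (EFin \o F)).
move=> t _; rewrite mulrN normrN normrM (ger0_norm (expR_ge0 _)) EFinM.
have mG : measurable_fun setT (fun y => gauss (expR t) y *
    ((g (x + y) - g x) * (h (x + y) - h x))).
  by apply: mf_mul; [exact: measurable_gauss|apply: mf_mul; exact: md].
have mGE : measurable_fun setT (fun y => `|gauss (expR t) y *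
    ((g (x + y) - g x) * (h (x + y) - h x))|%:E).
  by apply/measurable_EFinP; exact: mf_norm.
apply: (@le_trans _ _ ((expR (- (s * t)))%:E * \int[mu]_y `|gauss (expR t) y *
    ((g (x + y) - g x) * (h (x + y) - h x))|%:E)%E).
  apply: lee_wpmul2l; first by rewrite lee_fin expR_ge0.
  exact: normr_Rint_le.
rewrite -ge0_integralZl//.
rewrite le_eqVlt; apply/orP; left; apply/eqP; apply: eq_integral => y _.
rewrite -EFinM /F /levy_kernel/=.
rewrite normrM (ger0_norm (gauss_ge0 (expR_gt0 t) y)) normrM.
by congr EFin; ring.
Qed.

End carre_du_champ.

(** * Interpolation between the two bounds *)

Section interpolation.
Context (R : realType) (n : nat).
Local Notation mu := (lebesgue_rV R n).
Local Notation leb := (@lebesgue_measure R).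
Local Notation Q := (leb \x mu)%E.
Implicit Types (x y z : 'rV[R]_n) (s t b M N : R).

(** The minimum of the two fibre integrals, with the scale measured relative to
    the crossover. *)
Definition interp_profile b s t : R := Num.min (expR ((b - s) * t)) (expR (b * t)).

Definition interp_const b s : R :=
  (1 + gauss_moment2 R n) * \int[leb]_t interp_profile b s t.

(** The bound for the differences of a function that is bounded by [M] and
    whose Hoelder seminorm of order [s] is bounded by [N]. *)
Definition interp_weight M N s y : R := Num.min M (N * enorm y `^ s).

Lemma measurable_interp_profile b s : measurable_fun setT (interp_profile b s).
Proof.
by apply: mf_min; apply: mf_expR; apply: mf_mul;
  [exact: mf_cst|exact: measurable_id|exact: mf_cst|exact: measurable_id].
Qed.

Lemma interp_profile_ge0 b s t : 0 <= interp_profile b s t.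
Proof. by rewrite le_min !expR_ge0. Qed.

Lemma integ_interp_profile b s : 0 < b < s ->
  leb.-integrable setT (EFin \o interp_profile b s).
Proof.
move=> /andP[b0 bs]; apply: (@integ_two_sided _ _ 1 b (s - b)) => //.
- by rewrite subr_gt0.
- exact: measurable_interp_profile.
- exact: interp_profile_ge0.
- by move=> t; rewrite mul1r ge_min lexx orbT.
- by move=> t; rewrite mul1r ge_min -mulNr opprB lexx.
Qed.

Lemma interp_const_ge0 b s : 0 <= interp_const b s.
Proof.
rewrite mulr_ge0// ?addr_ge0// ?gauss_moment2_ge0//.
by apply: Rintegral_ge0 => t _; exact: interp_profile_ge0.
Qed.

Lemma interp_weight_ge0 M N s y : 0 <= M -> 0 <= N -> 0 <= interp_weight M N s y.
Proof. by move=> M0 N0; rewrite le_min M0 mulr_ge0// powR_ge0. Qed.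

Lemma measurable_interp_weight M N s : measurable_fun setT (interp_weight M N s).
Proof.
apply: mf_min; first exact: mf_cst.
apply: mf_mul; first exact: mf_cst.
by apply: mf_powR; apply: mf_enorm; exact: measurable_id.
Qed.

(** The first bound is the smaller one for large scales, the second one for
    small scales. *)
Lemma integral_levy_interp_fiber b s M N t : 0 < b < s -> s < 1 -> 0 < M -> 0 < N ->
  (\int[mu]_y (levy_kernel s (t, y) * interp_weight M N s y * enorm y `^ b)%:E <=
   ((1 + gauss_moment2 R n) *
     Num.min (M * expR ((b - s) * t)) (N * expR (b * t)))%:E)%E.
Proof.
move=> /andP[b0 bs] s1 M0 N0; have s0 := lt_trans b0 bs.
have t0 := expR_gt0 t.
pose c := 1 + gauss_moment2 R n.
have c0 : 0 <= c by rewrite addr_ge0// gauss_moment2_ge0.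
have mA a : measurable_fun setT (fun y => (enorm y `^ a * gauss (expR t) y)%:E).
  apply/measurable_EFinP; apply: mf_mul; last exact: measurable_gauss.
  by apply: mf_powR; apply: mf_enorm; exact: measurable_id.
have A0 a y : (0 <= (enorm y `^ a * gauss (expR t) y)%:E)%E.
  by rewrite lee_fin mulr_ge0 ?powR_ge0// gauss_ge0.
have mW : measurable_fun setT
    (fun y => (levy_kernel s (t, y) * interp_weight M N s y * enorm y `^ b)%:E).
  apply/measurable_EFinP; apply: mf_mul; last first.
    by apply: mf_powR; apply: mf_enorm; exact: measurable_id.
  apply: mf_mul; last exact: measurable_interp_weight.
  exact: (measurableT_comp (@measurable_levy_kernel _ n s) (pair1_measurable t)).
have W0 y : (0 <= (levy_kernel s (t, y) * interp_weight M N s y * enorm y `^ b)%:E)%E.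
  by rewrite lee_fin mulr_ge0 ?powR_ge0// mulr_ge0 ?levy_kernel_ge0//
    interp_weight_ge0// ltW.
have eb a : expR t `^ a = expR (a * t) by rewrite /powR gt_eqF// expRK mulrC.
have step (C a : R) : 0 <= C -> 0 <= a <= 2 ->
    (forall y, interp_weight M N s y * enorm y `^ b <= C * enorm y `^ a) ->
    (\int[mu]_y (levy_kernel s (t, y) * interp_weight M N s y * enorm y `^ b)%:E <=
     (c * (C * expR ((a - s) * t)))%:E)%E.
  move=> C0 a2 HC.
  apply: (@le_trans _ _ (\int[mu]_y ((expR (- (s * t)) * C)%:E *
      (enorm y `^ a * gauss (expR t) y)%:E))%E).
    apply: ge0_le_integral => //.
    - exact: measurable_funeM.
    - move=> y _; rewrite -EFinM lee_fin /levy_kernel/=.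
      have := ler_wpM2l (mulr_ge0 (expR_ge0 (- (s * t))) (gauss_ge0 t0 y)) (HC y).
      move: (interp_weight M N s y) (enorm y `^ b) (enorm y `^ a).
      move: (gauss (expR t) y) (expR (- (s * t))) => G E w B A H.
      by rewrite -mulrA; apply: (le_trans H); rewrite (_ : E * C * _ = E * G * (C * A))//; ring.
  rewrite ge0_integralZl//; last by rewrite lee_fin mulr_ge0 ?expR_ge0.
  have H := integral_powR_enorm_gauss_le n t0 a2.
  apply: le_trans (lee_wpmul2l _ H) _; first by rewrite lee_fin mulr_ge0 ?expR_ge0.
  rewrite -EFinM lee_fin eb mulrBl expRB expRN /c.
  by rewrite le_eqVlt; apply/orP; left; apply/eqP; field; rewrite gt_eqF// expR_gt0.
rewrite minr_pMr// EFin_min le_min; apply/andP; split.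
  apply: step; [exact: ltW| |]; first by apply/andP; split; lra.
  by move=> y; rewrite ler_wpM2r ?powR_ge0// ge_min lexx.
have -> : b * t = (s + b - s) * t by ring.
apply: step; [exact: ltW|by apply/andP; split; lra|].
move=> y; rewrite (@powRD _ _ s b); last by rewrite gt_eqF ?addr_gt0.
by rewrite mulrA ler_wpM2r ?powR_ge0// ge_min lexx orbT.
Qed.

(** The two terms cross at [t = ln (M / N) / s]. *)
Lemma interp_profile_scaling b s M N t : 0 < s -> 0 < M -> 0 < N ->
  Num.min (M * expR ((b - s) * t)) (N * expR (b * t)) =
  N * (M / N) `^ (b / s) * interp_profile b s (t - ln (M / N) / s).
Proof.
move=> s0 M0 N0; have MN : 0 < M / N by rewrite divr_gt0.
set r := ln (M / N) / s.
have rE : ln (M / N) = s * r by rewrite /r [RHS]mulrC divfK// gt_eqF.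
have -> : (M / N) `^ (b / s) = expR (b * r).
  by rewrite /powR gt_eqF// rE; congr expR; field; rewrite gt_eqF.
have {1}-> : M = N * expR (s * r).
  by rewrite -rE lnK ?posrE// mulrCA mulfV ?mulr1// gt_eqF.
rewrite /interp_profile minr_pMr; last by rewrite mulr_ge0 ?expR_ge0// ltW.
by rewrite -!mulrA -!expRD; congr (Num.min (N * expR _) (N * expR _)); ring.
Qed.

Lemma integral_levy_interp b s M N : 0 < b < s -> s < 1 -> 0 < M -> 0 < N ->
  (\int[Q]_p (levy_kernel s p * interp_weight M N s p.2 * enorm p.2 `^ b)%:E <=
   (interp_const b s * (N * (M / N) `^ (b / s)))%:E)%E.
Proof.
move=> bs s1 M0 N0; have s0 : 0 < s by case/andP: bs => b0; exact: lt_trans.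
have mW : measurable_fun setT (fun p : measurableTypeR R * 'rV[R]_n =>
    (levy_kernel s p * interp_weight M N s p.2 * enorm p.2 `^ b)%:E).
  apply/measurable_EFinP; apply: mf_mul; last first.
    by apply: mf_powR; apply: mf_enorm; exact: mf_snd.
  apply: mf_mul; first exact: measurable_levy_kernel.
  exact: (measurableT_comp (measurable_interp_weight M N s) measurable_snd).
have W0 (p : measurableTypeR R * 'rV[R]_n) :
    (0 <= (levy_kernel s p * interp_weight M N s p.2 * enorm p.2 `^ b)%:E)%E.
  by rewrite lee_fin mulr_ge0 ?powR_ge0// mulr_ge0 ?levy_kernel_ge0//
    interp_weight_ge0// ltW.
have ip := integ_interp_profile bs; have mp := measurable_interp_profile b s.
have mpE : measurable_fun setT (fun t : R => (interp_profile b s t)%:E).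
  exact/measurable_EFinP.
pose r := ln (M / N) / s; pose c := N * (M / N) `^ (b / s).
have c0 : 0 <= c by rewrite mulr_ge0 ?powR_ge0// ltW.
have mps : measurable_fun setT (fun t : R => (interp_profile b s (t - r))%:E).
  apply/measurable_EFinP; apply: (mf_comp mp).
  by apply: mf_add; [exact: measurable_id|exact: mf_cst].
have m0 := gauss_moment2_ge0 R n.
rewrite fubini_tonelli1//.
apply: (@le_trans _ _ (\int[leb]_t (((1 + gauss_moment2 R n) * c)%:E *
    (interp_profile b s (t - r))%:E))%E).
  apply: ge0_le_integral => //.
  - by move=> t _; apply: integral_ge0 => y _; exact: (W0 (t, y)).
  - exact: (measurable_fun_fubini_tonelli_F (fun p : measurableTypeR R * 'rV[R]_n =>
      (levy_kernel s p * interp_weight M N s p.2 * enorm p.2 `^ b)%:E)).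
  - exact: measurable_funeM.
  - move=> t _; rewrite -EFinM -mulrA -interp_profile_scaling//.
    exact: integral_levy_interp_fiber.
rewrite ge0_integralZl//; last 2 first.
- by move=> t _; rewrite lee_fin interp_profile_ge0.
- by rewrite lee_fin mulr_ge0// addr_ge0.
rewrite (ge0_integral_lebesgue_shift
  (F := fun t => (interp_profile b s t)%:E) (- r))//; last first.
  by move=> t; rewrite lee_fin interp_profile_ge0.
by rewrite -(EFin_Rint ip) -EFinM lee_fin /interp_const mulrAC.
Qed.

End interpolation.

(** * The real estimate *)

Section weighted_differences.
Context (R : realType) (n : nat).
Local Notation mu := (lebesgue_rV R n.+1).
Local Notation leb := (@lebesgue_measure R).
Local Notation Q := (leb \x mu)%E.
Implicit Types (g h : 'rV[R]_n.+1 -> R) (x y : 'rV[R]_n.+1) (s b M N : R).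

Definition weighted_kernel M N s (p : measurableTypeR R * 'rV[R]_n.+1) : R :=
  levy_kernel s p * interp_weight M N s p.2.

Definition weighted_difference M N s h x : \bar R :=
  (\int[Q]_p (`|h (x + p.2) - h x| * weighted_kernel M N s p)%:E)%E.

Lemma diff_const_ge0 s : 0 < s < 1 -> 0 <= diff_const s :> R.
Proof.
move=> /andP[s0 s1]; rewrite mulr_ge0 ?holder_const_ge0// invr_ge0 ltW//.
by rewrite riesz_const_gt0// s0/= (lt_trans s1)// ltr1n.
Qed.

Lemma measurable_weighted_kernel M N s : measurable_fun setT (weighted_kernel M N s).
Proof.
apply: mf_mul; first exact: measurable_levy_kernel.
exact: (measurableT_comp (measurable_interp_weight M N s) measurable_snd).
Qed.

Lemma weighted_kernel_ge0 M N s p : 0 <= M -> 0 <= N -> 0 <= weighted_kernel M N s p.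
Proof. by move=> M0 N0; rewrite mulr_ge0 ?levy_kernel_ge0 ?interp_weight_ge0. Qed.

Lemma difference_le_weight s g M N x y : 0 < s < 1 -> real_test g ->
  0 <= M -> 0 <= N -> (\forall y \ae mu, `|g y| <= M) ->
  (\forall y \ae mu, `|real_fracLap s g y| <= N) ->
  `|g (x + y) - g x| <= (2 + diff_const s) * interp_weight M N s y.
Proof.
move=> s1 tg M0 N0 gM fN; have d0 := diff_const_ge0 s1.
have g_M := ae_bound_everywhere tg M0 gM.
have H1 : `|g (x + y) - g x| <= 2 * M.
  by rewrite mulrDl !mul1r (le_trans (ler_normB _ _))// lerD.
have H2 := difference_sup x y s1 tg N0 fN.
have y0 : 0 <= N * enorm y `^ s by rewrite mulr_ge0 ?powR_ge0.
rewrite /interp_weight minr_pMr ?addr_ge0// le_min; apply/andP; split.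
  by rewrite (le_trans H1)// ler_wpM2r// lerDl.
by rewrite (le_trans H2)// -mulrA ler_wpM2r// lerDr.
Qed.

Lemma measurable_difference h : measurable_fun setT h -> measurable_fun setT
  (fun p : 'rV[R]_n.+1 * (measurableTypeR R * 'rV[R]_n.+1) =>
    `|h (p.1 + p.2.2) - h p.1|).
Proof.
move=> mh; apply: mf_norm; apply: mf_add.
  apply: (measurableT_comp mh); apply: mf_rV_add; first exact: mf_fst.
  exact: (measurableT_comp measurable_snd measurable_snd).
by apply: mf_opp; exact: (measurableT_comp mh measurable_fst).
Qed.

Lemma commutator_le_weighted s g h M N x : 0 < s < 1 -> real_test g ->
  real_test h -> 0 <= M -> 0 <= N -> (\forall y \ae mu, `|g y| <= M) ->
  (\forall y \ae mu, `|real_fracLap s g y| <= N) ->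
  (`|commutator s g h x|%:E <= ((frac_const s)^-1 * (2 + diff_const s))%:E *
    weighted_difference M N s h x)%E.
Proof.
move=> s1 tg th M0 N0 gM fN.
have s2 : 0 < s < 2.
  by case/andP: s1 => -> /= s1; apply: (lt_trans s1); rewrite ltr1n.
have c0 := frac_const_gt0 s2; have d0 := diff_const_ge0 s1.
have mg := real_test_measurable tg; have mh := real_test_measurable th.
apply: (le_trans (commutator_le x s2 tg th)).
rewrite EFinM -muleA; apply: lee_wpmul2l; first by rewrite lee_fin invr_ge0 ltW.
have md (u : 'rV[R]_n.+1 -> R) : measurable_fun setT u -> measurable_fun setT
    (fun p : measurableTypeR R * 'rV[R]_n.+1 => `|u (x + p.2) - u x|).
  move=> mu_; apply: mf_norm; apply: mf_add; last exact: mf_cst.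
  exact: (measurableT_comp (measurable_rV_translate x mu_) measurable_snd).
have mk := measurable_weighted_kernel M N s.
have k0 p := @weighted_kernel_ge0 M N s p M0 N0.
rewrite -ge0_integralZl//; last 3 first.
- by apply/measurable_EFinP; apply: mf_mul => //; exact: md.
- by move=> p _; rewrite lee_fin mulr_ge0.
- by rewrite lee_fin addr_ge0.
apply: ge0_le_integral => //.
- by move=> p _; rewrite lee_fin mulr_ge0 ?levy_kernel_ge0// mulr_ge0.
- apply/measurable_EFinP; apply: mf_mul; last exact: measurable_levy_kernel.
  by apply: mf_mul; exact: md.
- apply: measurable_funeM; apply/measurable_EFinP.
  by apply: mf_mul => //; exact: md.
move=> p _; rewrite -EFinM lee_fin.
have H := difference_le_weight x p.2 s1 tg M0 N0 gM fN.
have hL0 : 0 <= `|h (x + p.2) - h x| * levy_kernel s p.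
  by rewrite mulr_ge0 ?levy_kernel_ge0.
have := ler_wpM2r hL0 H; rewrite /weighted_kernel.
move: (levy_kernel s p) (interp_weight M N s p.2) (2 + diff_const s) => L W K.
move: `|h _ - _| `|g _ - _| => D E; clear.
by rewrite mulrA => /le_trans; apply; rewrite (_ : K * (D * (L * W)) = K * W * (D * L))//; ring.
Qed.

(** Minkowski's inequality reduces the estimate to the translates of [h] for one
    [y] at a time, for which the [L^2] Hoelder estimate of order [b] holds. *)
Lemma weighted_difference_L2 b s h M N (c : R) : 0 < b < s -> s < 1 ->
  0 < M -> 0 < N -> real_test h -> 0 < c ->
  (\int[mu]_x (real_fracLap b h x ^+ 2)%:E <= (c ^+ 2)%:E)%E ->
  (\int[mu]_x (weighted_difference M N s h x * weighted_difference M N s h x) <=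
   ((interp_const n.+1 b s * (diff_const b + 1) * c *
      (N * (M / N) `^ (b / s))) ^+ 2)%:E)%E.
Proof.
move=> bs s1 M0 N0 th c0 fc; have [b0 bs'] := andP bs.
have b1 : 0 < b < 1 by rewrite b0/= (lt_trans bs').
have s0 : 0 < s by exact: lt_trans bs'.
have d0 := diff_const_ge0 b1; have dp : 0 < diff_const b + 1 by rewrite ltr_wpDl.
have mh := real_test_measurable th.
(* Adding 1 makes the constant positive, so that the bound vanishes only at
   [y = 0], where the weight vanishes as well. *)
pose B (p : measurableTypeR R * 'rV[R]_n.+1) := (diff_const b + 1) * c * enorm p.2 `^ b.
have mk := measurable_weighted_kernel M N s.
have k0 p : 0 <= weighted_kernel M N s p by exact: weighted_kernel_ge0 (ltW M0) (ltW N0).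
have mB : measurable_fun setT B.
  apply: mf_mul; first exact: mf_cst.
  by apply: mf_powR; apply: mf_enorm; exact: mf_snd.
have B0 p : 0 <= B p by rewrite mulr_ge0 ?powR_ge0// ltW// mulr_gt0.
have Bk p : B p = 0 -> weighted_kernel M N s p = 0.
  move=> /eqP; rewrite mulf_eq0 gt_eqF ?mulr_gt0//= powR_eq0 => /andP[/eqP e0 _].
  rewrite /weighted_kernel /interp_weight e0 powR0 ?gt_eqF// mulr0.
  by rewrite (min_idPr (ltW M0)) mulr0.
have HF p : 0 < B p ->
    (\int[mu]_x (`|h (x + p.2)%R - h x| ^+ 2)%:E <= (B p ^+ 2)%:E)%E.
  move=> _; have H := difference_L2 p.2 b1 th c0 fc.
  apply: (@le_trans _ _ (\int[mu]_x ((h (x + p.2)%R - h x) ^+ 2)%:E)%E).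
    rewrite le_eqVlt; apply/orP; left; apply/eqP; apply: eq_integral => x _.
    by rewrite real_normK ?num_real.
  apply: (le_trans H); rewrite lee_fin.
  have a0 : 0 <= diff_const b * enorm p.2 `^ b * c.
    by rewrite mulr_ge0 ?(ltW c0)// mulr_ge0 ?powR_ge0.
  rewrite ler_sqr ?nnegrE// /B mulrAC ler_wpM2r ?powR_ge0//.
  by rewrite ler_wpM2r ?lerDl// ltW.
have kS : (\int[Q]_p (weighted_kernel M N s p * B p)%:E <=
    (interp_const n.+1 b s * (diff_const b + 1) * c * (N * (M / N) `^ (b / s)))%:E)%E.
  pose f (p : measurableTypeR R * 'rV[R]_n.+1) : R :=
    levy_kernel s p * interp_weight M N s p.2 * enorm p.2 `^ b.
  have mf : measurable_fun setT (EFin \o f).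
    apply/measurable_EFinP; apply: mf_mul; first exact: mk.
    by apply: mf_powR; apply: mf_enorm; exact: mf_snd.
  have f0 p : (0 <= (EFin \o f) p)%E.
    by rewrite lee_fin mulr_ge0 ?powR_ge0//; exact: k0.
  rewrite (_ : (fun p => _) = (fun p => ((diff_const b + 1) * c)%:E * (EFin \o f) p)%E);
    last by apply/funext => p; rewrite -EFinM mulrCA.
  rewrite ge0_integralZl//; last by rewrite lee_fin ltW// mulr_gt0.
  apply: le_trans (lee_wpmul2l _ (integral_levy_interp n.+1 bs s1 M0 N0)) _.
    by rewrite lee_fin ltW// mulr_gt0.
  by rewrite -EFinM lee_fin le_eqVlt; apply/orP; left; apply/eqP; ring.
exact: (@minkowski_integral2_product _ _ _ _ _ _ _ mu leb mu _ _ B _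
  (measurable_difference mh) mk mB (fun p => normr_ge0 _) k0 B0 Bk HF kS).
Qed.

End weighted_differences.

(** * Reduction of complex functions to real ones *)

Section complex_form.
Local Open Scope complex_scope.
Context (R : realType) (n : nat).
Local Notation mu := (lebesgue_rV R n).
Local Notation integ f := (mu.-integrable setT (EFin \o f)).
Implicit Types (u v : 'rV[R]_n -> R) (f : 'rV[R]_n -> R[i]) (x y xi : 'rV[R]_n).

Definition re f x : R := complex.Re (f x).
Definition im f x : R := complex.Im (f x).

Lemma integ_enorm_ctrans u s (theta : 'rV[R]_n -> R) : real_test u ->
  0 <= s <= 2 -> measurable_fun setT theta ->
  integ (fun xi => enorm xi `^ s * ctrans u xi (theta xi)).
Proof.
move=> tu s2 mt; have [C C0 HC] := ctrans_decay_weight tu.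
apply: (@integ_le _ _ _ mu _ (fun xi => C * decay_weight xi)); last 2 first.
- exact: integ_weight.
- move=> xi; apply: le_trans (HC xi (theta xi)).
  rewrite normrM (ger0_norm (powR_ge0 _ _)) ler_wpM2r//.
  by rewrite -sqr_enorm powR_le_1Dsqr// enorm_ge0.
apply: mf_mul; first by apply: mf_powR; apply: mf_enorm; exact: measurable_id.
by apply: (@measurable_ctrans _ _ _ _ u id) => //; exact: real_test_measurable.
Qed.

(** The part of the inversion integral that is in quadrature with [wave] is odd
    in the frequency. *)
Lemma Rint_quadrature u s x : real_test u -> 0 <= s <= 2 ->
  integ (fun xi => enorm xi `^ s * ctrans u xi (dotrV x xi + pi / 2)) /\
  \int[mu]_xi (enorm xi `^ s * ctrans u xi (dotrV x xi + pi / 2)) = 0.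
Proof.
move=> tu s2; have iu := real_test_integ tu.
have mt : measurable_fun setT (fun xi => dotrV x xi + pi / 2) by meas.
have i1 := integ_enorm_ctrans tu s2 mt; split; first exact: i1.
apply: (Rint_rV_odd i1) => xi; rewrite enormN dotrVNr -mulrN; congr (_ * _).
rewrite /ctrans -(Rint_opp (integ_cos _ iu)); last exact: measurable_phase.
apply: eq_Rintegral => y _; rewrite -mulNr; congr (_ * _).
rewrite dotrVNr -[LHS]cosN.
rewrite (_ : - (_ - _) = dotrV y xi - dotrV x xi + pi / 2); last by ring.
rewrite (_ : dotrV y xi - (dotrV x xi + pi / 2) = dotrV y xi - dotrV x xi - pi / 2); last by ring.
by rewrite cosDpihalf cosBpihalf.
Qed.

(** [ctrans] at the angles [0] and [pi / 2] is the cosine and the sine transform. *)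
Lemma fourierE f xi : integ (re f) -> integ (im f) ->
  fourier f xi = (ctrans (re f) xi 0 + ctrans (im f) xi (pi / 2)) +i*
    (ctrans (im f) xi 0 - ctrans (re f) xi (pi / 2)).
Proof.
move=> i1 i2.
have ic u t : integ u -> integ (fun y => cos (dotrV y xi - t) * u y).
  by move=> iu; apply: integ_cos => //; exact: measurable_phase.
rewrite /fourier /Cintegral /ctrans -(Rint_add (ic _ _ i1) (ic _ _ i2)).
rewrite -(Rint_sub (ic _ _ i2) (ic _ _ i1)).
congr (_ +i* _); apply: eq_Rintegral => y _; rewrite /re /im /expi cosN sinN;
  by case: (f y) => a b /=; rewrite subr0 cosBpihalf; ring.
Qed.

Lemma fracLaplacianE s f x : real_test (re f) -> real_test (im f) ->
  0 <= s <= 1 ->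
  fracLaplacian s f x = real_fracLap (2 * s) (re f) x +i*
    real_fracLap (2 * s) (im f) x.
Proof.
move=> t1 t2 s1; have s2 : 0 <= 2 * s <= 2 by apply/andP; split; lra.
have i1 := real_test_integ t1; have i2 := real_test_integ t2.
have [j1 e1] := Rint_quadrature x t1 s2; have [j2 e2] := Rint_quadrature x t2 s2.
have w1 := integ_enorm_wave x t1 s2; have w2 := integ_enorm_wave x t2 s2.
rewrite /fracLaplacian /inv_fourier /real_fracLap.
have -> : Cintegral (fun xi => (enorm xi `^ (2 * s))%:C%C * fourier f xi *
      expi (dotrV x xi)) =
    (\int[mu]_xi (enorm xi `^ (2 * s) * wave (re f) x xi)) +i*
    (\int[mu]_xi (enorm xi `^ (2 * s) * wave (im f) x xi)).
  rewrite -[X in _ = X +i* _]addr0 -[X in _ = _ +i* X]subr0 -{1}e2 -e1.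
  rewrite -(Rint_add w1 j2) -(Rint_sub w2 j1) /Cintegral.
  congr (_ +i* _); apply: eq_Rintegral => xi _;
    rewrite (fourierE xi i1 i2) /expi/= /wave;
    rewrite (ctrans_expand _ (_ + _) i1, ctrans_expand _ (_ + _) i2);
    rewrite (ctrans_expand _ (dotrV x xi) i1, ctrans_expand _ (dotrV x xi) i2);
    by rewrite cosDpihalf sinDpihalf; ring.
by apply/eqP; rewrite eq_complex/=; apply/andP; split; apply/eqP; ring.
Qed.

Lemma test_function_parts f : test_function f ->
  real_test (re f) /\ real_test (im f).
Proof.
move=> [s1 s2 cf]; split; (split; first by []);
  apply: (subclosed_compact _ cf); try exact: closed_closure;
  apply: closure_subset => x /=; apply: contra => /eqP fx0;
  by rewrite /re /im fx0.
Qed.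

Lemma real_fracLap_addZ s (c : R) u v x : real_test u -> real_test v -> 0 <= s <= 2 ->
  real_fracLap s (fun y => u y + c * v y) x = real_fracLap s u x + c * real_fracLap s v x.
Proof.
move=> tu tv s2; have iu := real_test_integ tu; have iv := real_test_integ tv.
have wu := integ_enorm_wave x tu s2; have wv := integ_enorm_wave x tv s2.
rewrite /real_fracLap mulrCA -mulrDr; congr (_ * _).
rewrite -(Rint_mull _ wv) -(Rint_add wu (integ_mull c wv)).
apply: eq_Rintegral => xi _; rewrite mulrCA -mulrDr; congr (_ * _).
have ic w : integ w -> integ (fun y => cos (dotrV y xi - dotrV x xi) * w y).
  by move=> iw; apply: integ_cos => //; exact: measurable_phase.
rewrite /wave /ctrans -(Rint_mull _ (ic _ iv)) -(Rint_add (ic _ iu) (integ_mull c (ic _ iv))).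
by apply: eq_Rintegral => y _; ring.
Qed.

Lemma commutatorE s (g h : 'rV[R]_n -> R[i]) x : test_function g ->
  test_function h -> 0 <= s <= 1 ->
  fracLaplacian s (fun y => g y * h y) x - g x * fracLaplacian s h x -
    h x * fracLaplacian s g x =
  (commutator (2 * s) (re g) (re h) x - commutator (2 * s) (im g) (im h) x) +i*
  (commutator (2 * s) (re g) (im h) x + commutator (2 * s) (im g) (re h) x).
Proof.
move=> tg th s1; have s2 : 0 <= 2 * s <= 2 by apply/andP; split; lra.
have [g1 g2] := test_function_parts tg; have [h1 h2] := test_function_parts th.
have g1h1 := real_test_mul g1 h1; have g2h2 := real_test_mul g2 h2.
have g1h2 := real_test_mul g1 h2; have g2h1 := real_test_mul g2 h1.
have reE : re (fun y => g y * h y) = (fun y => re g y * re h y + (-1) * (im g y * im h y)).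
  by apply/funext => y; rewrite /re /im; case: (g y) (h y) => a b [c d]/=; rewrite mulN1r.
have imE : im (fun y => g y * h y) = (fun y => re g y * im h y + 1 * (im g y * re h y)).
  by apply/funext => y; rewrite /re /im mul1r; case: (g y) (h y) => a b [c d]/=; ring.
have tre : real_test (re (fun y => g y * h y)) by rewrite reE; exact: real_test_addZ.
have tim : real_test (im (fun y => g y * h y)) by rewrite imE; exact: real_test_addZ.
rewrite (fracLaplacianE x tre tim s1) (fracLaplacianE x h1 h2 s1).
rewrite (fracLaplacianE x g1 g2 s1) reE imE !real_fracLap_addZ//.
have cE (f : 'rV[R]_n -> R[i]) : f x = re f x +i* im f x.
  by rewrite /re /im; case: (f x).
rewrite (cE g) (cE h) /commutator.
move: (re g x) (im g x) (re h x) (im h x).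
move: (real_fracLap _ (re g) x) (real_fracLap _ (im g) x).
move: (real_fracLap _ (re h) x) (real_fracLap _ (im h) x).
move: (real_fracLap _ _ x) (real_fracLap _ _ x).
move: (real_fracLap _ _ x) (real_fracLap _ _ x) => a b c d e1 e2 f1 f2 r1 r2 r3 r4.
by apply/eqP; rewrite eq_complex/=; apply/andP; split; apply/eqP; ring.

Qed.

End complex_form.

(** * Norms of complex functions *)

Section complex_norms.
Context (R : realType) (n : nat).
Local Notation mu := (lebesgue_rV R n).
Local Notation normc := (@ComplexField.Normc.normc R).
Implicit Types (f : 'rV[R]_n -> R[i]) (z : R[i]).

Lemma normc_ge0 z : 0 <= normc z.
Proof. by case: z => a b; exact: sqrtr_ge0. Qed.

Lemma normr_Re_le z : `|complex.Re z| <= normc z.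
Proof. by case: z => a b /=; rewrite -sqrtr_sqr ler_wsqrtr// lerDl sqr_ge0. Qed.

Lemma normr_Im_le z : `|complex.Im z| <= normc z.
Proof. by case: z => a b /=; rewrite -sqrtr_sqr ler_wsqrtr// lerDr sqr_ge0. Qed.

Lemma normc_le_Re_Im z : normc z <= `|complex.Re z| + `|complex.Im z|.
Proof.
case: z => a b /=; rewrite -[leRHS]ger0_norm ?addr_ge0// -sqrtr_sqr ler_wsqrtr//.
rewrite sqrrD !real_normK ?num_real// -addrA [_ *+ 2 + _]addrC addrA lerDl.
by rewrite mulrn_wge0// mulr_ge0.
Qed.

Lemma CLnorm2_sqr f :
  (CLnorm 2%:E f * CLnorm 2%:E f = \int[mu]_x (normc (f x) ^+ 2)%:E)%E.
Proof.
rewrite -poweR2E ?Lnorm_ge0// /CLnorm poweR_Lnorm ?pnatr_eq0//.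
apply: eq_integral => x _ /=.
by rewrite (ger0_norm (normc_ge0 _)) powR_mulrn// normc_ge0.
Qed.

Lemma CLnorm2_le f (K : R) : 0 <= K ->
  (\int[mu]_x (normc (f x) ^+ 2)%:E <= (K ^+ 2)%:E)%E -> (CLnorm 2%:E f <= K%:E)%E.
Proof.
move=> K0; rewrite -CLnorm2_sqr; have : (0 <= CLnorm 2%:E f)%E by exact: Lnorm_ge0.
case: (CLnorm 2%:E f) => [r| |]//.
by rewrite !lee_fin => r0; rewrite -expr2 ler_sqr.
Qed.

(** A Gaussian has integral 1, which is impossible for the zero measure. *)
Lemma lebesgue_rV_gt0 : (0 < mu setT)%E.
Proof.
rewrite lt0e measure_ge0 andbT; apply/eqP => mu0.
have := integral_gauss (@ltr01 R) n.
rewrite null_set_integral//; first by move=> /eqP; rewrite eq_sym onee_eq0.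
by apply/measurable_EFinP; exact: measurable_gauss.
Qed.

Lemma CLnormy_ge f : (\forall x \ae mu, ((normc (f x))%:E <= CLnorm +oo f)%E).
Proof.
rewrite /CLnorm unlock /= lebesgue_rV_gt0; 
apply: filterS (ess_sup_ge mu (abse \o (fun x => (normc (f x))%:E))) => x.
by rewrite /= ger0_norm ?lee_fin ?normc_ge0.
Qed.

Lemma CLnormy_fin f (M : R) : (forall x, normc (f x) <= M) ->
  exists2 r : R, 0 <= r & CLnorm +oo f = r%:E.
Proof.
move=> fM; have : (0 <= CLnorm +oo f)%E by exact: Lnorm_ge0.
have : (CLnorm +oo f <= M%:E)%E.
  rewrite /CLnorm unlock /= lebesgue_rV_gt0; apply/ess_supP; apply: nearW => x.
  by rewrite /= ger0_norm ?lee_fin ?normc_ge0.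
by case: (CLnorm +oo f) => [r| |]// _; exists r.
Qed.

End complex_norms.

(** * The complex estimate *)

Section complex_commutator.
Context (R : realType) (n : nat).
Local Notation mu := (lebesgue_rV R n.+1).
Local Notation leb := (@lebesgue_measure R).
Local Notation Q := (leb \x mu)%E.
Local Notation normc := (@ComplexField.Normc.normc R).
Implicit Types (g h : 'rV[R]_n.+1 -> R[i]) (alpha beta s b M N c : R).

Definition complex_commutator alpha g h x : R[i] :=
  fracLaplacian alpha (fun y => g y * h y) x - g x * fracLaplacian alpha h x -
  h x * fracLaplacian alpha g x.

Definition bilinear_const s : R := (frac_const s)^-1 * (2 + diff_const s).

(** The factor 4 counts the products of a real or imaginary part of [g] with one
    of [h]. *)
Definition commutator_const b s : R :=
  4 * bilinear_const s * (interp_const n.+1 b s * (diff_const b + 1)).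

Definition majorant M N s (u : 'rV[R]_n.+1 -> R) x : \bar R :=
  ((bilinear_const s)%:E * weighted_difference M N s u x)%E.

Lemma sqr_add4_le (A B : \bar R) : (0 <= A)%E -> (0 <= B)%E ->
  ((A + B + (B + A)) * (A + B + (B + A)) <= 8%:E * (A * A + B * B))%E.
Proof.
have e8 : (0 < 8%:E :> \bar R)%E by rewrite lte_fin.
case: A B => [a| |] [b| |]// a0 b0.
- rewrite -!EFinD -!EFinM lee_fin -subr_ge0 (_ : _ - _ = 4 * (a - b) ^+ 2); last by ring.
  by rewrite mulr_ge0// sqr_ge0.
- by rewrite mulyy addey// gt0_muley// leey.
- by rewrite mulyy addye// gt0_muley// leey.
- by rewrite mulyy addye// gt0_muley// leey.
Qed.

Lemma bilinear_const_ge0 s : 0 < s < 1 -> 0 <= bilinear_const s.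
Proof.
move=> s1; have s2 : 0 < s < 2.
  by case/andP: s1 => -> /= s1; apply: (lt_trans s1); rewrite ltr1n.
by rewrite mulr_ge0 ?addr_ge0 ?diff_const_ge0// invr_ge0 ltW// frac_const_gt0.
Qed.

Lemma commutator_const_ge0 b s : 0 < b < 1 -> 0 < s < 1 -> 0 <= commutator_const b s.
Proof.
move=> b1 s1; rewrite mulr_ge0//; first by rewrite mulr_ge0// bilinear_const_ge0.
by rewrite mulr_ge0 ?interp_const_ge0// addr_ge0// diff_const_ge0.
Qed.

Lemma bounded_of_normc_re_im g (N : R) : (\forall x \ae mu, normc (g x) <= N) ->
  (\forall x \ae mu, `|re g x| <= N) /\ (\forall x \ae mu, `|im g x| <= N).
Proof.
move=> gN; split; apply: filterS gN => x; apply: le_trans.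
  exact: normr_Re_le.
exact: normr_Im_le.
Qed.

Lemma re_im_fracLaplacian s g : test_function g -> 0 <= s <= 1 ->
  re (fracLaplacian s g) = real_fracLap (2 * s) (re g) /\
  im (fracLaplacian s g) = real_fracLap (2 * s) (im g).
Proof.
move=> tg s1; have [g1 g2] := test_function_parts tg.
by split; apply/funext => x; rewrite /re /im fracLaplacianE.
Qed.

Lemma normc_commutator_le alpha g h M N x : 0 < 2 * alpha < 1 ->
  test_function g -> test_function h -> 0 <= M -> 0 <= N ->
  (\forall x \ae mu, normc (g x) <= M) ->
  (\forall x \ae mu, normc (fracLaplacian alpha g x) <= N) ->
  ((normc (complex_commutator alpha g h x))%:E <=
   majorant M N (2 * alpha) (re h) x + majorant M N (2 * alpha) (im h) x +
   (majorant M N (2 * alpha) (im h) x + majorant M N (2 * alpha) (re h) x))%E.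
Proof.
move=> s1 tg th M0 N0 gM fN.
have a1 : 0 <= alpha <= 1 by case/andP: s1 => *; apply/andP; split; lra.
have [g1 g2] := test_function_parts tg; have [h1 h2] := test_function_parts th.
have [gM1 gM2] := bounded_of_normc_re_im gM.
have := bounded_of_normc_re_im fN; have [-> ->] := re_im_fracLaplacian tg a1.
move=> [fN1 fN2].
have HC (u v : 'rV[R]_n.+1 -> R) (tg' : real_test u) (th' : real_test v)
    (gM' : \forall y \ae mu, `|u y| <= M)
    (fN' : \forall y \ae mu, `|real_fracLap (2 * alpha) u y| <= N) :
    (`|commutator (2 * alpha) u v x|%:E <= majorant M N (2 * alpha) v x)%E.
  exact: commutator_le_weighted.
rewrite /complex_commutator (commutatorE x tg th a1).
set z := (X in normc X).
apply: (@le_trans _ _ (`|complex.Re z| + `|complex.Im z|)%:E).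
  by rewrite lee_fin normc_le_Re_Im.
rewrite EFinD; apply: leeD; rewrite /z/=.
  apply: (@le_trans _ _ (`|commutator (2 * alpha) (re g) (re h) x| +
    `|commutator (2 * alpha) (im g) (im h) x|)%:E).
    by rewrite lee_fin ler_normB.
  by rewrite EFinD; apply: leeD; exact: HC.
apply: (@le_trans _ _ (`|commutator (2 * alpha) (re g) (im h) x| +
    `|commutator (2 * alpha) (im g) (re h) x|)%:E).
  by rewrite lee_fin ler_normD.
by rewrite EFinD; apply: leeD; exact: HC.
Qed.

Lemma measurable_weighted_difference M N s (u : 'rV[R]_n.+1 -> R) :
  0 <= M -> 0 <= N -> measurable_fun setT u ->
  measurable_fun setT (weighted_difference M N s u).
Proof.
move=> M0 N0 mu_.
pose F (p : 'rV[R]_n.+1 * (measurableTypeR R * 'rV[R]_n.+1)) : R :=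
  `|u (p.1 + p.2.2) - u p.1| * weighted_kernel M N s p.2.
have mF : measurable_fun setT (EFin \o F).
  apply/measurable_EFinP; apply: mf_mul; first exact: measurable_difference.
  exact: (measurableT_comp (measurable_weighted_kernel M N s) measurable_snd).
have F0 p : (0 <= (EFin \o F) p)%E.
  by rewrite lee_fin mulr_ge0// weighted_kernel_ge0.
exact: (@measurable_fun_fubini_tonelli_F _ _ _ _ _ (sigma_finite_product leb mu)
  (EFin \o F) mF F0).
Qed.

Lemma weighted_difference_ge0 M N s (u : 'rV[R]_n.+1 -> R) x :
  0 <= M -> 0 <= N -> (0 <= weighted_difference M N s u x)%E.
Proof.
move=> M0 N0; apply: integral_ge0 => p _.
by rewrite lee_fin mulr_ge0// weighted_kernel_ge0.
Qed.

Lemma measurable_sqr_normc_fracLaplacian s h : test_function h -> 0 <= s <= 1 ->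
  measurable_fun setT (fun x => (normc (fracLaplacian s h x) ^+ 2)%:E).
Proof.
move=> th s1; have [h1 h2] := test_function_parts th.
have [e1 e2] := re_im_fracLaplacian th s1.
apply/measurable_EFinP; apply: mf_exp.
rewrite (_ : (fun x => _) = (fun x => Num.sqrt (re (fracLaplacian s h) x ^+ 2 +
    im (fracLaplacian s h) x ^+ 2))); last first.
  by apply/funext => x; rewrite /re /im; case: (fracLaplacian s h x).
by rewrite e1 e2; apply: mf_sqrt; apply: mf_add; apply: mf_exp;
  exact: measurable_real_fracLap.
Qed.

Lemma measurable_commutator s (u v : 'rV[R]_n.+1 -> R) : real_test u ->
  real_test v -> measurable_fun setT (commutator s u v).
Proof.
move=> tu tv; have mu_ := real_test_measurable tu; have mv := real_test_measurable tv.
have m w : real_test w -> measurable_fun setT (real_fracLap s w).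
  exact: measurable_real_fracLap.
apply: mf_add; last by apply: mf_opp; apply: mf_mul => //; exact: m.
apply: mf_add; last by apply: mf_opp; apply: mf_mul => //; exact: m.
by apply: m; exact: real_test_mul.
Qed.

Lemma measurable_sqr_normc_commutator alpha g h : 0 <= alpha <= 1 ->
  test_function g -> test_function h ->
  measurable_fun setT (fun x => (normc (complex_commutator alpha g h x) ^+ 2)%:E).
Proof.
move=> a1 tg th.
have [g1 g2] := test_function_parts tg; have [h1 h2] := test_function_parts th.
under eq_fun do rewrite /complex_commutator commutatorE//.
apply/measurable_EFinP; apply: mf_exp; apply: mf_sqrt.
apply: mf_add; apply: mf_exp; apply: mf_add => //;
  by [exact: measurable_commutator|apply: mf_opp; exact: measurable_commutator].
Qed.

(** Each of the two functions [re h], [im h] occurs in two of the four real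
    commutators, hence twice in the majorant. *)
Lemma complex_commutator_L2 alpha beta g h M N c : 0 < beta < 2 * alpha ->
  2 * alpha < 1 -> test_function g -> test_function h ->
  0 < M -> 0 < N -> 0 < c ->
  (\forall x \ae mu, normc (g x) <= M) ->
  (\forall x \ae mu, normc (fracLaplacian alpha g x) <= N) ->
  (\int[mu]_x (normc (fracLaplacian (beta / 2) h x) ^+ 2)%:E <= (c ^+ 2)%:E)%E ->
  (CLnorm 2%:E (complex_commutator alpha g h) <=
   (commutator_const beta (2 * alpha) * c *
      (N * (M / N) `^ (beta / (2 * alpha))))%:E)%E.
Proof.
move=> ba a1 tg th M0 N0 c0 gM fN hc.
have a01 : 0 <= alpha <= 1 by case/andP: ba => *; apply/andP; split; lra.
have [b0 ba'] := andP ba; set s := 2 * alpha in ba a1 ba' *.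
have s0 : 0 < s by exact: lt_trans ba'.
have s1 : 0 < s < 1 by rewrite s0.
have b1 : 0 < beta < 1 by rewrite b0 (lt_trans ba').
have bh : 0 <= beta / 2 <= 1 by apply/andP; split; case/andP: b1 => *; lra.
have [h1 h2] := test_function_parts th.
pose I := N * (M / N) `^ (beta / s).
have I0 : 0 <= I by rewrite mulr_ge0 ?powR_ge0// ltW.
pose K := bilinear_const s.
have K0 : 0 <= K by exact: bilinear_const_ge0.
pose S := interp_const n.+1 beta s * (diff_const beta + 1) * c * I.
have S0 : 0 <= S.
  apply: mulr_ge0 => //; apply: mulr_ge0; last exact: ltW.
  by rewrite mulr_ge0 ?interp_const_ge0// addr_ge0// diff_const_ge0.
have KE0 : (0 <= K%:E)%E by rewrite lee_fin.
have HS (u : 'rV[R]_n.+1 -> R) : real_test u ->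
    (forall x, `|real_fracLap beta u x| <= normc (fracLaplacian (beta / 2) h x)) ->
    (\int[mu]_x ((K%:E * weighted_difference M N s u x) *
       (K%:E * weighted_difference M N s u x)) <= ((K * S) ^+ 2)%:E)%E.
  move=> tu uh; have mw := measurable_weighted_difference s (ltW M0) (ltW N0)
    (real_test_measurable tu).
  have w0 x := @weighted_difference_ge0 M N s u x (ltW M0) (ltW N0).
  under eq_integral do rewrite muleACA.
  rewrite ge0_integralZl//; last 3 first.
  - exact: emeasurable_funM.
  - by move=> x _; exact: mule_ge0.
  - exact: mule_ge0.
  rewrite exprMn EFinM expr2 EFinM; apply: lee_wpmul2l; first exact: mule_ge0.
  apply: (weighted_difference_L2 ba a1 M0 N0 tu c0); apply: le_trans hc.
  have mf := measurable_real_fracLap beta tu.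
  apply: ge0_le_integral => //.
  - by move=> x _; rewrite lee_fin sqr_ge0.
  - by apply/measurable_EFinP; apply: mf_exp.
  - exact: measurable_sqr_normc_fracLaplacian th bh.
  - move=> x _; rewrite lee_fin -(real_normK (num_real _)) ler_sqr ?nnegrE//.
    exact: normc_ge0.
have [e1 e2] := re_im_fracLaplacian th bh.
have b2 : 2 * (beta / 2) = beta by field.
have A1 : forall x, `|real_fracLap beta (re h) x| <= normc (fracLaplacian (beta / 2) h x).
  by move=> x; rewrite -{1}b2 -e1; exact: normr_Re_le.
have A2 : forall x, `|real_fracLap beta (im h) x| <= normc (fracLaplacian (beta / 2) h x).
  by move=> x; rewrite -{1}b2 -e2; exact: normr_Im_le.
have H1 := HS _ h1 A1; have H2 := HS _ h2 A2.
pose W u x := majorant M N s u x.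
have W0 u x : (0 <= W u x)%E.
  by apply: mule_ge0 => //; exact: weighted_difference_ge0 (ltW M0) (ltW N0).
have mW u : real_test u -> measurable_fun setT (W u).
  move=> tu; apply: measurable_funeM.
  exact: measurable_weighted_difference (ltW M0) (ltW N0) (real_test_measurable tu).
have -> : commutator_const beta s * c * I = 4 * (K * S).
  by rewrite /commutator_const /S -/K; ring.
apply: CLnorm2_le; first by apply: mulr_ge0 => //; exact: mulr_ge0.
apply: (@le_trans _ _ (\int[mu]_x (8%:E * (W (re h) x * W (re h) x +
    W (im h) x * W (im h) x)))%E).
  apply: ge0_le_integral => //.
  - by move=> x _; rewrite lee_fin sqr_ge0.
  - exact: measurable_sqr_normc_commutator a01 tg th.
  - by apply: measurable_funeM; apply: emeasurable_funD; apply: emeasurable_funM; exact: mW.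
  move=> x _; apply: le_trans (sqr_add4_le (W0 _ x) (W0 _ x)).
  have H := normc_commutator_le x s1 tg th (ltW M0) (ltW N0) gM fN.
  by rewrite expr2 EFinM; apply: lee_pmul; rewrite ?lee_fin ?normc_ge0//; exact: H.
have m1 : measurable_fun setT (fun x => (W (re h) x * W (re h) x)%E).
  by apply: emeasurable_funM; exact: mW.
have m2 : measurable_fun setT (fun x => (W (im h) x * W (im h) x)%E).
  by apply: emeasurable_funM; exact: mW.
rewrite ge0_integralZl//; last 2 first.
- exact: emeasurable_funD.
- by move=> x _; apply: adde_ge0; exact: mule_ge0.
rewrite ge0_integralD//; last 2 first.
- by move=> x _; exact: mule_ge0.
- by move=> x _; exact: mule_ge0.
apply: le_trans (lee_wpmul2l _ (leeD H1 H2)) _ => //.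
rewrite -EFinD -EFinM lee_fin; move: (K * S) => P; rewrite le_eqVlt; apply/orP; left.
by apply/eqP; ring.
Qed.

End complex_commutator.

Lemma interpolation_powR (R : realType) (M N b s : R) : 0 < M -> 0 < N -> 0 < s ->
  N * (M / N) `^ (b / s) = M `^ (b / s) * N `^ ((s - b) / s).
Proof.
move=> M0 N0 s0; rewrite /powR !gt_eqF ?divr_gt0// -{1}[N]lnK ?posrE//.
rewrite ln_div ?posrE// -!expRD; congr expR.
by field; rewrite gt_eqF.
Qed.

Section endpoint_cases.
Context (R : realType) (n : nat).
Local Notation mu := (lebesgue_rV R n.+1).
Local Notation normc := (@ComplexField.Normc.normc R).
Implicit Types (g h : 'rV[R]_n.+1 -> R[i]) (alpha M N : R).

Lemma test_function_bounded g : test_function g ->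
  exists M, forall x, normc (g x) <= M.
Proof.
move=> tg; have [t1 t2] := test_function_parts tg.
have [_ [M1 [_ _ H1 _]]] := real_test_bounded t1.
have [_ [M2 [_ _ H2 _]]] := real_test_bounded t2.
by exists (M1 + M2) => x; rewrite (le_trans (normc_le_Re_Im _))// lerD//;
  [exact: H1|exact: H2].
Qed.

Lemma fracLaplacian_bounded alpha g : test_function g -> 0 <= alpha <= 1 ->
  exists N, forall x, normc (fracLaplacian alpha g x) <= N.
Proof.
move=> tg a1; have [t1 t2] := test_function_parts tg.
have a2 : 0 <= 2 * alpha <= 2 by case/andP: a1 => *; apply/andP; split; lra.
have [N1 H1] := real_fracLap_bounded t1 a2.
have [N2 H2] := real_fracLap_bounded t2 a2.
exists (N1 + N2) => x; rewrite (le_trans (normc_le_Re_Im _))// fracLaplacianE//=.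
by rewrite lerD.
Qed.

(** If [g] or its fractional Laplacian vanishes almost everywhere, then [g] is
    constant, and the commutator is zero. *)
Lemma complex_commutator_eq0 alpha g h M N x : 0 < 2 * alpha < 1 ->
  test_function g -> test_function h -> 0 <= M -> 0 <= N -> M * N = 0 ->
  (\forall x \ae mu, normc (g x) <= M) ->
  (\forall x \ae mu, normc (fracLaplacian alpha g x) <= N) ->
  normc (complex_commutator alpha g h x) = 0.
Proof.
move=> s1 tg th M0 N0 MN gM fN; have s0 : 2 * alpha != 0 by case/andP: s1 => /gt_eqF ->.
have W0 y : interp_weight M N (2 * alpha) y = 0.
  have N1 : 0 <= N * enorm y `^ (2 * alpha) by rewrite mulr_ge0 ?powR_ge0.
  move/eqP : MN; rewrite mulf_eq0 /interp_weight => /orP[/eqP E|/eqP E].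
    by rewrite E; apply/min_idPl.
  by rewrite E mul0r; apply/min_idPr.
have D0 (u : 'rV[R]_n.+1 -> R) : majorant M N (2 * alpha) u x = 0%E.
  rewrite /majorant /weighted_difference integral0_eq ?mule0// => p _.
  by rewrite /weighted_kernel W0 !mulr0.
have := normc_commutator_le x s1 tg th M0 N0 gM fN.
rewrite !D0 !adde0 lee_fin => H; apply/eqP; rewrite eq_le H/=.
exact: normc_ge0.
Qed.

End endpoint_cases.

Theorem theorem1p2 (R : realType) (d : nat) (alpha beta : R)
    (hd : (1 <= d)%N) (hbeta : 0 < beta) (hba : beta <= alpha)
    (halpha : alpha < 2^-1) :
  exists2 C : R, 0 < C & forall g h : 'rV[R]_d -> R[i],
    test_function g -> test_function h ->
    (CLnorm 2%:E (fun x => fracLaplacian alpha (fun y => g y * h y)%R x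
         - g x * fracLaplacian alpha h x - h x * fracLaplacian alpha g x)%R
     <= C%:E * CLnorm 2%:E (fracLaplacian (beta / 2) h)
        * CLnorm +oo g `^ (beta / (2 * alpha))
        * CLnorm +oo (fracLaplacian alpha g)
            `^ ((2 * alpha - beta) / (2 * alpha)))%E.
Proof.
case: d hd => [//|n] _.
have s1 : 0 < 2 * alpha < 1 by apply/andP; split; lra.
have ba : 0 < beta < 2 * alpha by apply/andP; split; lra.
have b1 : 0 < beta < 1 by apply/andP; split; lra.
have a1 : 0 <= alpha <= 1 by apply/andP; split; lra.
have [s0 s1'] := andP s1.
set s := 2 * alpha in s1 ba s0 s1' *.
have K0 := commutator_const_ge0 n b1 s1.
set K := commutator_const n beta s in K0.
have K1 : 0 < K + 1 by rewrite ltr_wpDl.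
exists (K + 1) => // g h tg th.
have [Mg HMg] := test_function_bounded tg.
have [Ng HNg] := fracLaplacian_bounded tg a1.
have [M M0 eM] := CLnormy_fin HMg; have [N N0 eN] := CLnormy_fin HNg.
have gM : \forall x \ae lebesgue_rV R n.+1, ComplexField.Normc.normc (g x) <= M.
  by have := CLnormy_ge g; apply: filterS => x; rewrite eM lee_fin.
have fN : \forall x \ae lebesgue_rV R n.+1,
    ComplexField.Normc.normc (fracLaplacian alpha g x) <= N.
  by have := CLnormy_ge (fracLaplacian alpha g); apply: filterS => x; rewrite eN lee_fin.
have h0 : (0 <= CLnorm 2%:E (fracLaplacian (beta / 2) h))%E by exact: Lnorm_ge0.
rewrite eM eN !poweR_EFin.
change (CLnorm 2%:E (complex_commutator alpha g h) <=
  (K + 1)%:E * CLnorm 2%:E (fracLaplacian (beta / 2) h) * (M `^ (beta / s))%:E *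
  (N `^ ((s - beta) / s))%:E)%E.
have [MN|] := eqVneq (M * N) 0.
  apply: (@le_trans _ _ 0%:E).
    apply: CLnorm2_le => //; rewrite integral0_eq ?lee_fin ?expr0n// => x _.
    by rewrite (complex_commutator_eq0 x s1 tg th M0 N0 MN gM fN) expr0n.
  by rewrite !mule_ge0// lee_fin ?powR_ge0// ltW.
rewrite mulf_eq0 negb_or => /andP[Mn0 Nn0].
have {}M0 : 0 < M by rewrite lt_neqAle eq_sym Mn0.
have {}N0 : 0 < N by rewrite lt_neqAle eq_sym Nn0.
have Ma : 0 < M `^ (beta / s) by exact: powR_gt0.
have Na : 0 < N `^ ((s - beta) / s) by exact: powR_gt0.
case E : (CLnorm 2%:E (fracLaplacian (beta / 2) h)) h0 => [r| |]//; last first.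
  by move=> _; rewrite gt0_muley ?lte_fin// gt0_mulye ?lte_fin// gt0_mulye ?lte_fin// leey.
rewrite lee_fin => r0.
pose P := M `^ (beta / s) * N `^ ((s - beta) / s).
have P0 : 0 < P by exact: mulr_gt0.
(* The estimate needs a positive bound for the norm of the differentiated [h],
   which may be zero. *)
apply/lee_addgt0Pr => e e0; pose c := r + e / ((K + 1) * P).
have d0 : 0 < e / ((K + 1) * P) by rewrite divr_gt0// mulr_gt0.
have c0 : 0 < c by exact: ltr_wpDl.
have hc : (\int[lebesgue_rV R n.+1]_x
    (ComplexField.Normc.normc (fracLaplacian (beta / 2) h x) ^+ 2)%:E <= (c ^+ 2)%:E)%E.
  by rewrite -CLnorm2_sqr E -EFinM lee_fin -expr2 ler_sqr ?nnegrE ?(ltW c0)// lerDl ltW.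
have H := complex_commutator_L2 ba s1' tg th M0 N0 c0 gM fN hc.
apply: (le_trans H); rewrite interpolation_powR// -!EFinM -EFinD lee_fin.
have -> : (K + 1) * r * M `^ (beta / s) * N `^ ((s - beta) / s) + e = (K + 1) * c * P.
  by rewrite -[_ * r * _ * _]mulrA -/P /c; field; rewrite !gt_eqF.
rewrite -/P ler_wpM2r ?(ltW P0)// ler_wpM2r ?(ltW c0)//.
by rewrite lerDl.
Qed.
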